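(* Let $R$ be a commutative ring. The set $\mathrm{Br}^c_{\rm fl}(R)$ of Brauer equivalence classes of (isomorphism classes of) Azumaya corings over $R$ is an abelian group under the operation induced by the tensor product $\otimes_R$, with unit element $[R]$ (the class of $(R,R)$).
   Context: All algebras $S,T$ are commutative; $\otimes=\otimes_R$. The map $\eta_i:S^{\otimes 2}\to S^{\otimes 3}$ ($i=1,2,3$) inserts $1$ in the $i$-th position; for an $S\otimes S$-module $M$, $M_i=M\otimes_{S^{\otimes 2},\eta_i}S^{\otimes3}$ and $m_i=m\otimes1\in M_i$. An $S\otimes S$-module is viewed as an $S$-bimodule via $smt=(s\otimes t)m$. An $S/R$-coring is an $S\otimes S$-module $\mathcal C$ with $S$-bimodule maps $\Delta:\mathcal C\to\mathcal C\otimes_S\mathcal C$, $\Delta(c)=c_{(1)}\otimes_S c_{(2)}$, and $\varepsilon:\mathcal C\to S$ satisfying coassociativity and the counit property. To $\Delta$ corresponds the $S^{\otimes 3}$-linear map $\tilde\Delta:\mathcal C_2\to\mathcal C_3\otimes_{S^{\otimes3}}\mathcal C_1$, $\tilde\Delta(c_2)=c_{(1)3}\otimes c_{(2)1}$. For $S$ faithfully flat over $R$, an Azumaya $S/R$-coring is an $S/R$-coring that is faithfully projective (finitely generated, projective, faithful) as an $S\otimes S$-module and such that $\tilde\Delta$ is an isomorphism. For an invertible $S$-module $I$, the elementary coring $\mathrm{Can}_R(I;S)$ is $I^*\otimes I$ with $\Delta(f\otimes x)=\sum_i (f\otimes e_i)\otimes_S(f_i\otimes x)$, $\varepsilon(f\otimes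 x)=f(x)$, where $\{(e_i,f_i)\}$ is a finite dual basis of $I$. An Azumaya coring over $R$ is a pair $(S,\mathcal C)$ with $S$ a faithfully flat finitely presented commutative $R$-algebra and $\mathcal C$ an Azumaya $S/R$-coring. An isomorphism $(S,\mathcal C)\to(T,\mathcal D)$ is a pair $(f,\varphi)$ with $f:S\to T$ an $R$-algebra isomorphism and $\varphi:\mathcal C\to\mathcal D$ an $R$-module isomorphism with $\varphi(scs')=f(s)\varphi(c)f(s')$ and $\Delta_{\mathcal D}(\varphi(c))=\varphi(c_{(1)})\otimes_T\varphi(c_{(2)})$. The tensor product is $(S,\mathcal C)\otimes(T,\mathcal D)=(S\otimes T,\mathcal C\otimes\mathcal D)$ with the obvious structure maps. $(S,\mathcal C)$ and $(T,\mathcal D)$ are Brauer equivalent if $\mathcal C\otimes\mathcal E_1\cong\mathcal D\otimes\mathcal E_2$ as Azumaya corings over $R$, for some elementary corings $\mathcal E_1,\mathcal E_2$ over $R$ (Azumaya corings over $R$ of the form $(U,\mathrm{Can}_R(I;U))$). This is an equivalence relation. *)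

(* Defs.v *)
From HB Require Import structures.
From mathcomp Require Import all_boot all_order all_algebra.
From mathcomp Require Import boolp.

Set Implicit Arguments.
Unset Strict Implicit.
Unset Printing Implicit Defensive.

Import GRing.Theory.

Local Open Scope ring_scope.
Local Open Scope quotient_scope.

(* Rings and algebras may be zero: everything is stated over comPzRingType,
   and a commutative R-algebra is a ring with a structure morphism, because
   comAlgType only covers nonzero algebras over nonzero rings. *)

Definition restr (A B : comPzRingType) (f : {rmorphism A -> B})
  (M : lmodType B) : Type := M.

Section Restr.
Variables (A B : comPzRingType) (f : {rmorphism A -> B}) (M : lmodType B).

HB.instance Definition _ := GRing.Zmodule.on (restr f M).

Definition restr_scale (a : A) (m : restr f M) : restr f M :=
  f a *: (m : M).

Fact restr_scaleA a b m :
  restr_scale a (restr_scale b m) = restr_scale (a * b) m.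
Proof. by rewrite /restr_scale rmorphM scalerA. Qed.

Fact restr_scale1 : left_id 1 restr_scale.
Proof. by move=> m; rewrite /restr_scale rmorph1 scale1r. Qed.

Fact restr_scaleDr : right_distributive restr_scale +%R.
Proof. by move=> a m n; rewrite /restr_scale scalerDr. Qed.

Fact restr_scaleDl m : {morph restr_scale^~ m : a b / a + b}.
Proof. by move=> a b; rewrite /restr_scale rmorphD scalerDl. Qed.

HB.instance Definition _ := GRing.Zmodule_isLmodule.Build A (restr f M)
  restr_scaleA restr_scale1 restr_scaleDr restr_scaleDl.

End Restr.

(* Tensor product over A of a B-module M and a C-module N, for f : A -> B and
   g : A -> C: formal sums of pairs modulo the congruence below. The relation
   tens_rel_0l turns the quotient into a group, with -(m, n) = (-m, n). *)
Section Tensor.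
Variables (A B C : comPzRingType).
Variables (f : {rmorphism A -> B}) (g : {rmorphism A -> C}).
Variables (M : lmodType B) (N : lmodType C).

Inductive tens_rel : seq (M * N) -> seq (M * N) -> Prop :=
| tens_rel_refl s : tens_rel s s
| tens_rel_sym s t : tens_rel s t -> tens_rel t s
| tens_rel_trans s t u : tens_rel s t -> tens_rel t u -> tens_rel s u
| tens_rel_cat s s' t t' :
    tens_rel s s' -> tens_rel t t' -> tens_rel (s ++ t) (s' ++ t')
| tens_rel_comm s t : tens_rel (s ++ t) (t ++ s)
| tens_rel_0l n : tens_rel [:: (0, n)] [::]
| tens_rel_Dl m m' n : tens_rel [:: (m + m', n)] [:: (m, n); (m', n)]
| tens_rel_Dr m n n' : tens_rel [:: (m, n + n')] [:: (m, n); (m, n')]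
| tens_rel_Z a m n : tens_rel [:: (f a *: m, n)] [:: (m, g a *: n)].

Definition tens_equiv : rel (seq (M * N)) := fun s t => `[< tens_rel s t >].

Fact tens_equiv_equiv : equiv_class_of tens_equiv.
Proof.
split=> [s|s t|s t u].
- exact/asboolP/tens_rel_refl.
- by apply/asboolP/asboolP; apply: tens_rel_sym.
- move=> /asboolP H /asboolP K; apply/asboolP; exact: tens_rel_trans H K.
Qed.

Canonical tens_equiv_rel := EquivRelPack tens_equiv_equiv.

Definition tens : Type := {eq_quot tens_equiv_rel}.

HB.instance Definition _ := Choice.on tens.
HB.instance Definition _ := EqQuotient.on tens.

Definition tens_cls (s : seq (M * N)) : tens := \pi_tens s.

Lemma tens_clsP s t : tens_cls s = tens_cls t <-> tens_rel s t.
Proof.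
by split=> [/eqmodP/asboolP|H] //; apply/eqmodP/asboolP.
Qed.

Lemma tens_clsK x : tens_cls (repr x) = x.
Proof. exact: reprK. Qed.

Lemma tens_repr_rel s : tens_rel (repr (tens_cls s)) s.
Proof. by apply/tens_clsP; rewrite tens_clsK. Qed.

Definition tens_opp_seq (s : seq (M * N)) := [seq (- p.1, p.2) | p <- s].

Lemma tens_opp_rel s t :
  tens_rel s t -> tens_rel (tens_opp_seq s) (tens_opp_seq t).
Proof.
elim=> {s t} [s|s t _|s t u _ + _|s s' t t' _ H _ K|s t|n|m m' n|m n n'|a m n].
- exact: tens_rel_refl.
- exact: tens_rel_sym.
- exact: tens_rel_trans.
- by rewrite /tens_opp_seq !map_cat; apply: tens_rel_cat.
- by rewrite /tens_opp_seq !map_cat; apply: tens_rel_comm.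
- by rewrite /= oppr0; apply: tens_rel_0l.
- by rewrite /= opprD; apply: tens_rel_Dl.
- exact: tens_rel_Dr.
- by rewrite /= -scalerN; apply: tens_rel_Z.
Qed.

Definition tens_add (x y : tens) : tens := tens_cls (repr x ++ repr y).
Definition tens_opp (x : tens) : tens := tens_cls (tens_opp_seq (repr x)).
Definition tens_zero : tens := tens_cls [::].

Lemma tens_addE s t : tens_add (tens_cls s) (tens_cls t) = tens_cls (s ++ t).
Proof. by apply/tens_clsP/tens_rel_cat; apply: tens_repr_rel. Qed.

Lemma tens_oppE s : tens_opp (tens_cls s) = tens_cls (tens_opp_seq s).
Proof. by apply/tens_clsP/tens_opp_rel/tens_repr_rel. Qed.

Fact tens_addA : associative tens_add.
Proof.
move=> x y z; rewrite -(tens_clsK x) -(tens_clsK y) -(tens_clsK z).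
by rewrite !tens_addE catA.
Qed.

Fact tens_addC : commutative tens_add.
Proof. by move=> x y; apply/tens_clsP/tens_rel_comm. Qed.

Fact tens_add0 : left_id tens_zero tens_add.
Proof. by move=> x; rewrite -(tens_clsK x) tens_addE. Qed.

Fact tens_addN : left_inverse tens_zero tens_opp tens_add.
Proof.
move=> x; rewrite -(tens_clsK x) tens_oppE tens_addE; apply/tens_clsP.
elim: (repr x) => [|[m n] s IHs] /=; first exact: tens_rel_refl.
apply: (@tens_rel_trans _ ([:: (- m, n); (m, n)] ++ (tens_opp_seq s ++ s))).
  rewrite -[_ :: _ ++ _]/([:: (- m, n)] ++ (tens_opp_seq s ++ [:: (m, n)] ++ s)).
  rewrite -[[:: _; _] ++ _]/([:: (- m, n)] ++ ([:: (m, n)] ++ (tens_opp_seq s ++ s))).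
  apply: tens_rel_cat; first exact: tens_rel_refl.
  by rewrite !catA; apply: tens_rel_cat; [exact: tens_rel_comm | exact: tens_rel_refl].
rewrite -[X in tens_rel _ X]/([::] ++ [::]); apply: tens_rel_cat => //.
apply: tens_rel_trans (tens_rel_sym (tens_rel_Dl _ _ _)) _.
by rewrite addNr; apply: tens_rel_0l.
Qed.

HB.instance Definition _ := GRing.isZmodule.Build tens
  tens_addA tens_addC tens_add0 tens_addN.

Definition tpure (m : M) (n : N) : tens := tens_cls [:: (m, n)].

Lemma tpureDl n : {morph tpure^~ n : m m' / m + m'}.
Proof.
by move=> m m'; rewrite -[RHS]/(tens_add _ _) tens_addE; apply/tens_clsP/tens_rel_Dl.
Qed.

Lemma tpureDr m : {morph tpure m : n n' / n + n'}.
Proof.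
by move=> n n'; rewrite -[RHS]/(tens_add _ _) tens_addE; apply/tens_clsP/tens_rel_Dr.
Qed.

Lemma tpureZ a m n : tpure (f a *: m) n = tpure m (g a *: n).
Proof. exact/tens_clsP/tens_rel_Z. Qed.

Lemma tens_clsE s : tens_cls s = \sum_(p <- s) tpure p.1 p.2.
Proof.
elim: s => [|p s IHs]; first by rewrite big_nil.
rewrite big_cons -IHs -[RHS]/(tens_add _ _) tens_addE.
by case: p.
Qed.

Lemma tens_ind (Q : tens -> Prop) :
  Q 0 -> (forall x y, Q x -> Q y -> Q (x + y)) ->
  (forall m n, Q (tpure m n)) -> forall x, Q x.
Proof.
move=> Q0 QD Qp x; rewrite -(tens_clsK x) tens_clsE.
elim: (repr x) => [|p s IHs]; first by rewrite big_nil.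
by rewrite big_cons; apply: QD.
Qed.

Record balanced (P : zmodType) (b : M -> N -> P) : Prop := Balanced {
  balDl : forall m m' n, b (m + m') n = b m n + b m' n;
  balDr : forall m n n', b m (n + n') = b m n + b m n';
  balZ : forall a m n, b (f a *: m) n = b m (g a *: n) }.

(* tlift b is the map m (x) n |-> b m n. It is defined for every b, by means
   of a chosen representative, so that formulas may be written without
   carrying proofs; it is meaningful when b is balanced (tlift_pure). *)
Definition tlift (P : zmodType) (b : M -> N -> P) (x : tens) : P :=
  \sum_(p <- repr x) b p.1 p.2.

Section LiftTheory.
Variables (P : zmodType) (b : M -> N -> P).
Hypothesis b_bal : balanced b.

Lemma tens_rel_sum s t : tens_rel s t ->
  \sum_(p <- s) b p.1 p.2 = \sum_(p <- t) b p.1 p.2.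
Proof.
elim=> {s t} //.
- by move=> s t u _ -> _ ->.
- by move=> s s' t t' _ Hs _ Ht; rewrite !big_cat Hs Ht.
- by move=> s t; rewrite !big_cat /= addrC.
- move=> n; rewrite big_seq1 big_nil /=.
  by apply: (@addrI _ (b 0 n)); rewrite -balDl // !addr0.
- by move=> m m' n; rewrite big_seq1 big_cons big_seq1 /= balDl.
- by move=> m n n'; rewrite big_seq1 big_cons big_seq1 /= balDr.
- by move=> a m n; rewrite !big_seq1 /= balZ.
Qed.

Lemma tlift_cls s : tlift b (tens_cls s) = \sum_(p <- s) b p.1 p.2.
Proof. exact: tens_rel_sum (tens_repr_rel s). Qed.

Lemma tlift_pure m n : tlift b (tpure m n) = b m n.
Proof. by rewrite tlift_cls big_seq1. Qed.

Lemma tliftD : {morph tlift b : x y / x + y}.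
Proof.
move=> x y; rewrite -(tens_clsK x) -(tens_clsK y).
by rewrite -[LHS]/(tlift b (tens_add _ _)) tens_addE !tlift_cls big_cat.
Qed.

Lemma tlift0 : tlift b 0 = 0.
Proof. by rewrite -[0]/(tens_cls [::]) tlift_cls big_nil. Qed.

End LiftTheory.

End Tensor.

Section TensorAction.
Variables (A B C : comPzRingType).
Variables (f : {rmorphism A -> B}) (g : {rmorphism A -> C}).

Definition tensR : Type := tens f g B^o C^o.
HB.instance Definition _ := GRing.Zmodule.on tensR.

Section Action.
Variables (M : lmodType B) (N : lmodType C).

Definition tens_act1 (b : B) (c : C) (y : tens f g M N) : tens f g M N :=
  tlift (fun m n => tpure f g (b *: m) (c *: n)) y.

(* (b (x) c) . (m (x) n) = b m (x) c n *)
Definition tens_act (x : tensR) (y : tens f g M N) : tens f g M N :=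
  tlift (fun (b : B^o) (c : C^o) => tens_act1 b c y) x.

Fact tens_act1_bal b c : balanced f g
  (fun (m : M) (n : N) => tpure f g (b *: m) (c *: n)).
Proof.
split=> [m m' n|m n n'|a m n].
- by rewrite scalerDr tpureDl.
- by rewrite scalerDr tpureDr.
- by rewrite !scalerA [b * _]mulrC [c * _]mulrC -!scalerA tpureZ.
Qed.

Fact tens_act1_pure b c m n :
  tens_act1 b c (tpure f g m n) = tpure f g (b *: m) (c *: n).
Proof. exact: (tlift_pure (tens_act1_bal b c)). Qed.

Fact tens_act1D b c : {morph tens_act1 b c : x y / x + y}.
Proof. exact: (tliftD (tens_act1_bal b c)). Qed.

Fact tens_act1_0 b c : tens_act1 b c 0 = 0.
Proof. exact: (tlift0 (tens_act1_bal b c)). Qed.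

Fact tens_act_bal y : balanced f g
  (fun (b : B^o) (c : C^o) => tens_act1 b c y).
Proof.
split.
- move=> b b' c; elim/tens_ind: y => [|x y IHx IHy|m n].
  + by rewrite !tens_act1_0 addr0.
  + by rewrite !tens_act1D IHx IHy addrACA.
  + by rewrite !tens_act1_pure scalerDl tpureDl.
- move=> b c c'; elim/tens_ind: y => [|x y IHx IHy|m n].
  + by rewrite !tens_act1_0 addr0.
  + by rewrite !tens_act1D IHx IHy addrACA.
  + by rewrite !tens_act1_pure scalerDl tpureDr.
- move=> a b c; elim/tens_ind: y => [|x y IHx IHy|m n].
  + by rewrite !tens_act1_0.
  + by rewrite !tens_act1D IHx IHy.
  + by rewrite !tens_act1_pure -!scalerA tpureZ.
Qed.

Lemma tens_act_pure (b : B^o) (c : C^o) m n :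
  tens_act (tpure f g b c) (tpure f g m n) =
  tpure f g ((b : B) *: m) ((c : C) *: n).
Proof. by rewrite /tens_act (tlift_pure (tens_act_bal _)) tens_act1_pure. Qed.

Fact tens_actDl y : {morph tens_act^~ y : x x' / x + x'}.
Proof. exact: (tliftD (tens_act_bal y)). Qed.

Fact tens_act0l y : tens_act 0 y = 0.
Proof. exact: (tlift0 (tens_act_bal y)). Qed.

Fact tens_actDr : right_distributive tens_act +%R.
Proof.
move=> x y y'; elim/tens_ind: x => [|x x' IHx IHx'|b c].
- by rewrite !tens_act0l addr0.
- by rewrite !tens_actDl IHx IHx' addrACA.
- by rewrite /tens_act !(tlift_pure (tens_act_bal _)) tens_act1D.
Qed.

Fact tens_act0r x : tens_act x 0 = 0.
Proof. by apply: (@addrI _ (tens_act x 0)); rewrite -tens_actDr !addr0. Qed.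

Fact tens_act1r : left_id (tpure f g (1 : B^o) (1 : C^o)) tens_act.
Proof.
elim/tens_ind=> [|x y IHx IHy|m n].
- by rewrite tens_act0r.
- by rewrite tens_actDr IHx IHy.
- by rewrite tens_act_pure !scale1r.
Qed.

End Action.

Definition tensR_one : tensR := tpure f g (1 : B^o) (1 : C^o).
Definition tensR_mul (x y : tensR) : tensR := tens_act x y.

Lemma tens_actA (M : lmodType B) (N : lmodType C) x y (z : tens f g M N) :
  tens_act x (tens_act y z) = tens_act (tensR_mul x y) z.
Proof.
rewrite /tensR_mul; elim/tens_ind: z => [|z z' IHz IHz'|m n].
- by rewrite !tens_act0r.
- by rewrite !tens_actDr IHz IHz'.
elim/tens_ind: y => [|y y' IHy IHy'|b c].
- by rewrite tens_act0r !tens_act0l tens_act0r.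
- by rewrite !(tens_actDl, tens_actDr) IHy IHy'.
elim/tens_ind: x => [|x x' IHx IHx'|b' c'].
- by rewrite !tens_act0l.
- by rewrite !tens_actDl IHx IHx'.
by rewrite !tens_act_pure !scalerA.
Qed.

Fact tensR_mulC : commutative tensR_mul.
Proof.
move=> x y; rewrite /tensR_mul; elim/tens_ind: x => [|x x' IHx IHx'|b c].
- by rewrite tens_act0l tens_act0r.
- by rewrite tens_actDl tens_actDr IHx IHx'.
elim/tens_ind: y => [|y y' IHy IHy'|b' c'].
- by rewrite tens_act0l tens_act0r.
- by rewrite tens_actDl tens_actDr IHy IHy'.
rewrite !tens_act_pure; congr (tpure f g _ _); exact: mulrC.
Qed.

Fact tensR_mulA : associative tensR_mul.
Proof. by move=> x y z; rewrite /tensR_mul tens_actA. Qed.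

Fact tensR_mul1 : left_id tensR_one tensR_mul.
Proof. exact: tens_act1r. Qed.

Fact tensR_mulDl : left_distributive tensR_mul +%R.
Proof. by move=> x y z; exact: tens_actDl. Qed.

HB.instance Definition _ := GRing.Zmodule_isComPzRing.Build tensR
  tensR_mulA tensR_mulC tensR_mul1 tensR_mulDl.

HB.instance Definition _ (M : lmodType B) (N : lmodType C) :=
  GRing.Zmodule_isLmodule.Build tensR (tens f g M N)
    (@tens_actA M N) (@tens_act1r M N) (@tens_actDr M N) (@tens_actDl M N).

Definition rpure (b : B) (c : C) : tensR := tpure f g (b : B^o) (c : C^o).

Lemma rpureM b c b' c' : rpure b c * rpure b' c' = rpure (b * b') (c * c').
Proof. exact: tens_act_pure. Qed.

Lemma scale_rpure (M : lmodType B) (N : lmodType C) b c (m : M) (n : N) :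
  rpure b c *: tpure f g m n = tpure f g (b *: m) (c *: n).
Proof. exact: tens_act_pure. Qed.

Definition tinl (b : B) : tensR := rpure b 1.
Definition tinr (c : C) : tensR := rpure 1 c.

Fact tinl_zmod_morphism : zmod_morphism tinl.
Proof.
move=> b b'; apply/eqP; rewrite eq_sym subr_eq /tinl /rpure -tpureDl.
by rewrite -[in X in tpure _ _ X](subrK b' b).
Qed.

Fact tinl_monoid_morphism : monoid_morphism tinl.
Proof. by split=> // b b'; rewrite /tinl rpureM mulr1. Qed.

HB.instance Definition _ := GRing.isZmodMorphism.Build B tensR tinl
  tinl_zmod_morphism.
HB.instance Definition _ := GRing.isMonoidMorphism.Build B tensR tinl
  tinl_monoid_morphism.

Fact tinr_zmod_morphism : zmod_morphism tinr.
Proof.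
move=> b b'; apply/eqP; rewrite eq_sym subr_eq /tinr /rpure -tpureDr.
by rewrite -[in X in tpure _ _ _ X](subrK b' b).
Qed.

Fact tinr_monoid_morphism : monoid_morphism tinr.
Proof. by split=> // b b'; rewrite /tinr rpureM mulr1. Qed.

HB.instance Definition _ := GRing.isZmodMorphism.Build C tensR tinr
  tinr_zmod_morphism.
HB.instance Definition _ := GRing.isMonoidMorphism.Build C tensR tinr
  tinr_monoid_morphism.

Lemma tinlr a : tinl (f a) = tinr (g a).
Proof.
have := tpureZ f g a (1 : B^o) (1 : C^o).
by rewrite /tinl /tinr /rpure /GRing.scale /= !mulr1.
Qed.

Section RingLift.
Variables (E : comPzRingType).
Variables (h : {rmorphism B -> E}) (k : {rmorphism C -> E}).
Hypothesis hk : forall a, h (f a) = k (g a).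

Definition rlift of (forall a, h (f a) = k (g a)) : tensR -> E :=
  tlift (fun (b : B^o) (c : C^o) => h b * k c).

Fact rlift_bal : balanced f g (fun (b : B^o) (c : C^o) => h b * k c).
Proof.
split=> [b b' c|b c c'|a b c].
- by rewrite rmorphD mulrDl.
- by rewrite rmorphD mulrDr.
- by rewrite /GRing.scale /= !rmorphM hk mulrAC mulrC mulrA.
Qed.

Lemma rlift_pure b c : rlift hk (rpure b c) = h b * k c.
Proof. exact: (tlift_pure rlift_bal). Qed.

Fact rlift_zmod_morphism : zmod_morphism (rlift hk).
Proof.
move=> x y; apply/eqP; rewrite eq_sym subr_eq; apply/eqP.
by rewrite -(tliftD rlift_bal) subrK.
Qed.

Fact rlift_monoid_morphism : monoid_morphism (rlift hk).
Proof.
have lD := tliftD rlift_bal; have l0 := tlift0 rlift_bal.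
split; first by rewrite -[1]/(rpure 1 1) rlift_pure !rmorph1 mulr1.
move=> x y; elim/tens_ind: x => [|x x' IHx IHx'|b c].
- by rewrite mul0r /rlift l0 mul0r.
- by rewrite mulrDl /rlift !lD mulrDl -/(rlift hk) IHx IHx'.
elim/tens_ind: y => [|y y' IHy IHy'|b' c'].
- by rewrite mulr0 /rlift l0 mulr0.
- by rewrite mulrDr /rlift !lD mulrDr -/(rlift hk) IHy IHy'.
rewrite -!/(rpure _ _) rpureM !rlift_pure !rmorphM.
by rewrite mulrACA.
Qed.

HB.instance Definition _ := GRing.isZmodMorphism.Build tensR E (rlift hk)
  rlift_zmod_morphism.
HB.instance Definition _ := GRing.isMonoidMorphism.Build tensR E (rlift hk)
  rlift_monoid_morphism.

End RingLift.

End TensorAction.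

Record ralg (R : comPzRingType) : Type := Ralg {
  ralg_ring :> comPzRingType;
  ralg_str : {rmorphism R -> ralg_ring} }.

Definition exact_seq (U V W : zmodType) (u : U -> V) (v : V -> W) : Prop :=
  forall y, v y = 0 <-> exists x, u x = y.

Definition faithfully_flat (R : comPzRingType) (S : ralg R) : Prop :=
  forall (U V W : lmodType R) (u : {linear U -> V}) (v : {linear V -> W}),
    let ext (X Y : lmodType R) (h : X -> Y) :=
      tlift (fun (s : S^o) (x : X) => tpure (ralg_str S) idfun s (h x)) in
    exact_seq u v <-> exact_seq (ext U V u) (ext V W v).

(* Polynomials in n variables, as formal sums of terms (coefficient, exponent);
   two of them are the same polynomial when all their coefficients agree.
   The library's {mpoly R[n]} requires R to be nonzero. *)
Section Polynomials.
Variables (R : comPzRingType) (n : nat).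

Definition mpol : Type := seq (R * {ffun 'I_n -> nat}).

Definition mpol_coef (p : mpol) (e : {ffun 'I_n -> nat}) : R :=
  \sum_(t <- p | t.2 == e) t.1.

Definition mpol_mul (p q : mpol) : mpol :=
  [seq (t.1 * t'.1, [ffun i => (t.2 i + t'.2 i)%N])
  | t : R * {ffun 'I_n -> nat} <- p, t' : R * {ffun 'I_n -> nat} <- q].

Definition mpol_eval (S : ralg R) (x : 'I_n -> S) (p : mpol) : S :=
  \sum_(t <- p) ralg_str S t.1 * \prod_(i < n) x i ^+ t.2 i.

Definition mpol_in_ideal (m : nat) (F : 'I_m -> mpol) (p : mpol) : Prop :=
  exists Q : 'I_m -> mpol,
    forall e, mpol_coef p e = \sum_(j < m) mpol_coef (mpol_mul (Q j) (F j)) e.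

End Polynomials.

(* S = R[X_1, ..., X_n] / (F_1, ..., F_m) *)
Definition finitely_presented (R : comPzRingType) (S : ralg R) : Prop :=
  exists (n : nat) (x : 'I_n -> S) (m : nat) (F : 'I_m -> mpol R n),
    (forall s, exists p, mpol_eval x p = s) /\
    (forall p, mpol_eval x p = 0 <-> mpol_in_ideal F p).

Section Modules.
Variables (A : comPzRingType) (M : lmodType A).

Definition fin_gen : Prop :=
  exists (n : nat) (e : 'I_n -> M),
    forall x, exists a : 'I_n -> A, x = \sum_(i < n) a i *: e i.

Definition projective : Prop :=
  forall (U V : lmodType A) (p : {linear U -> V}) (h : {linear M -> V}),
    (forall y, exists x, p x = y) ->
    exists k : {linear M -> U}, forall x, p (k x) = h x.

Definition faithful : Prop :=
  forall a : A, (forall x : M, a *: x = 0) -> a = 0.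

Definition faithfully_projective : Prop :=
  [/\ fin_gen, projective & faithful].

(* M (x)_A N as an A-module *)
Definition tensA (N : lmodType A) : lmodType A :=
  restr (tinl idfun idfun) (tens idfun idfun M N).

Definition invertible : Prop :=
  exists (N : lmodType A) (h : {linear tensA N -> A^o}), bijective h.

Definition dual : Type := {linear M -> A^o}.

Definition dual_mk (h : M -> A^o) (hl : linear h) : dual :=
  HB.pack h (GRing.isLinear.Build A M A^o *:%R h hl).

Lemma dual_mkE h hl : dual_mk (h := h) hl =1 h.
Proof. by []. Qed.

Lemma dual_ext (u v : dual) : u =1 v -> u = v.
Proof.
case: u => u [[uN] [uZ]]; case: v => v [[vN] [vZ]] /= uv.
have {}uv : u = v by apply: funext.
subst v; do 2 f_equal; f_equal; exact: Prop_irrelevance.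
Qed.

HB.instance Definition _ := gen_eqMixin dual.
HB.instance Definition _ := gen_choiceMixin dual.

Fact dual_zero_linear : linear (fun _ : M => 0 : A^o).
Proof. by move=> a x y; rewrite scaler0 addr0. Qed.

Fact dual_opp_linear (u : dual) : linear (fun x => - u x : A^o).
Proof. by move=> a x y; rewrite linearP opprD scalerN. Qed.

Fact dual_add_linear (u v : dual) : linear (fun x => u x + v x : A^o).
Proof. by move=> a x y; rewrite !linearP scalerDr addrACA. Qed.

Fact dual_scale_linear (a : A) (u : dual) : linear (fun x => a *: u x : A^o).
Proof.
by move=> b x y; rewrite linearP scalerDr !scalerA [a * b]mulrC.
Qed.

Definition dual_zero := dual_mk dual_zero_linear.
Definition dual_opp u := dual_mk (dual_opp_linear u).
Definition dual_add u v := dual_mk (dual_add_linear u v).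
Definition dual_scale a u := dual_mk (dual_scale_linear a u).

Fact dual_addA : associative dual_add.
Proof. by move=> u v w; apply: dual_ext => x; exact: addrA. Qed.

Fact dual_addC : commutative dual_add.
Proof. by move=> u v; apply: dual_ext => x; exact: addrC. Qed.

Fact dual_add0 : left_id dual_zero dual_add.
Proof. by move=> u; apply: dual_ext => x; exact: add0r. Qed.

Fact dual_addN : left_inverse dual_zero dual_opp dual_add.
Proof. by move=> u; apply: dual_ext => x; exact: addNr. Qed.

HB.instance Definition _ := GRing.isZmodule.Build dual
  dual_addA dual_addC dual_add0 dual_addN.

Fact dual_scaleA a b u : dual_scale a (dual_scale b u) = dual_scale (a * b) u.
Proof. by apply: dual_ext => x; exact: scalerA. Qed.

Fact dual_scale1 : left_id 1 dual_scale.
Proof. by move=> u; apply: dual_ext => x; exact: scale1r. Qed.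

Fact dual_scaleDr : right_distributive dual_scale +%R.
Proof. by move=> a u v; apply: dual_ext => x; exact: scalerDr. Qed.

Fact dual_scaleDl u : {morph dual_scale^~ u : a b / a + b}.
Proof. by move=> a b; apply: dual_ext => x; exact: scalerDl. Qed.

HB.instance Definition _ := GRing.Zmodule_isLmodule.Build A dual
  dual_scaleA dual_scale1 dual_scaleDr dual_scaleDl.

End Modules.

Arguments tensA {A} M N.

Section Corings.
Variables (R : comPzRingType).

Section BaseAlgebra.
Variable (S : ralg R).

Notation i := (ralg_str S).

Definition tens2 : comPzRingType := tensR i i.
Definition left2 : {rmorphism S -> tens2} := tinl i i.
Definition right2 : {rmorphism S -> tens2} := tinr i i.
Definition str2 : {rmorphism R -> tens2} := left2 \o i.

Definition tens3 : comPzRingType := tensR i str2.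

Definition pos1 : {rmorphism S -> tens3} := tinl i str2.
Definition pos2 : {rmorphism S -> tens3} := tinr i str2 \o left2.
Definition pos3 : {rmorphism S -> tens3} := tinr i str2 \o right2.

Fact pos12 r : pos1 (i r) = pos2 (i r).
Proof. exact: tinlr. Qed.

Fact pos23 r : pos2 (i r) = pos3 (i r).
Proof. by congr (tinr i str2 _); exact: tinlr. Qed.

Fact pos13 r : pos1 (i r) = pos3 (i r).
Proof. by rewrite pos12 pos23. Qed.

(* s (x) t |-> 1 (x) s (x) t,  s (x) 1 (x) t,  s (x) t (x) 1 *)
Definition eta1 : {rmorphism tens2 -> tens3} := rlift pos23.
Definition eta2 : {rmorphism tens2 -> tens3} := rlift pos13.
Definition eta3 : {rmorphism tens2 -> tens3} := rlift pos12.

Fact id_agree r : idfun (i r) = idfun (i r).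
Proof. by []. Qed.

Definition mul2 : {rmorphism tens2 -> S} :=
  rlift (h := idfun) (k := idfun) id_agree.

(* C (x)_S C: the right action of S on the first factor is through 1 (x) s,
   the left action on the second one is through s (x) 1. *)
Definition tensS (C D : lmodType tens2) := tens right2 left2 C D.

Fact outer_agree r :
  tinl right2 left2 (left2 (i r)) = tinr right2 left2 (right2 (i r)).
Proof.
transitivity (tinl right2 left2 (right2 (i r))).
  by congr (tinl _ _ _); exact: tinlr.
by rewrite tinlr; congr (tinr _ _ _); exact: tinlr.
Qed.

Definition outer : {rmorphism tens2 -> tensR right2 left2} :=
  rlift (h := tinl right2 left2 \o left2) (k := tinr right2 left2 \o right2)
    outer_agree.

(* s (c (x) d) t = sc (x) dt *)
Definition tensS_bimod (C D : lmodType tens2) : lmodType tens2 :=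
  restr outer (tensS C D).


Record coring_data : Type := CoringData {
  coring_mod :> lmodType tens2;
  comul : coring_mod -> tensS coring_mod coring_mod;
  counit : coring_mod -> S }.

Section CoringAxioms.
Variable C : coring_data.

Record is_coring : Prop := IsCoring {
  comul_linear : linear (comul (c := C) : C -> tensS_bimod C C);
  counit_linear : linear (counit (c := C) : C -> restr mul2 S^o);
  (* both sides in C (x)_S (C (x)_S C) *)
  comul_assoc : forall c : C,
    tlift (fun c1 c2 =>
      tlift (fun c11 c12 =>
        tpure right2 left2 c11 (tpure right2 left2 c12 c2 : tensS_bimod C C))
        (comul c1)) (comul c) =
    tlift (fun c1 c2 =>
      tpure right2 left2 c1 (comul c2 : tensS_bimod C C)) (comul c);
  counit_l : forall c : C,
    tlift (fun c1 c2 => left2 (counit c1) *: c2) (comul c) = c;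
  counit_r : forall c : C,
    tlift (fun c1 c2 => right2 (counit c2) *: c1) (comul c) = c }.

(* M_i, for eta = eta_i *)
Definition ext3 (eta : {rmorphism tens2 -> tens3}) (M : lmodType tens2) :
    lmodType tens3 :=
  restr (tinr idfun eta) (tens idfun eta M tens3^o).

Definition ext3_pure (eta : {rmorphism tens2 -> tens3}) (M : lmodType tens2)
    (m : M) (u : tens3) : ext3 eta M :=
  tpure idfun eta m (u : tens3^o).

(* Delta~ (c (x) u) = u . (c_(1)3 (x) c_(2)1) *)
Definition comul_tilde (x : ext3 eta2 C) : tensA (ext3 eta3 C) (ext3 eta1 C) :=
  tlift (fun (c : C) (u : tens3^o) =>
    (u : tens3) *:
    tlift (fun c1 c2 =>
      tpure idfun idfun (ext3_pure eta3 c1 1) (ext3_pure eta1 c2 1)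
        : tensA (ext3 eta3 C) (ext3 eta1 C)) (comul c)) x.

(* comul_tilde is automatically linear, so it is an isomorphism as soon as it
   is bijective. *)
Definition azumaya_over : Prop :=
  [/\ is_coring, faithfully_projective C & bijective comul_tilde].

End CoringAxioms.

Definition dual_basis (I : lmodType S) (n : nat) (e : 'I_n -> I)
    (f : 'I_n -> dual I) : Prop :=
  forall x, x = \sum_(j < n) (f j x : S) *: e j.

Definition can (I : lmodType S) (n : nat) (e : 'I_n -> I) (f : 'I_n -> dual I) :
    coring_data :=
  @CoringData (tens i i (dual I) I)
    (tlift (fun g x => \sum_(j < n)
       (tpure right2 left2 (tpure i i g (e j)) (tpure i i (f j) x)
          : tensS (tens i i (dual I) I) (tens i i (dual I) I))))
    (tlift (fun (g : dual I) x => g x : S)).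

End BaseAlgebra.

Arguments comul {S c}.
Arguments counit {S c}.

Definition ralg_tens (S T : ralg R) : ralg R :=
  Ralg (tinl (ralg_str S) (ralg_str T) \o ralg_str S).

Section TensorCoring.
Variables (S T : ralg R) (C : coring_data S) (D : coring_data T).

Notation i := (ralg_str S).
Notation j := (ralg_str T).
Notation ST := (ralg_tens S T).
Notation S2T2 := (tensR (str2 S) (str2 T)).
Notation inS := (tinl (str2 S) (str2 T)).
Notation inT := (tinr (str2 S) (str2 T)).

Fact left_agree r : inS (left2 S (i r)) = inT (left2 T (j r)).
Proof. exact: tinlr. Qed.

Fact right_agree r : inS (right2 S (i r)) = inT (right2 T (j r)).
Proof.
transitivity (inS (str2 S r)); first by congr (tinl _ _ _); rewrite /= tinlr.
by rewrite tinlr; congr (tinr _ _ _); exact: tinlr.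
Qed.

(* s (x) t |-> (s (x) 1) (x) (t (x) 1)  and  (1 (x) s) (x) (1 (x) t) *)
Definition left4 : {rmorphism ST -> S2T2} :=
  rlift (h := inS \o left2 S) (k := inT \o left2 T) left_agree.
Definition right4 : {rmorphism ST -> S2T2} :=
  rlift (h := inS \o right2 S) (k := inT \o right2 T) right_agree.

Fact mid_agree r : left4 (ralg_str ST r) = right4 (ralg_str ST r).
Proof.
rewrite /left4 /right4 /= /tinl !rlift_pure !rmorph1 !mulr1 /=.
by congr (tinl _ _ _); exact: tinlr.
Qed.

(* (s (x) t) (x) (s' (x) t') |-> (s (x) s') (x) (t (x) t') *)
Definition swap_mid : {rmorphism tens2 ST -> S2T2} := rlift mid_agree.

Definition coring_tens_mod : lmodType (tens2 ST) :=
  restr swap_mid (tens (str2 S) (str2 T) C D).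

Definition coring_tens_pure (c : C) (d : D) : coring_tens_mod :=
  tpure (str2 S) (str2 T) c d.

(* (c (x) d) |-> (c_(1) (x) d_(1)) (x) (c_(2) (x) d_(2)) *)
Definition coring_tens : coring_data ST :=
  @CoringData ST coring_tens_mod
    (tlift (fun (c : C) (d : D) =>
       tlift (fun c1 c2 => tlift (fun d1 d2 =>
         tpure (right2 ST) (left2 ST)
           (coring_tens_pure c1 d1) (coring_tens_pure c2 d2)
         : tensS coring_tens_mod coring_tens_mod)
       (comul d)) (comul c)))
    (tlift (fun (c : C) (d : D) => rpure i j (counit c) (counit d))).

End TensorCoring.

(* Pairs (S, C), before imposing the axioms of an Azumaya coring. *)
Record cpair : Type := Cpair {
  cbase : ralg R;
  ccoring : coring_data cbase }.

Definition is_azumaya (X : cpair) : Prop :=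
  [/\ faithfully_flat (cbase X), finitely_presented (cbase X)
    & azumaya_over (ccoring X)].

Definition cpair_tens (X Y : cpair) : cpair :=
  Cpair (coring_tens (ccoring X) (ccoring Y)).

Definition ralg_id : ralg R := @Ralg R R idfun.

Definition cpair_unit : cpair :=
  @Cpair ralg_id
    (@CoringData ralg_id (restr (mul2 ralg_id) R^o)
      (fun r => tpure (right2 ralg_id) (left2 ralg_id) r
                  ((1 : R^o) : restr (mul2 ralg_id) R^o))
      (fun r => r)).

(* Compatibility with the counits follows from the other conditions when X
   and Y are corings. *)
Definition cpair_iso (X Y : cpair) : Prop :=
  exists (f : {rmorphism cbase X -> cbase Y})
         (phi : {linear restr (str2 (cbase X)) (ccoring X) ->
                        restr (str2 (cbase Y)) (ccoring Y)}),
    [/\ bijective f,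
        forall r, f (ralg_str (cbase X) r) = ralg_str (cbase Y) r,
        bijective phi,
        forall (s s' : cbase X) (c : ccoring X),
          phi (rpure _ _ s s' *: c) =
          rpure (ralg_str (cbase Y)) (ralg_str (cbase Y)) (f s) (f s') *:
            (phi c : ccoring Y)
      & forall c : ccoring X,
          comul (phi c : ccoring Y) =
          tlift (fun c1 c2 : ccoring X =>
            tpure (right2 (cbase Y)) (left2 (cbase Y))
              (phi c1 : ccoring Y) (phi c2 : ccoring Y)) (comul c)].

Definition is_elementary (X : cpair) : Prop :=
  exists (U : ralg R) (I : lmodType U) (n : nat)
         (e : 'I_n -> I) (f : 'I_n -> dual I),
    [/\ invertible I, dual_basis e f & X = Cpair (can e f)].

Record azumaya_coring : Type := AzumayaCoring {
  az_pair :> cpair;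
  az_axiom : is_azumaya az_pair }.

Definition brauer_equiv (X Y : azumaya_coring) : Prop :=
  exists E1 E2 : azumaya_coring,
    [/\ is_elementary E1, is_elementary E2
      & cpair_iso (cpair_tens X E1) (cpair_tens Y E2)].

(* The set of equivalence classes, a class being the predicate of its
   members. *)
Record brauer_fl : Type := BrauerFl {
  brauer_class : azumaya_coring -> Prop;
  brauer_classP : exists X, brauer_class = brauer_equiv X }.

Definition brauer_cls (X : azumaya_coring) : brauer_fl :=
  BrauerFl (ex_intro _ X (erefl (brauer_equiv X))).

End Corings.

(* Main.v *)
(* Write C_ij for an S (x) S-module C placed at the positions i and j of a tensor
   power of S. The Azumaya condition on (S, C) reads C_13 = C_12 (x) C_23, so the
   counit makes C_12 (x) C_21 = C_11 trivial and C_21 is invertible with dual C_12.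
   The inverse of (S, C) is the co-opposite coring C^cop, which has C_21 as
   underlying module: C (x) C^cop is C_13 (x) C_42 = C_12 (x) C_23 (x) C_42
   = C_12 (x) C_43, and this is the elementary coring of C^cop over S (x) S.
   Azumaya corings are closed under tensor products because each ingredient is:
   faithful flatness, finite presentation, dual bases with trace ideal 1, and the
   bijection C (x)_R S = C (x)_S C, c (x) s |-> c_(1) s (x) c_(2), which replaces
   the map Delta~. Elementary corings are closed under tensor products up to
   isomorphism, since Can(I) (x) Can(J) = Can(I (x) J). *)

Require Import Defs.
From HB Require Import structures.
From mathcomp Require Import all_boot all_order all_algebra.
From mathcomp Require Import boolp.

Set Implicit Arguments.
Unset Strict Implicit.
Unset Printing Implicit Defensive.

Import GRing.Theory.
Local Open Scope ring_scope.

(** * Tensor products *)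

(** Most identities are proved by one device. Let [G] be the inverse of c (x) s |-> c_(1) s (x)
    c_(2). Then every c (x) d is a sum of z_(1) s (x) z_(2), so a claim about an arbitrary pair c, d
    becomes a claim about coproducts, where coassociativity and the counit axioms apply. The duality
    between C_12 and C_21 is made explicit by one element [u] with counit 1, which exists because C
    has trace ideal 1: its coproduct is at once the element that pairs to 1 and a dual basis of
    C_21. Lifting along surjections and faithfulness do not pass visibly to tensor products, which
    is why dual bases and trace ideals replace them. The witnesses of Brauer equivalence must be
    Azumaya corings. No general proof that Can(I) is Azumaya is given: each elementary coring that
    occurs is isomorphic to a coring already known to be Azumaya, and inherits the property along
    the isomorphism. *)

Notation addmap h := {morph h : x y / x + y}.

Lemma addmap0 (U V : zmodType) (h : U -> V) : addmap h -> h 0 = 0.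
Proof. by move=> hD; apply: (@addrI _ (h 0)); rewrite -hD !addr0. Qed.

Lemma addmap_sum (U V : zmodType) (h : U -> V) (I : Type) (s : seq I) (F : I -> U) :
  addmap h -> h (\sum_(i <- s) F i) = \sum_(i <- s) h (F i).
Proof. by move=> hD; apply: (big_morph h hD (addmap0 hD)). Qed.

Section TensGen.
Variables (A B C : comPzRingType).
Variables (f : {rmorphism A -> B}) (g : {rmorphism A -> C}).
Variables (M : lmodType B) (N : lmodType C).

Implicit Types (P : zmodType).

(* tlift b x is a finite sum over the chosen representative of x, so the next
   lemmas hold without assuming that b is balanced. *)
Lemma tlift_ext P (b b' : M -> N -> P) (x : tens f g M N) :
  (forall m n, b m n = b' m n) -> tlift b x = tlift b' x.
Proof. by move=> e; apply: eq_bigr. Qed.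

Lemma tlift_split P (b b1 b2 : M -> N -> P) (x : tens f g M N) :
  (forall m n, b m n = b1 m n + b2 m n) -> tlift b x = tlift b1 x + tlift b2 x.
Proof. by move=> e; rewrite /tlift -big_split; apply: eq_bigr. Qed.

Lemma addmap_tlift P (Q : zmodType) (h : P -> Q) (b : M -> N -> P)
  (x : tens f g M N) :
  addmap h -> h (tlift b x) = tlift (fun m n => h (b m n)) x.
Proof. exact: addmap_sum. Qed.

Lemma tlift_tpure (x : tens f g M N) : tlift (tpure f g (M := M) (N := N)) x = x.
Proof. by rewrite /tlift -tens_clsE tens_clsK. Qed.

Lemma tpure_balanced : balanced f g (tpure f g (M := M) (N := N)).
Proof.
split=> [m m' n|m n n'|a m n]; [exact: tpureDl|exact: tpureDr|exact: tpureZ].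
Qed.

Lemma tens_ext P (h k : tens f g M N -> P) : addmap h -> addmap k ->
  (forall m n, h (tpure f g m n) = k (tpure f g m n)) -> h =1 k.
Proof.
move=> hD kD e; elim/tens_ind=> [|x y IHx IHy|m n]; last exact: e.
- by rewrite !addmap0.
- by rewrite hD kD IHx IHy.
Qed.

Lemma tpure0l (n : N) : tpure f g (0 : M) n = 0 :> tens f g M N.
Proof. exact: (addmap0 (tpureDl f g n)). Qed.

Lemma tpure0r (m : M) : tpure f g m (0 : N) = 0 :> tens f g M N.
Proof. exact: (addmap0 (tpureDr f g m)). Qed.

Lemma tpure_suml (I : Type) (s : seq I) (F : I -> M) (n : N) :
  tpure f g (\sum_(i <- s) F i) n = \sum_(i <- s) tpure f g (F i) n.
Proof. by rewrite (addmap_sum (h := fun m => tpure f g m n)) //; apply: tpureDl. Qed.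

Lemma tpure_sumr (I : Type) (s : seq I) (F : I -> N) (m : M) :
  tpure f g m (\sum_(i <- s) F i) = \sum_(i <- s) tpure f g m (F i).
Proof. by rewrite (addmap_sum (h := fun n => tpure f g m n)) //; apply: tpureDr. Qed.

Lemma scale_tinl b (m : M) (n : N) :
  tinl f g b *: tpure f g m n = tpure f g (b *: m) n.
Proof. by rewrite /tinl scale_rpure scale1r. Qed.

Lemma scale_tinr c (m : M) (n : N) :
  tinr f g c *: tpure f g m n = tpure f g m (c *: n).
Proof. by rewrite /tinr scale_rpure scale1r. Qed.

Lemma bal_comp P (Q : zmodType) (h : P -> Q) (b : M -> N -> P) :
  addmap h -> balanced f g b -> balanced f g (fun m n => h (b m n)).
Proof.
move=> hD [bDl bDr bZ]; split=> *; first by rewrite bDl hD.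
  by rewrite bDr hD.
by rewrite bZ.
Qed.

Lemma bal_scalel P (K : M -> N -> P) b : balanced f g K ->
  balanced f g (fun m n => K (b *: m) n).
Proof.
move=> bK; split=> [m m' n|m n n'|a m n].
- by rewrite scalerDr (balDl bK).
- by rewrite (balDr bK).
- by rewrite scalerA mulrC -scalerA (balZ bK).
Qed.

Lemma bal_scaler P (K : M -> N -> P) c : balanced f g K ->
  balanced f g (fun m n => K m (c *: n)).
Proof.
move=> bK; split=> [m m' n|m n n'|a m n].
- by rewrite (balDl bK).
- by rewrite scalerDr (balDr bK).
- by rewrite (balZ bK) scalerA mulrC -scalerA.
Qed.

Lemma tlift_tinl P (K : M -> N -> P) b x : balanced f g K ->
  tlift K (tinl f g b *: x) = tlift (fun m n => K (b *: m) n) x.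
Proof.
move=> bK; have bK' := bal_scalel b bK.
apply: (@tens_ext _ (fun x => tlift K (tinl f g b *: x)) _ _ (tliftD bK')).
  by move=> y z; rewrite scalerDr (tliftD bK).
by move=> m n; rewrite scale_tinl !tlift_pure.
Qed.

Lemma tlift_tinr P (K : M -> N -> P) c x : balanced f g K ->
  tlift K (tinr f g c *: x) = tlift (fun m n => K m (c *: n)) x.
Proof.
move=> bK; have bK' := bal_scaler c bK.
apply: (@tens_ext _ (fun x => tlift K (tinr f g c *: x)) _ _ (tliftD bK')).
  by move=> y z; rewrite scalerDr (tliftD bK).
by move=> m n; rewrite scale_tinr !tlift_pure.
Qed.

End TensGen.

Section TensGen2.
Variables (A B C : comPzRingType).
Variables (f : {rmorphism A -> B}) (g : {rmorphism A -> C}).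
Variables (M : lmodType B) (N : lmodType C).
Variables (A' B' C' : comPzRingType).
Variables (f' : {rmorphism A' -> B'}) (g' : {rmorphism A' -> C'}).
Variables (M' : lmodType B') (N' : lmodType C').
Variable P : zmodType.

(** Both sides are finite double sums over the chosen representatives. Iterated Sweedler sums are
    reordered in this way, with no balancedness to check. *)
Lemma tlift_exchange (K : M -> N -> M' -> N' -> P) (x : tens f g M N)
    (y : tens f' g' M' N') :
  tlift (fun m n => tlift (K m n) y) x =
  tlift (fun m' n' => tlift (fun m n => K m n m' n') x) y.
Proof. exact: exchange_big. Qed.

(** The representative of [y] stays fixed, so each identity holds summand by summand. *)
Lemma bal_param (K : M -> N -> M' -> N' -> P) (y : tens f' g' M' N') :
  (forall m' n', balanced f g (fun m n => K m n m' n')) ->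
  balanced f g (fun m n => tlift (K m n) y).
Proof.
move=> bK; split=> *.
- by apply: tlift_split => m' n'; apply: (balDl (bK m' n')).
- by apply: tlift_split => m' n'; apply: (balDr (bK m' n')).
- by apply: tlift_ext => m' n'; apply: (balZ (bK m' n')).
Qed.

End TensGen2.

Section RLift.
Variables (A B C E : comPzRingType).
Variables (f : {rmorphism A -> B}) (g : {rmorphism A -> C}).
Variables (h : {rmorphism B -> E}) (k : {rmorphism C -> E}).
Hypothesis hk : forall a, h (f a) = k (g a).

Lemma rlift_inl b : rlift hk (tinl f g b) = h b.
Proof. by rewrite [LHS]rlift_pure rmorph1 mulr1. Qed.

Lemma rlift_inr c : rlift hk (tinr f g c) = k c.
Proof. by rewrite [LHS]rlift_pure rmorph1 mul1r. Qed.

End RLift.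

(** * Sweedler calculus *)

Section Bimodule.
Variables (R : comPzRingType) (S : ralg R).
Notation i := (ralg_str S).
Notation l2 := (left2 S).
Notation r2 := (right2 S).

Lemma rpure_lr (s t : S) : rpure i i s t = l2 s * r2 t.
Proof. by rewrite /= rpureM mulr1 mul1r. Qed.

Lemma tens2_ind (Q : tens2 S -> Prop) :
  Q 0 -> (forall x y, Q x -> Q y -> Q (x + y)) ->
  (forall s t, Q (l2 s * r2 t)) -> forall x, Q x.
Proof. by move=> Q0 QD Qp; elim/tens_ind=> // s t;
    rewrite -[tpure _ _ _ _]/(rpure i i s t) rpure_lr. Qed.

Lemma lr_str r : l2 (i r) = r2 (i r).
Proof. exact: tinlr. Qed.

Section Mod.
Variable C : lmodType (tens2 S).

Lemma lrC s t (c : C) : r2 t *: (l2 s *: c) = l2 s *: (r2 t *: c).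
Proof. by rewrite !scalerA mulrC. Qed.

Lemma lscaleA s t (c : C) : l2 s *: (l2 t *: c) = l2 (s * t) *: c.
Proof. by rewrite !scalerA -rmorphM. Qed.

Lemma rscaleA s t (c : C) : r2 s *: (r2 t *: c) = r2 (s * t) *: c.
Proof. by rewrite !scalerA -rmorphM. Qed.

End Mod.

Lemma outer_l s : outer S (l2 s) = tinl r2 l2 (l2 s).
Proof. by rewrite /= /tinl rlift_pure rmorph1 mulr1. Qed.

Lemma outer_r s : outer S (r2 s) = tinr r2 l2 (r2 s).
Proof. by rewrite /= /tinr rlift_pure rmorph1 mul1r. Qed.

Lemma tensS_l (C D : lmodType (tens2 S)) s (c : C) (d : D) :
  l2 s *: (tpure r2 l2 c d : tensS_bimod C D) = tpure r2 l2 (l2 s *: c) d.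
Proof.
rewrite -[LHS]/(outer S (l2 s) *: tpure r2 l2 c d) outer_l /tinl scale_rpure.
by rewrite scale1r.
Qed.

Lemma tensS_r (C D : lmodType (tens2 S)) s (c : C) (d : D) :
  r2 s *: (tpure r2 l2 c d : tensS_bimod C D) = tpure r2 l2 c (r2 s *: d).
Proof.
rewrite -[LHS]/(outer S (r2 s) *: tpure r2 l2 c d) outer_r /tinr scale_rpure.
by rewrite scale1r.
Qed.

End Bimodule.

Notation bal2 S := (balanced (right2 S) (left2 S)).

Section Coring.
Variables (R : comPzRingType) (S : ralg R) (C : coring_data S).
Notation l2 := (left2 S).
Notation r2 := (right2 S).
Implicit Types (P : zmodType).

(* sw b c is the sum of the b c_(1) c_(2). *)
Definition sw P (b : C -> C -> P) (c : C) : P := tlift b (comul c).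

(** The condition for [T] to descend to the triple tensor product of [C] over [S]. *)
Record trilin P (T : C -> C -> C -> P) : Prop := Trilin {
  tri12 : forall c, bal2 S (fun a b => T a b c);
  tri23 : forall a, bal2 S (T a) }.

Section Linear.
Hypothesis hL : linear (comul (c := C) : C -> tensS_bimod C C).

Lemma comulD : addmap (comul (c := C)).
Proof.
move=> x y; have := hL 1 x y; rewrite !scale1r => ->.
by [].
Qed.

Lemma comulZ a x : comul (a *: x) = a *: (comul x : tensS_bimod C C).
Proof.
have := hL a x 0; rewrite addr0 => ->.
by rewrite (addmap0 comulD) addr0.
Qed.

Lemma swD P (b : C -> C -> P) : bal2 S b -> addmap (sw b).
Proof. by move=> bb x y; rewrite /sw comulD (tliftD bb). Qed.

Lemma sw_ext P (b b' : C -> C -> P) c :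
  (forall x y, b x y = b' x y) -> sw b c = sw b' c.
Proof. exact: tlift_ext. Qed.

Lemma addmap_sw P (Q : zmodType) (h : P -> Q) (b : C -> C -> P) c :
  addmap h -> h (sw b c) = sw (fun x y => h (b x y)) c.
Proof. exact: addmap_tlift. Qed.

Lemma sw_l P (b : C -> C -> P) s c : bal2 S b ->
  sw b (l2 s *: c) = sw (fun x y => b (l2 s *: x) y) c.
Proof.
move=> bb; rewrite /sw comulZ.
rewrite -[_ *: _]/(outer S (l2 s) *: (comul c : tensS C C)) outer_l.
exact: tlift_tinl.
Qed.

Lemma sw_r P (b : C -> C -> P) s c : bal2 S b ->
  sw b (r2 s *: c) = sw (fun x y => b x (r2 s *: y)) c.
Proof.
move=> bb; rewrite /sw comulZ.
rewrite -[_ *: _]/(outer S (r2 s) *: (comul c : tensS C C)) outer_r.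
exact: tlift_tinr.
Qed.

(** A right scalar on [c1] lands on the second leg of its coproduct, from where it crosses to
    [c2]. *)
Lemma trilin_sw1 P (T : C -> C -> C -> P) : trilin T ->
  bal2 S (fun c1 c2 => sw (fun a b => T a b c2) c1).
Proof.
move=> tT; split=> [m m' n|m n n'|a m n].
- by rewrite swD //; apply: tri12.
- by apply: tlift_split => x y; apply: (balDr (tri23 tT _)).
- rewrite sw_r; last exact: tri12.
  by apply: sw_ext => x y; rewrite (balZ (tri23 tT _)).
Qed.

Lemma trilin_sw2 P (T : C -> C -> C -> P) : trilin T ->
  bal2 S (fun c1 c2 => sw (fun a b => T c1 a b) c2).
Proof.
move=> tT; split=> [m m' n|m n n'|a m n].
- by apply: tlift_split => x y; apply: (balDl (tri12 tT _)).
- by rewrite swD //; apply: tri23.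
- rewrite sw_l; last exact: tri23.
  by apply: sw_ext => x y; rewrite (balZ (tri12 tT _)).
Qed.

End Linear.

Lemma trilin_param (A' B' C' : comPzRingType) (f' : {rmorphism A' -> B'})
    (g' : {rmorphism A' -> C'}) (M' : lmodType B') (N' : lmodType C') P
    (T : C -> C -> C -> M' -> N' -> P) (y : tens f' g' M' N') :
  (forall m n, trilin (fun a b c => T a b c m n)) ->
  trilin (fun a b c => tlift (T a b c) y).
Proof.
move=> tT; split=> c; apply: bal_param => m n; first exact: (tri12 (tT m n)).
exact: (tri23 (tT m n)).
Qed.

Hypothesis hC : is_coring C.
Let hL := comul_linear hC.

Lemma counitD : addmap (counit (c := C)).
Proof.
move=> x y; have := counit_linear hC 1 x y; rewrite !scale1r => ->.
by [].
Qed.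

Lemma counitZ a x : counit (a *: x : C) = mul2 S a * counit x.
Proof.
have := counit_linear hC a x 0; rewrite addr0 => ->.
by rewrite (addmap0 counitD) addr0.
Qed.

Lemma counit_ls s x : counit (l2 s *: x : C) = s * counit x.
Proof. by rewrite counitZ /= /tinl /mul2 /= rlift_pure mulr1. Qed.

Lemma counit_rs s x : counit (r2 s *: x : C) = s * counit x.
Proof. by rewrite counitZ /= /tinr /mul2 /= rlift_pure mul1r. Qed.

(** [comul_assoc] is an equation in C (x)_S (C (x)_S C). The map that [T] induces there is well
    defined by [bT], and is applied to both sides. *)
Lemma sw_assoc P (T : C -> C -> C -> P) c : trilin T ->
  sw (fun c1 c2 => sw (fun a b => T a b c2) c1) c =
  sw (fun c1 c2 => sw (fun a b => T c1 a b) c2) c.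
Proof.
move=> tT.
have bT : bal2 S (fun c1 (x : tensS_bimod C C) => tlift (T c1) x).
  split=> [m m' n|m n n'|a m n].
  - by apply: tlift_split => x y; apply: (balDl (tri12 tT _)).
  - exact: (tliftD (tri23 tT m)).
  - apply: (@tens_ext _ _ _ _ _ _ _ _ (fun x => tlift (T (r2 a *: m)) x) (fun x :
      tensS_bimod C C => tlift (T m) (l2 a *: x)) _ _ _ n).
    + exact: (tliftD (tri23 tT _)).
    + by move=> x y; rewrite scalerDr (tliftD (tri23 tT _)).
    + move=> x y; rewrite tensS_l !tlift_pure; try exact: tri23.
      exact: (balZ (tri12 tT _)).
have /(congr1 (tlift (fun c1 (x : tensS_bimod C C) => tlift (T c1) x))) :=
    comul_assoc hC c.
rewrite !(addmap_tlift _ _ (tliftD bT)) => e.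
transitivity (tlift (fun m n => tlift (fun c1 (x : tensS_bimod C C) =>
    tlift (T c1) x) (tlift
   (fun c11 c12 : C =>
    tpure r2 l2 c11 (tpure r2 l2 c12 n : tensS_bimod C C)) (comul m))) (comul c)).
  apply: sw_ext => c1 c2; rewrite (addmap_tlift _ _ (tliftD bT)).
  apply: sw_ext => a b; rewrite (tlift_pure bT) tlift_pure //; exact: tri23.
rewrite e; apply: sw_ext => c1 c2; rewrite (tlift_pure bT).
by [].
Qed.

Lemma sw_counitl P (q : C -> P) c : addmap q ->
  sw (fun c1 c2 => q (l2 (counit c1) *: c2)) c = q c.
Proof.
by move=> qD; rewrite -[in RHS](counit_l hC c) (addmap_tlift _ _ qD).
Qed.

Lemma sw_counitr P (q : C -> P) c : addmap q ->
  sw (fun c1 c2 => q (r2 (counit c2) *: c1)) c = q c.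
Proof.
by move=> qD; rewrite -[in RHS](counit_r hC c) (addmap_tlift _ _ qD).
Qed.

Lemma comulE c : comul c = sw (tpure r2 l2 (M := C) (N := C)) c.
Proof. by rewrite /sw tlift_tpure. Qed.

End Coring.

Section CoringIntro.
Variables (R : comPzRingType) (S : ralg R) (C : coring_data S).
Notation r2 := (right2 S).
Notation l2 := (left2 S).

Lemma trilin_tpure : trilin (fun a b c : C =>
  tpure r2 l2 a (tpure r2 l2 b c : tensS_bimod C C)).
Proof.
split=> c; split=> [m m' n|m n n'|a m n].
- exact: tpureDl.
- by rewrite tpureDl; apply: tpureDr.
- by rewrite tpureZ tensS_l.
- by rewrite tpureDl; apply: tpureDr.
- by rewrite tpureDr; apply: tpureDr.
- by rewrite tpureZ.
Qed.

Lemma is_coringI :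
  linear (comul (c := C) : C -> tensS_bimod C C) ->
  linear (counit (c := C) : C -> restr (mul2 S) S^o) ->
  (forall c : C, sw (fun c1 c2 => sw (fun a b =>
     tpure r2 l2 a (tpure r2 l2 b c2 : tensS_bimod C C)) c1) c =
     sw (fun c1 c2 => sw (fun a b =>
     tpure r2 l2 c1 (tpure r2 l2 a b : tensS_bimod C C)) c2) c) ->
  (forall c : C, sw (fun c1 c2 => l2 (counit c1) *: c2) c = c) ->
  (forall c : C, sw (fun c1 c2 => r2 (counit c2) *: c1) c = c) ->
  is_coring C.
Proof.
move=> hL hE hA hl hr; split=> // c; rewrite [LHS]hA; apply: tlift_ext => c1 c2.
rewrite [in RHS]comulE (addmap_sw (h := fun x : tensS_bimod C C => tpure r2 l2 c1 x)) //.
exact: tpureDr.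
Qed.

End CoringIntro.

(** * The Azumaya condition *)

Section Tilde.
Variables (R : comPzRingType) (S : ralg R).
Notation i := (ralg_str S).
Notation l2 := (left2 S).
Notation r2 := (right2 S).
Notation p1 := (pos1 S).
Notation p2 := (pos2 S).
Notation p3 := (pos3 S).

Lemma tens3_ind (Q : tens3 S -> Prop) :
  Q 0 -> (forall x y, Q x -> Q y -> Q (x + y)) ->
  (forall s t u, Q (p1 s * p2 t * p3 u)) -> forall x, Q x.
Proof.
move=> Q0 QD Qp; elim/tens_ind=> // s x.
elim/tens_ind: x s => [|x y IHx IHy|t u] s; first by rewrite tpure0r.
  by rewrite tpureDr; apply: QD.
rewrite -[tpure _ _ s _]/(rpure i (str2 S) s (rpure i i t u)).
rewrite rpure_lr.
have -> : rpure i (str2 S) s (l2 t * r2 u) = p1 s * p2 t * p3 u.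
  by rewrite /= /tinl /tinr !rpureM ?mul1r ?mulr1 ?rpureM ?mul1r ?mulr1.
exact: Qp.
Qed.

Lemma eta1E s t : eta1 S (l2 s * r2 t) = p2 s * p3 t.
Proof. by rewrite -rpure_lr [LHS]rlift_pure. Qed.
Lemma eta2E s t : eta2 S (l2 s * r2 t) = p1 s * p3 t.
Proof. by rewrite -rpure_lr [LHS]rlift_pure. Qed.
Lemma eta3E s t : eta3 S (l2 s * r2 t) = p1 s * p2 t.
Proof. by rewrite -rpure_lr [LHS]rlift_pure. Qed.

(* S (x) S (x) S acts on C (x)_S C (act3) and on C (x)_R S (mid_act), where the
   second factor of C (x)_R S is the middle position. *)
Lemma act23_agree r :
  (tinl r2 l2 \o r2) (i r) = (tinr r2 l2 \o r2) (i r).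
Proof. by rewrite /= tinlr; congr (tinr _ _ _); apply: lr_str. Qed.

Definition act23 : {rmorphism tens2 S -> tensR r2 l2} := rlift act23_agree.

Lemma act3_agree r :
  (tinl r2 l2 \o l2) (i r) = (act23 \o str2 S) r.
Proof.
rewrite [RHS]/= /tinl [X in _ = X]rlift_pure rmorph1 mulr1.
by rewrite /=; congr (tinl _ _ _); apply: lr_str.
Qed.

Definition act3 : {rmorphism tens3 S -> tensR r2 l2} := rlift act3_agree.

Lemma act3_1 s : act3 (p1 s) = tinl r2 l2 (l2 s).
Proof. exact: rlift_inl. Qed.
Lemma act3_2 s : act3 (p2 s) = tinl r2 l2 (r2 s).
Proof. by rewrite [LHS]rlift_inr; apply: rlift_inl. Qed.
Lemma act3_3 s : act3 (p3 s) = tinr r2 l2 (r2 s).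
Proof. by rewrite [LHS]rlift_inr; apply: rlift_inr. Qed.

Lemma mid_act23_agree r : (tinr (str2 S) i) (i r) = (tinl (str2 S) i \o r2) (i r).
Proof. by rewrite -tinlr /=; congr (tinl _ _ _); apply: lr_str. Qed.

Definition mid_act23 : {rmorphism tens2 S -> tensR (str2 S) i} := rlift mid_act23_agree.

Lemma mid_act_agree r : (tinl (str2 S) i \o l2) (i r) = (mid_act23 \o str2 S) r.
Proof.
rewrite [RHS]/= [X in _ = rlift _ X]/tinl [X in _ = X]rlift_pure rmorph1 mulr1.
exact: (tinlr (str2 S) i r).
Qed.

Definition mid_act : {rmorphism tens3 S -> tensR (str2 S) i} := rlift mid_act_agree.

Lemma mid_act_1 s : mid_act (p1 s) = tinl (str2 S) i (l2 s).
Proof. exact: rlift_inl. Qed.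
Lemma mid_act_2 s : mid_act (p2 s) = tinr (str2 S) i s.
Proof. by rewrite [LHS]rlift_inr; apply: rlift_inl. Qed.
Lemma mid_act_3 s : mid_act (p3 s) = tinl (str2 S) i (r2 s).
Proof. by rewrite [LHS]rlift_inr; apply: rlift_inr. Qed.

Section Mod.
Variable C : lmodType (tens2 S).

Definition cS : lmodType (tensR (str2 S) i) := tens (str2 S) i C S^o.
Definition cpure (c : C) (s : S) : cS := tpure (str2 S) i c (s : S^o).

(** Extending scalars along [eta2] only adds a middle tensor factor, so C_2 is C (x)_R S. *)
Definition mid_ext : cS -> ext3 (eta2 S) C :=
  tlift (fun c (s : S^o) => ext3_pure (eta2 S) c (p2 s)).
Definition mid_extV : ext3 (eta2 S) C -> cS :=
  tlift (fun c (u : (tens3 S)^o) => mid_act u *: (cpure c 1 : tens (str2 S) i C S^o)).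

Lemma ext3_scale (eta : {rmorphism tens2 S -> tens3 S}) (c : C) u v :
  u *: ext3_pure eta c v = ext3_pure eta c (u * v).
Proof.
rewrite -[LHS]/(tinr idfun eta u *: tpure idfun eta c (v : (tens3 S)^o)).
by rewrite /tinr scale_rpure scale1r.
Qed.

Lemma ext3_bal (eta : {rmorphism tens2 S -> tens3 S}) a (c : C) u :
  ext3_pure eta (a *: c) u = ext3_pure eta c (eta a * u).
Proof. exact: (tpureZ idfun eta a c (u : (tens3 S)^o)). Qed.

Lemma mid_ext_bal : balanced (str2 S) i
  (fun c (s : S^o) => ext3_pure (eta2 S) (c : C) (p2 s)).
Proof.
split=> [m m' n|m n n'|a m n].
- exact: tpureDl.
- by rewrite rmorphD; apply: tpureDr.
- rewrite ext3_bal rmorphM /=; congr (ext3_pure _ _ (_ * _)).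
  have := eta2E (i a) 1; rewrite !rmorph1 !mulr1 => ->; exact: pos12.
Qed.

Lemma mid_extV_bal : balanced idfun (eta2 S)
  (fun (c : C) (u : (tens3 S)^o) => mid_act u *: (cpure c 1 : tens (str2 S) i C S^o)).
Proof.
split=> [m m' n|m n n'|a m n].
- by rewrite -scalerDr; congr (_ *: _); apply: tpureDl.
- by rewrite rmorphD scalerDl.
- rewrite [in RHS]rmorphM mulrC -scalerA; congr (_ *: _).
  change (cpure (a *: m) 1 = mid_act (eta2 S a) *: cpure m 1); elim/tens2_ind: a =>
      [|x y IHx IHy|s t].
  + by rewrite scale0r !rmorph0 scale0r; apply: tpure0l.
  + by rewrite scalerDl !rmorphD scalerDl -IHx -IHy; apply: tpureDl.
  + rewrite eta2E rmorphM mid_act_1 mid_act_3 -rmorphM; symmetry; exact: scale_tinl.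
Qed.

Lemma mid_ext_bij : bijective mid_ext.
Proof.
exists mid_extV.
- apply: tens_ext => [x y|x y|c s] //.
    by rewrite /mid_ext (tliftD mid_ext_bal) /mid_extV (tliftD mid_extV_bal).
  rewrite /mid_ext (tlift_pure mid_ext_bal) /mid_extV (tlift_pure mid_extV_bal) mid_act_2.
  by rewrite scale_tinr /GRing.scale /= mulr1.
- apply: tens_ext => [x y|x y|c u] //.
    by rewrite /mid_extV (tliftD mid_extV_bal) /mid_ext (tliftD mid_ext_bal).
  rewrite /mid_extV (tlift_pure mid_extV_bal).
  elim/tens3_ind: u => [|x y IHx IHy|s t u].
  + by rewrite rmorph0 scale0r tpure0r /mid_ext (addmap0 (tliftD mid_ext_bal)).
  + by rewrite rmorphD scalerDl /mid_ext (tliftD mid_ext_bal) -!/(mid_ext _) IHx IHy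
      tpureDr.
  + rewrite !rmorphM mid_act_1 mid_act_2 mid_act_3 mulrAC -rmorphM -scalerA.
    rewrite scale_tinr scale_tinl /mid_ext (tlift_pure mid_ext_bal) ext3_bal eta2E.
    by rewrite /GRing.scale /= mulr1 mulrAC.
Qed.

Notation C31 := (tensA (ext3 (eta3 S) C) (ext3 (eta1 S) C)).

Definition outer_pure (c d : C) : C31 :=
  tpure idfun idfun (ext3_pure (eta3 S) c 1) (ext3_pure (eta1 S) d 1).

Lemma C31_scale (x : ext3 (eta3 S) C) (y : ext3 (eta1 S) C) u :
  u *: (tpure idfun idfun x y : C31) = tpure idfun idfun (u *: x) y.
Proof.
rewrite -[LHS]/(tinl idfun idfun u *: tpure idfun idfun x y).
by rewrite /tinl scale_rpure scale1r.
Qed.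

Lemma C31_scaler (x : ext3 (eta3 S) C) (y : ext3 (eta1 S) C) u :
  u *: (tpure idfun idfun x y : C31) = tpure idfun idfun x (u *: y).
Proof. by rewrite C31_scale; apply: (tpureZ idfun idfun u x y). Qed.

Lemma outer_pure_1 s c d : outer_pure (l2 s *: c) d = p1 s *: outer_pure c d.
Proof.
rewrite /outer_pure C31_scale ext3_scale ext3_bal;
    congr (tpure _ _ (ext3_pure _ _ (_ * _)) _).
by have := eta3E s 1; rewrite !rmorph1 !mulr1.
Qed.

Lemma outer_pure_2 s c d : outer_pure (r2 s *: c) d = p2 s *: outer_pure c d.
Proof.
rewrite /outer_pure C31_scale ext3_scale ext3_bal;
    congr (tpure _ _ (ext3_pure _ _ (_ * _)) _).
by have := eta3E 1 s; rewrite !rmorph1 !mul1r.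
Qed.

Lemma outer_pure_2' s c d : outer_pure c (l2 s *: d) = p2 s *: outer_pure c d.
Proof.
rewrite /outer_pure C31_scaler ext3_scale ext3_bal;
    congr (tpure _ _ _ (ext3_pure _ _ (_ * _))).
by have := eta1E s 1; rewrite !rmorph1 !mulr1.
Qed.

Lemma outer_pure_3 s c d : outer_pure c (r2 s *: d) = p3 s *: outer_pure c d.
Proof.
rewrite /outer_pure C31_scaler ext3_scale ext3_bal;
    congr (tpure _ _ _ (ext3_pure _ _ (_ * _))).
by have := eta1E 1 s; rewrite !rmorph1 !mul1r.
Qed.

(** The right action on the first factor and the left action on the second both become the action of
    the middle position [p2]. *)
Lemma outer_pure_bal : bal2 S outer_pure.
Proof.
split=> [m m' n|m n n'|a m n]; last by rewrite outer_pure_2 outer_pure_2'.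
- rewrite /outer_pure -tpureDl; congr (tpure _ _ _ _); exact: tpureDl.
- rewrite /outer_pure -tpureDr; congr (tpure _ _ _ _); exact: tpureDl.
Qed.

Definition outer_ext : tensS C C -> C31 := tlift outer_pure.

Lemma outer_extD : addmap outer_ext.
Proof. exact: (tliftD outer_pure_bal). Qed.

Lemma outer_ext_act u x : outer_ext (act3 u *: x) = u *: outer_ext x.
Proof.
apply: (@tens_ext _ _ _ _ _ _ _ _ (fun x => outer_ext (act3 u *: x)) (fun x =>
    u *: outer_ext x)) => {x}.
- by move=> x y; rewrite scalerDr outer_extD.
- by move=> x y; rewrite outer_extD scalerDr.
move=> c d; elim/tens3_ind: u => [|u v IHu IHv|s t u].
- by rewrite rmorph0 !scale0r (addmap0 outer_extD).
- by rewrite rmorphD !scalerDl outer_extD IHu IHv.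
- rewrite !rmorphM act3_1 act3_2 act3_3 -rmorphM -scalerA.
  rewrite scale_tinr scale_tinl /outer_ext !(tlift_pure outer_pure_bal).
  by rewrite -scalerA outer_pure_1 outer_pure_2 outer_pure_3 -!scalerA.
Qed.

(** Candidate inverse of [outer_ext]: all coefficients are collected and act on C (x)_S C. *)
Definition outer_extV (x : ext3 (eta3 S) C) (y : ext3 (eta1 S) C) : tensS C C :=
  tlift (fun (c : C) (u : (tens3 S)^o) => tlift (fun (d : C) (v : (tens3 S)^o) =>
    act3 (u * v) *: tpure r2 l2 c d) y) x.

Lemma outer_extV_balr c u : balanced idfun (eta1 S) (fun (d : C) (v : (tens3 S)^o) =>
    act3 (u * v) *: (tpure r2 l2 c d : tensS C C)).
Proof.
split=> [m m' n|m n n'|a m n].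
- by rewrite tpureDr scalerDr.
- by rewrite mulrDr rmorphD scalerDl.
- have -> : u * (eta1 S a *: n) = u * n * eta1 S a :> tens3 S.
    by rewrite -mulrA; congr (_ * _); apply: mulrC.
  rewrite [in RHS]rmorphM -scalerA.
  congr (_ *: _); change (tpure r2 l2 c (a *: m) =
      act3 (eta1 S a) *: tpure r2 l2 c m :> tensS C C); elim/tens2_ind: a =>
      [|x y IHx IHy|s t].
  + by rewrite scale0r !rmorph0 scale0r tpure0r.
  + by rewrite scalerDl !rmorphD scalerDl tpureDr IHx IHy.
  + by rewrite eta1E rmorphM act3_2 act3_3 tinlr -rmorphM scale_tinr.
Qed.

Lemma outer_extV_ball d v : balanced idfun (eta3 S) (fun (c : C) (u : (tens3 S)^o) =>
    act3 (u * v) *: (tpure r2 l2 c d : tensS C C)).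
Proof.
split=> [m m' n|m n n'|a m n].
- by rewrite tpureDl scalerDr.
- by rewrite mulrDl rmorphD scalerDl.
- have -> : (eta3 S a *: n) * v = n * v * eta3 S a :> tens3 S.
    by rewrite [RHS]mulrAC; congr (_ * _); apply: mulrC.
  rewrite [in RHS]rmorphM -scalerA.
  congr (_ *: _); change (tpure r2 l2 (a *: m) d =
      act3 (eta3 S a) *: tpure r2 l2 m d :> tensS C C); elim/tens2_ind: a =>
      [|x y IHx IHy|s t].
  + by rewrite scale0r !rmorph0 scale0r tpure0l.
  + by rewrite scalerDl !rmorphD scalerDl tpureDl IHx IHy.
  + by rewrite eta3E rmorphM act3_1 act3_2 -rmorphM scale_tinl.
Qed.

Lemma outer_extV_pure c u d v :
  outer_extV (ext3_pure (eta3 S) c u) (ext3_pure (eta1 S) d v) =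
  act3 (u * v) *: tpure r2 l2 c d.
Proof.
rewrite /outer_extV tlift_pure; first by rewrite (tlift_pure (outer_extV_balr c u)).
by apply: bal_param => d' v'; apply: outer_extV_ball.
Qed.

Lemma outer_extV_Dl y : addmap (outer_extV^~ y).
Proof. by apply: tliftD; apply: bal_param => d' v'; apply: outer_extV_ball. Qed.

Lemma outer_extV_Dr x : addmap (outer_extV x).
Proof. by move=> y y'; apply: tlift_split => c u;
    apply: (tliftD (outer_extV_balr c u)). Qed.

Lemma outer_extV_bal : balanced idfun idfun outer_extV.
Proof.
split=> [m m' n|m n n'|a m n]; [exact: outer_extV_Dl|exact: outer_extV_Dr|].
change (outer_extV (a *: m) n = outer_extV m (a *: n)).
apply: (@tens_ext _ _ _ _ _ _ _ _ (fun m : ext3 (eta3 S) C =>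
    outer_extV (a *: m) n) (fun m => outer_extV m (a *: n)) _ _ _ m) => {m}.
- by move=> x y; rewrite scalerDr outer_extV_Dl.
- by move=> x y; rewrite outer_extV_Dl.
move=> c u; rewrite -[tpure _ _ _ _]/(ext3_pure (eta3 S) c u) ext3_scale.
apply: (@tens_ext _ _ _ _ _ _ _ _ (fun n => outer_extV _ n) (fun n : ext3 (eta1 S) C =>
    outer_extV (ext3_pure (eta3 S) c u) (a *: n)) _ _ _ n) => {n}.
- exact: outer_extV_Dr.
- by move=> x y; rewrite scalerDr outer_extV_Dr.
move=> d v; rewrite -[tpure _ _ _ _]/(ext3_pure (eta1 S) d v) ext3_scale.
by rewrite !outer_extV_pure mulrCA mulrA.
Qed.

Lemma outer_ext_bij : bijective outer_ext.
Proof.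
have jD := tliftD outer_extV_bal.
exists (tlift outer_extV).
- apply: tens_ext => [x y|x y|c d] //; first by rewrite outer_extD jD.
  rewrite /outer_ext (tlift_pure outer_pure_bal) (tlift_pure outer_extV_bal)
      outer_extV_pure.
  by rewrite mulr1 rmorph1 scale1r.
- apply: tens_ext => [x y|x y|x y] //; first by rewrite jD outer_extD.
  rewrite (tlift_pure outer_extV_bal).
  apply: (@tens_ext _ _ _ _ _ _ _ _ (fun x : ext3 (eta3 S) C =>
      outer_ext (outer_extV x y) : C31) (fun x : ext3 (eta3 S) C =>
      tpure idfun idfun x y : C31) _ _ _ x) => {x} [x x'|x x'|c u].
  + by rewrite outer_extV_Dl outer_extD.
  + by rewrite tpureDl.
  apply: (@tens_ext _ _ _ _ _ _ _ _ (fun y : ext3 (eta1 S) C =>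
      outer_ext (outer_extV (ext3_pure (eta3 S) c u) y) : C31) (fun y :
      ext3 (eta1 S) C => tpure idfun idfun (ext3_pure (eta3 S) c u) y : C31) _ _ _ y) =>
      {y} [x x'|x x'|d v].
  + by rewrite outer_extV_Dr outer_extD.
  + by rewrite tpureDr.
  rewrite outer_extV_pure outer_ext_act /outer_ext (tlift_pure outer_pure_bal) -scalerA
      /outer_pure.
  by rewrite C31_scaler ext3_scale C31_scale ext3_scale !mulr1.
Qed.

End Mod.

Section Cor.
Variable C : coring_data S.
Hypothesis hC : is_coring C.

Lemma coF_bal0 s : bal2 S (fun a b : C => tpure r2 l2 (r2 s *: a) b : tensS C C).
Proof. exact: bal_scalel (tpure_balanced _ _ _ _). Qed.

(* comul_tilde, once C_2 is identified with C (x)_R S and C_3 (x) C_1 with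
   C (x)_S C: the map c (x) s |-> c_(1) s (x) c_(2). *)
Definition coF : cS C -> tensS C C :=
  tlift (fun c (s : S^o) => sw (fun a b => tpure r2 l2 (r2 s *: a) b) c).

Lemma coF_bal : balanced (str2 S) i
  (fun (c : C) (s : S^o) => sw (fun a b => (tpure r2 l2 (r2 s *: a) b : tensS C C)) c).
Proof.
split=> [m m' n|m n n'|a m n].
- by rewrite (swD (comul_linear hC) (coF_bal0 _)).
- by apply: tlift_split => x y; rewrite rmorphD scalerDl tpureDl.
- rewrite -[str2 S a]/(l2 (i a)) (sw_l (comul_linear hC) _ _ (coF_bal0 n));
    apply: sw_ext => x y.
  by rewrite lr_str rscaleA mulrC.
Qed.

Lemma coF_pure c s : coF (cpure c s) = sw (fun a b => tpure r2 l2 (r2 s *: a) b) c.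
Proof. exact: (tlift_pure coF_bal). Qed.

Lemma scaler_addmap (A : pzRingType) (M : lmodType A) (a : A) :
  addmap (fun x : M => a *: x).
Proof. by move=> x y; rewrite scalerDr. Qed.

Lemma comul_tilde_bal : balanced idfun (eta2 S)
  (fun (c : C) (u : (tens3 S)^o) => (u : tens3 S) *: sw (@outer_pure C) c).
Proof.
split=> [m m' n|m n n'|a m n].
- by rewrite -scalerDr (swD (comul_linear hC) (outer_pure_bal C)).
- by rewrite scalerDl.
rewrite [X in _ = X *: _]mulrC -scalerA; congr (_ *: _).
change (sw (@outer_pure C) (a *: m) = eta2 S a *: sw (@outer_pure C) m).
elim/tens2_ind: a => [|x' y IHx IHy|s t].
- by rewrite rmorph0 !scale0r (addmap0 (swD (comul_linear hC) (outer_pure_bal C))).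
- by rewrite rmorphD !scalerDl (swD (comul_linear hC) (outer_pure_bal C)) IHx IHy.
rewrite eta2E -!scalerA (sw_l (comul_linear hC) _ _ (outer_pure_bal C)).
rewrite (addmap_sw (h := *:%R (p3 t))); last exact: scaler_addmap.
rewrite (addmap_sw (h := *:%R (p1 s))); last exact: scaler_addmap.
rewrite (sw_r (comul_linear hC) (b := fun x y => outer_pure (l2 s *: x) y)).
  by apply: sw_ext => x y; rewrite outer_pure_1 outer_pure_3.
exact: bal_scalel (outer_pure_bal C).
Qed.

Lemma comul_tildeE x : comul_tilde (mid_ext x) = outer_ext (coF x).
Proof.
have tD : addmap (comul_tilde (C := C)) by exact: (tliftD comul_tilde_bal).
have i1D : addmap (@mid_ext C) by exact: (tliftD (mid_ext_bal C)).
apply: (@tens_ext _ _ _ _ _ _ _ _ (fun x => comul_tilde (mid_ext x)) (fun x =>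
    outer_ext (coF x))) => {x}.
- by move=> x y; rewrite i1D tD.
- by move=> x y; rewrite /coF (tliftD coF_bal) outer_extD.
move=> c s; rewrite -[tpure _ _ _ _]/(cpure c s) coF_pure /mid_ext (tlift_pure
    (mid_ext_bal C)).
rewrite [LHS](tlift_pure comul_tilde_bal).
rewrite (addmap_sw _ _ (@outer_extD C)) (addmap_sw (h := *:%R (p2 s)));
    last exact: scaler_addmap.
apply: sw_ext => a b; rewrite /outer_ext (tlift_pure (outer_pure_bal C)).
by rewrite outer_pure_2.
Qed.

Lemma tilde_coF : bijective (comul_tilde (C := C)) <-> bijective coF.
Proof.
have [[k1 k1K k1V] [k2 k2K k2V]] := (@mid_ext_bij C, @outer_ext_bij C).
split=> bij.
- have -> : coF = k2 \o (comul_tilde (C := C) \o @mid_ext C).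
    by apply: funext => x /=; rewrite comul_tildeE k2K.
  apply: bij_comp; first by exists (@outer_ext C).
  by apply: bij_comp => //; exists k1.
- have -> : comul_tilde (C := C) = @outer_ext C \o (coF \o k1).
    by apply: funext => x /=; rewrite -comul_tildeE k1V.
  apply: bij_comp; first by exists k2.
  by apply: bij_comp => //; exists (@mid_ext C).
Qed.

End Cor.
End Tilde.

(** * Faithfully projective modules *)

Section DualBasis.
Variables (A : comPzRingType) (M : lmodType A).

Definition has_dual_basis : Prop :=
  exists s : seq (M * dual M), forall x, x = \sum_(p <- s) (p.2 x : A) *: p.1.

(** Membership in the trace ideal, generated by the values of all functionals on [M]. *)
Definition in_trace (a : A) : Prop :=
  exists s : seq (M * dual M), a = \sum_(p <- s) (p.2 p.1 : A).

Lemma in_trace0 : in_trace 0.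
Proof. by exists [::]; rewrite big_nil. Qed.

Lemma in_traceD a b : in_trace a -> in_trace b -> in_trace (a + b).
Proof. by move=> [s ->] [t ->]; exists (s ++ t); rewrite big_cat. Qed.

Lemma in_traceM a b : in_trace b -> in_trace (a * b).
Proof.
move=> [s ->]; exists [seq (a *: p.1, p.2) | p <- s].
by rewrite big_map mulr_sumr; apply: eq_bigr => p _; rewrite linearZ.
Qed.

Lemma in_trace_apply (g : dual M) x : in_trace (g x).
Proof. by exists [:: (x, g)]; rewrite big_seq1. Qed.

(** A lift of [h] is determined by preimages of the images of the basis elements, which may be
    chosen freely. If [a] kills [M], it kills every value of a functional, hence the sum of such
    values that equals 1. *)
Lemma dual_basis_faithfully_projective :
  has_dual_basis -> in_trace 1 -> faithfully_projective M.
Proof.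
move=> [s sP] [t t1]; split.
- exists (size s), (fun j => (tnth (in_tuple s) j).1) => x.
  exists (fun j => (tnth (in_tuple s) j).2 x).
  by rewrite {1}(sP x) big_tnth.
- move=> U V p h psurj.
  pose q x := projT1 (cid (psurj (h x))).
  have qP x : p (q x) = h x by rewrite /q; case: cid.
  pose k x : U := \sum_(j <- s) (j.2 x : A) *: q j.1.
  have kl : linear k.
    move=> a x y; rewrite /k scaler_sumr -big_split; apply: eq_bigr => j _.
    by rewrite linearP scalerDl scalerA.
  pose kL : {linear M -> U} := HB.pack k (GRing.isLinear.Build A M U *:%R k kl).
  exists kL => x; rewrite -[kL x]/(k x).
  rewrite /k linear_sum [in RHS](sP x) linear_sum; apply: eq_bigr => j _.
  by rewrite !linearZ qP.
- move=> a a0; rewrite -[a]mulr1 t1 mulr_sumr big1 // => p _.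
  have -> : a * (p.2 p.1 : A) = p.2 (a *: p.1) by rewrite linearZ.
  by rewrite a0 linear0.
Qed.

(** Split the surjection from a free module given by the generators; the coordinates of the section
    are the functionals. *)
Lemma projective_dual_basis : fin_gen M -> projective M -> has_dual_basis.
Proof.
move=> [n [e eP]] pM.
pose p0 (v : 'rV[A]_n) : M := \sum_(j < n) v 0 j *: e j.
have p0l : linear p0.
  move=> a x y; rewrite /p0 scaler_sumr -big_split; apply: eq_bigr => j _.
  by rewrite !mxE scalerDl scalerA.
pose p : {linear 'rV[A]_n -> M} := HB.pack p0 (GRing.isLinear.Build A _ M *:%R p0 p0l).
have psurj y : exists x, p x = y.
  have [a ->] := eP y; exists (\row_j a j); apply: eq_bigr => j _.
  by rewrite mxE.
have [k kP] := pM _ _ p idfun psurj.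
have fl j : linear (fun x => (k x) 0 j : A^o).
  by move=> a x y; rewrite linearP !mxE.
exists [seq (e j, dual_mk (fl j)) | j <- enum 'I_n] => x.
rewrite big_map -[LHS](kP x) -[p (k x)]/(p0 (k x)) /p0.
by rewrite [RHS]big_enum.
Qed.

(* Determinant trick, in the quotient by the trace ideal. *)
Lemma trace_det n (B : 'M[A]_n) : (forall i j, in_trace (B i j)) ->
  in_trace (1 - \det (1%:M - B)).
Proof.
move=> BT.
pose cg (a b : A) := in_trace (a - b).
have cgD a b a' b' : cg a b -> cg a' b' -> cg (a + a') (b + b').
  by move=> ab ab'; rewrite /cg opprD addrACA; apply: in_traceD.
have cgM a b a' b' : cg a b -> cg a' b' -> cg (a * a') (b * b').
  move=> ab ab'; rewrite /cg.
  have -> : a * a' - b * b' = a' * (a - b) + b * (a' - b').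
    by rewrite !mulrBr [a' * a]mulrC [a' * b]mulrC addrA subrK.
  by apply: in_traceD; apply: in_traceM.
have cg0 a : cg a a by rewrite /cg subrr; apply: in_trace0.
(* Compare the Leibniz expansions of [det 1] and [det (1 - B)] factor by factor: the entries differ
   by those of [B]. *)
rewrite -{1}(det1 A n); apply: (big_rec2 cg) => // s a b _ ab.
apply: (cgD _ _ _ _ _ ab); apply: (cgM _ _ _ _ (cg0 _)).
apply: (big_rec2 cg) => // i c d _ cd; apply: (cgM _ _ _ _ _ cd).
by rewrite !mxE /cg opprB addrC subrK; apply: BT.
Qed.

(* Nakayama: M equals its trace ideal times M, so an element of 1 + in_trace
   kills M. *)
Lemma faithful_trace : has_dual_basis -> faithful M -> in_trace 1.
Proof.
move=> [s sP] fM.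
pose n := size s; pose e (j : 'I_n) := (tnth (in_tuple s) j).1.
pose f (j : 'I_n) := (tnth (in_tuple s) j).2.
have eP x : x = \sum_(j < n) (f j x : A) *: e j by rewrite {1}(sP x) big_tnth.
pose B : 'M[A]_n := \matrix_(i, j) f j (e i).
have Be i : \sum_j (1%:M - B) i j *: e j = 0.
  under eq_bigr do rewrite !mxE scalerBl.
  rewrite sumrB -eP (bigD1 i) //= eqxx scale1r big1 ?addr0 ?subrr // => j ji.
  by rewrite eq_sym (negbTE ji) scale0r.
have det0 k : \det (1%:M - B) *: e k = 0.
  (* Multiply (1 - B) e = 0 by the adjugate. *)
  transitivity (\sum_i \adj (1%:M - B) k i *: \sum_j (1%:M - B) i j *: e j); last first.
    by rewrite big1 // => i _; rewrite Be scaler0.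
  under eq_bigr do (rewrite scaler_sumr; under eq_bigr do rewrite scalerA).
  rewrite exchange_big /=; under eq_bigr do rewrite -scaler_suml.
  have := mul_adj_mx (1%:M - B) => /matrixP adjE.
  under eq_bigr => j _ do (have := adjE k j; rewrite !mxE => ->).
  rewrite (bigD1 k) //= eqxx big1 ?addr0 // => j jk.
  by rewrite eq_sym (negbTE jk) scale0r.
have {}det0 : \det (1%:M - B) = 0.
  apply: fM => x; rewrite (eP x) scaler_sumr big1 // => j _.
  by rewrite scalerA mulrC -scalerA det0 scaler0.
rewrite -[1]subr0 -det0; apply: trace_det => i j; rewrite mxE.
exact: in_trace_apply.
Qed.

Lemma faithfully_projectiveP :
  faithfully_projective M <-> has_dual_basis /\ in_trace 1.
Proof.
split=> [[fg pr fa]|[db tr]]; last exact: dual_basis_faithfully_projective.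
have db := projective_dual_basis fg pr.
by split=> //; apply: faithful_trace.
Qed.

End DualBasis.

Section Transfer.
Variables (A A' : comPzRingType) (h : {rmorphism A' -> A}) (h' : A -> A').
Variables (M : lmodType A) (M' : lmodType A').
Variables (phi : M' -> M) (psi : M -> M').
Hypotheses (hK : cancel h h') (h'K : cancel h' h).
Hypotheses (phiK : cancel phi psi) (psiK : cancel psi phi).
Hypotheses (phiD : addmap phi) (phiZ : forall a x, phi (a *: x) = h a *: phi x).

(** The base ring changes together with the module: this is applied along the middle swap that
    compares [tens2] of a tensor product with the tensor product of the [tens2], and along the flip
    of S (x) S. *)
Lemma faithfully_projective_transfer :
  faithfully_projective M -> faithfully_projective M'.
Proof.
have h'D : addmap h' by move=> x y; rewrite -[x in LHS]h'K -[y in LHS]h'K -rmorphD hK.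
have h'M a x : h' (h a * x) = a * h' x by rewrite -[x in LHS]h'K -rmorphM hK.
have psiD : addmap psi by move=> x y; rewrite -[x in LHS]psiK -[y in LHS]psiK -phiD phiK.
have psiZ a x : psi (a *: x) = h' a *: psi x.
  by apply: (can_inj phiK); rewrite phiZ !psiK h'K.
have gl (g : dual M) : linear (fun x => h' (g (phi x)) : A'^o).
  by move=> a x y; rewrite phiD phiZ linearP h'D [_ *: g _]/(_ * _) h'M.
move=> /faithfully_projectiveP [[s sP] [t t1]]; apply/faithfully_projectiveP; split.
- exists [seq (psi p.1, dual_mk (gl p.2)) | p <- s] => x.
  rewrite big_map -[LHS]phiK {1}(sP (phi x)) (addmap_sum _ _ psiD).
  by apply: eq_bigr => p _; rewrite psiZ.
- exists [seq (psi p.1, dual_mk (gl p.2)) | p <- t].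
  rewrite big_map -[LHS]hK rmorph1 t1 (addmap_sum _ _ h'D).
  by apply: eq_bigr => p _; rewrite /= psiK.
Qed.

End Transfer.

Section TensFP.
Variables (A B C : comPzRingType).
Variables (f : {rmorphism A -> B}) (g : {rmorphism A -> C}).
Variables (M : lmodType B) (N : lmodType C).

Lemma dual_tens_bal (u : dual M) (v : dual N) :
  balanced f g (fun m n => rpure f g (u m) (v n)).
Proof.
split=> [m m' n|m n n'|a m n].
- by rewrite linearD; apply: tpureDl.
- by rewrite linearD; apply: tpureDr.
- by rewrite !linearZ; apply: (tpureZ f g a (u m : B^o) (v n : C^o)).
Qed.

Lemma dual_tens_linear (u : dual M) (v : dual N) :
  linear (tlift (fun m n => rpure f g (u m) (v n)) : tens f g M N -> (tensR f g)^o).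
Proof.
have bD := tliftD (dual_tens_bal u v).
move=> a x y; rewrite bD; congr (_ + _).
elim/tens_ind: x => [|x x' IHx IHx'|m n].
- by rewrite scaler0 (addmap0 bD) scaler0.
- by rewrite scalerDr !bD IHx IHx' scalerDr.
elim/tens_ind: a => [|a a' IHa IHa'|b c].
- by rewrite !scale0r (addmap0 bD).
- by rewrite !scalerDl bD IHa IHa'.
rewrite -[tpure f g b c]/(rpure f g b c) scale_rpure !(tlift_pure (dual_tens_bal _ _)).
by rewrite !linearZ [RHS]rpureM.
Qed.

Definition dual_tens (u : dual M) (v : dual N) : dual (tens f g M N) :=
  dual_mk (dual_tens_linear u v).

Lemma dual_tensE u v m n :
  dual_tens u v (tpure f g m n) = rpure f g (u m) (v n).
Proof. exact: (tlift_pure (dual_tens_bal u v)). Qed.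

(** Products of dual basis pairs form a dual basis, and 1 (x) 1 is a product of two sums of
    traces. *)
Lemma faithfully_projective_tens :
  faithfully_projective M -> faithfully_projective N ->
  faithfully_projective (tens f g M N).
Proof.
move=> /faithfully_projectiveP [[s sP] [t t1]] /faithfully_projectiveP [[s' s'P] [t'
    t'1]].
apply/faithfully_projectiveP; split.
- exists [seq (tpure f g p.1 q.1, dual_tens p.2 q.2) | p <- s, q <- s'].
  apply: tens_ext => [//|x y|m n].
    by rewrite -big_split; apply: eq_bigr => p _; rewrite linearD scalerDl.
  rewrite big_allpairs_dep {1}(sP m) {1}(s'P n) tpure_suml; apply: eq_bigr => p _.
  rewrite tpure_sumr; apply: eq_bigr => q _; rewrite -scale_rpure.
  by congr (_ *: _); rewrite dual_tensE.
- exists [seq (tpure f g p.1 q.1, dual_tens p.2 q.2) | p <- t, q <- t'].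
  rewrite big_allpairs_dep -[LHS]/(rpure f g 1 1) t1 t'1 [LHS]tpure_suml;
      apply: eq_bigr => p _.
  rewrite [LHS]tpure_sumr; apply: eq_bigr => q _; by rewrite dual_tensE.
Qed.

End TensFP.

(** * Tensor products of Azumaya corings *)

Section TensorCoring.
Variables (R : comPzRingType) (S T : ralg R).
Variables (C : coring_data S) (D : coring_data T).
Notation i := (ralg_str S).
Notation j := (ralg_str T).
Notation ST := (ralg_tens S T).
Notation CD := (coring_tens_mod C D).
Notation cp := (@coring_tens_pure R S T C D).
Notation st := (rpure i j).
Implicit Types (P : zmodType).

Lemma cpDl d : addmap (fun c => cp c d). Proof. exact: tpureDl. Qed.
Lemma cpDr c : addmap (cp c). Proof. exact: tpureDr. Qed.

Lemma cp_ext P (h k : CD -> P) : addmap h -> addmap k ->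
  (forall c d, h (cp c d) = k (cp c d)) -> h =1 k.
Proof. exact: tens_ext. Qed.

Lemma st_ind (Q : ST -> Prop) : Q 0 -> (forall x y, Q x -> Q y -> Q (x + y)) ->
  (forall s t, Q (st s t)) -> forall x, Q x.
Proof. exact: tens_ind. Qed.

Lemma swap_mid_l s t : swap_mid S T (left2 ST (st s t)) =
  rpure (str2 S) (str2 T) (left2 S s) (left2 T t).
Proof.
rewrite [LHS]rlift_inl [LHS]rlift_pure [LHS]rpureM.
by rewrite mulr1 mul1r.
Qed.

Lemma swap_mid_r s t : swap_mid S T (right2 ST (st s t)) =
  rpure (str2 S) (str2 T) (right2 S s) (right2 T t).
Proof.
rewrite [LHS]rlift_inr [LHS]rlift_pure [LHS]rpureM.
by rewrite mulr1 mul1r.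
Qed.

Lemma cp_l s t c d : left2 ST (st s t) *: cp c d = cp (left2 S s *: c) (left2 T t *: d).
Proof.
rewrite -[LHS]/(swap_mid S T (left2 ST (st s t)) *: tpure (str2 S) (str2 T) c d).
by rewrite swap_mid_l scale_rpure.
Qed.

Lemma cp_r s t c d : right2 ST (st s t) *: cp c d =
    cp (right2 S s *: c) (right2 T t *: d).
Proof.
rewrite -[LHS]/(swap_mid S T (right2 ST (st s t)) *: tpure (str2 S) (str2 T) c d).
by rewrite swap_mid_r scale_rpure.
Qed.

Lemma cp_semilinear (A : comPzRingType) (V : lmodType A)
    (m : {rmorphism ST -> tens2 ST}) (m' : {rmorphism ST -> A}) (h : CD -> V) :
  addmap h ->
  (forall s t c d, h (m (st s t) *: cp c d) = m' (st s t) *: h (cp c d)) ->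
  forall x c, h (m x *: c) = m' x *: h c.
Proof.
move=> hD hm x c.
apply: (@cp_ext _ (fun c => h (m x *: c)) (fun c => m' x *: h c)) => {c} [c c'|c c'|c d];
  rewrite ?scalerDr ?hD ?scalerDr //.
elim/st_ind: x => [|x y IHx IHy|s t] //; first by rewrite !rmorph0 !scale0r addmap0.
by rewrite !rmorphD !scalerDl hD IHx IHy.
Qed.

Lemma cp_linear (V : lmodType (tens2 ST)) (h : CD -> V) : addmap h ->
  (forall s t c d, h (left2 ST (st s t) *: cp c d) = left2 ST (st s t) *: h (cp c d)) ->
  (forall s t c d, h (right2 ST (st s t) *: cp c d) = right2 ST (st s t) *: h (cp c d)) ->
  linear h.
Proof.
move=> hD hl hr a x y; rewrite hD; congr (_ + _).
elim/tens2_ind: a => [|a b IHa IHb|s t].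
- by rewrite !scale0r addmap0.
- by rewrite !scalerDl hD IHa IHb.
- by rewrite -!scalerA (cp_semilinear hD hl) (cp_semilinear hD hr).
Qed.

Lemma cp_bal P (K : CD -> CD -> P) :
  (forall y, addmap (K^~ y)) -> (forall x, addmap (K x)) ->
  (forall s t c d c' d',
     K (cp (right2 S s *: c) (right2 T t *: d)) (cp c' d') =
     K (cp c d) (cp (left2 S s *: c') (left2 T t *: d'))) ->
  bal2 ST K.
Proof.
move=> Kl Kr KZ; split=> [m m' n|m n n'|x m n]; [exact: Kl|exact: Kr|].
apply: (@cp_ext _ (fun m => K (right2 ST x *: m) n) (fun m => K m (left2 ST x *: n))) =>
    {m}
    [m m'|m m'|c d]; rewrite ?scalerDr ?Kl //.
apply: (@cp_ext _ (fun n => K (right2 ST x *: cp c d) n) (fun n =>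
    K (cp c d) (left2 ST x *: n))) => {n}
    [n n'|n n'|c' d']; rewrite ?scalerDr ?Kr //.
elim/st_ind: x => [|x y IHx IHy|s t].
- by rewrite !rmorph0 !scale0r (addmap0 (Kl _)) (addmap0 (Kr _)).
- by rewrite !rmorphD !scalerDl Kl Kr IHx IHy.
- by rewrite cp_r cp_l KZ.
Qed.

Lemma bal_cpl P (K : CD -> CD -> P) d d' : bal2 ST K ->
  bal2 S (fun c c' => K (cp c d) (cp c' d')).
Proof.
move=> bK; split=> [m m' n|m n n'|a m n].
- by rewrite cpDl (balDl bK).
- by rewrite cpDl (balDr bK).
- have := balZ bK (st a 1) (cp m d) (cp n d').
  by rewrite cp_l cp_r !rmorph1 !scale1r.
Qed.

Lemma bal_cpr P (K : CD -> CD -> P) c c' : bal2 ST K ->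
  bal2 T (fun d d' => K (cp c d) (cp c' d')).
Proof.
move=> bK; split=> [m m' n|m n n'|a m n].
- by rewrite cpDr (balDl bK).
- by rewrite cpDr (balDr bK).
- have := balZ bK (st 1 a) (cp c m) (cp c' n).
  by rewrite cp_l cp_r !rmorph1 !scale1r.
Qed.

Hypotheses (hLC : linear (comul (c := C) : C -> tensS_bimod C C)).
Hypotheses (hLD : linear (comul (c := D) : D -> tensS_bimod D D)).

Definition sw2 P (K : CD -> CD -> P) c d :=
  sw (fun c1 c2 => sw (fun d1 d2 => K (cp c1 d1) (cp c2 d2)) d) c.

Lemma sw2_bal P (K : CD -> CD -> P) : bal2 ST K ->
  balanced (str2 S) (str2 T) (sw2 K).
Proof.
move=> bK; split=> [c c' d|c d d'|r c d].
- by apply: (swD hLC); apply: bal_param => d1 d2; apply: bal_cpl.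
- apply: tlift_split => c1 c2; apply: (swD hLD); exact: bal_cpr.
- rewrite /sw2 -[str2 S r]/(left2 S (i r)) -[str2 T r]/(left2 T (j r)).
  rewrite (sw_l hLC (b := fun c1 c2 => sw (fun d1 d2 => K (cp c1 d1) (cp c2 d2)) d));
    last by apply: bal_param => d1 d2; apply: bal_cpl.
  apply: sw_ext => c1 c2.
  rewrite (sw_l hLD (b := fun d1 d2 => K (cp c1 d1) (cp c2 d2))); last exact: bal_cpr.
  apply: sw_ext => d1 d2; congr (K _ _).
  exact: (tpureZ (str2 S) (str2 T)).
Qed.

Lemma comul_cp c d : comul (c := coring_tens C D) (cp c d) =
  sw2 (fun x y => tpure (right2 ST) (left2 ST) x y
    : tensS (coring_tens_mod C D) (coring_tens_mod C D)) c d.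
Proof. exact: (tlift_pure (sw2_bal (tpure_balanced _ _ _ _)) c d). Qed.

Lemma sw_cp P (K : CD -> CD -> P) c d : bal2 ST K ->
  sw (C := coring_tens C D) K (cp c d) = sw2 K c d.
Proof.
move=> bK; rewrite /sw comul_cp /sw2 (addmap_sw _ _ (tliftD bK)); apply: sw_ext => c1 c2.
rewrite (addmap_sw _ _ (tliftD bK)); apply: sw_ext => d1 d2.
by rewrite (tlift_pure bK).
Qed.

Lemma coring_tens_comulD : addmap (comul (c := coring_tens C D)).
Proof. exact: (tliftD (sw2_bal (tpure_balanced _ _ _ _))). Qed.

Lemma coring_tens_linear : linear (comul (c := coring_tens C D) :
  coring_tens C D -> tensS_bimod (coring_tens C D) (coring_tens C D)).
Proof.
apply: cp_linear; first exact: coring_tens_comulD.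
- move=> s t c d; rewrite cp_l !comul_cp /sw2.
  have tb := tpure_balanced (right2 ST) (left2 ST) CD CD.
  rewrite (sw_l hLC); last by apply: bal_param => d1 d2; apply: (bal_cpl _ _ tb).
  rewrite [RHS](addmap_sw (h := fun x : tensS_bimod CD CD => left2 ST (st s t) *: x));
    last by move=> ? ?; rewrite scalerDr.
  apply: sw_ext => c1 c2; rewrite (sw_l hLD); last exact: (bal_cpr _ _ tb).
  rewrite [RHS](addmap_sw (h := fun x : tensS_bimod CD CD => left2 ST (st s t) *: x));
    last by move=> ? ?; rewrite scalerDr.
  by apply: sw_ext => d1 d2; rewrite [RHS]tensS_l cp_l.
- move=> s t c d; rewrite cp_r !comul_cp /sw2.
  have tb := tpure_balanced (right2 ST) (left2 ST) CD CD.
  rewrite (sw_r hLC); last by apply: bal_param => d1 d2; apply: (bal_cpl _ _ tb).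
  rewrite [RHS](addmap_sw (h := fun x : tensS_bimod CD CD => right2 ST (st s t) *: x));
    last by move=> ? ?; rewrite scalerDr.
  apply: sw_ext => c1 c2; rewrite (sw_r hLD); last exact: (bal_cpr _ _ tb).
  rewrite [RHS](addmap_sw (h := fun x : tensS_bimod CD CD => right2 ST (st s t) *: x));
    last by move=> ? ?; rewrite scalerDr.
  by apply: sw_ext => d1 d2; rewrite [RHS]tensS_r cp_r.
Qed.

Lemma trilin_cpl P (K : CD -> CD -> CD -> P) d1 d2 d3 : trilin (C := coring_tens C D) K ->
  trilin (fun c1 c2 c3 => K (cp c1 d1) (cp c2 d2) (cp c3 d3)).
Proof.
move=> tK; split=> c; first exact: (bal_cpl _ _ (tri12 tK _)).
exact: (bal_cpl _ _ (tri23 tK _)).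
Qed.

Lemma trilin_cpr P (K : CD -> CD -> CD -> P) c1 c2 c3 : trilin (C := coring_tens C D) K ->
  trilin (fun d1 d2 d3 => K (cp c1 d1) (cp c2 d2) (cp c3 d3)).
Proof.
move=> tK; split=> c; first exact: (bal_cpr _ _ (tri12 tK _)).
exact: (bal_cpr _ _ (tri23 tK _)).
Qed.

Lemma sw_exchange P (K : C -> C -> D -> D -> P) c d :
  sw (fun a b => sw (K a b) d) c = sw (fun a' b' => sw (fun a b => K a b a' b') c) d.
Proof. exact: tlift_exchange. Qed.

End TensorCoring.

Section TensorIsCoring.
Variables (R : comPzRingType) (S T : ralg R).
Variables (C : coring_data S) (D : coring_data T).
Hypotheses (hC : is_coring C) (hD : is_coring D).
Notation i := (ralg_str S).
Notation j := (ralg_str T).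
Notation ST := (ralg_tens S T).
Notation CD := (coring_tens_mod C D).
Notation cp := (@coring_tens_pure R S T C D).
Notation st := (rpure i j).
Let hLC := comul_linear hC.
Let hLD := comul_linear hD.
Let hL := coring_tens_linear hLC hLD.

Lemma sw2_assoc (P : zmodType) (K : CD -> CD -> CD -> P) c d :
  trilin (C := coring_tens C D) K ->
  sw (C := coring_tens C D) (fun x1 x2 => sw (C := coring_tens C D) (fun a b =>
      K a b x2) x1) (cp c d) =
  sw (C := coring_tens C D) (fun x1 x2 => sw (C := coring_tens C D) (fun a b =>
      K x1 a b) x2) (cp c d).
Proof.
move=> tK.
rewrite sw_cp //; last exact: (trilin_sw1 hL tK).
rewrite sw_cp //; last exact: (trilin_sw2 hL tK).
(* Bring both coproducts of [C] outside and both of [D] inside. Coassociativity then applies first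
   to [D] and next to [C]. *)
transitivity (sw (fun c1 c2 => sw (fun a b => sw (fun d1 d2 => sw (fun a' b' =>
  K (cp a a') (cp b b') (cp c2 d2)) d1) d) c1) c).
  apply: sw_ext => c1 c2; rewrite -sw_exchange; apply: sw_ext => d1 d2.
  by rewrite sw_cp //; apply: (tri12 tK).
transitivity (sw (fun c1 c2 => sw (fun a b => sw (fun d1 d2 => sw (fun a' b' =>
  K (cp c1 d1) (cp a a') (cp b b')) d2) d) c2) c); last first.
  apply: sw_ext => c1 c2; rewrite -sw_exchange; apply: sw_ext => d1 d2.
  by rewrite sw_cp //; apply: (tri23 tK).
transitivity (sw (fun c1 c2 => sw (fun a b => sw (fun d1 d2 => sw (fun a' b' =>
  K (cp a d1) (cp b a') (cp c2 b')) d2) d) c1) c).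
  apply: sw_ext => c1 c2; apply: sw_ext => a b.
  by rewrite (sw_assoc hD _ (trilin_cpr a b c2 tK)).
have := sw_assoc hC c (T := fun a b c2 => sw (fun d1 d2 => sw (fun a' b' =>
  K (cp a d1) (cp b a') (cp c2 b')) d2) d); apply.
apply: trilin_param => d1 d2; apply: trilin_param => a' b'; exact: trilin_cpl.
Qed.

Lemma coring_tens_counit_bal : balanced (str2 S) (str2 T)
  (fun (c : C) (d : D) => st (counit c) (counit d)).
Proof.
split=> [m m' n|m n n'|a m n].
- by rewrite (counitD hC); apply: tpureDl.
- by rewrite (counitD hD); apply: tpureDr.
- rewrite -[str2 S a]/(left2 S (i a)) -[str2 T a]/(left2 T (j a)).
  by rewrite (counit_ls hC) (counit_ls hD); apply: (tpureZ i j).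
Qed.

Lemma counit_cp c d : counit (c := coring_tens C D) (cp c d) = st (counit c) (counit d).
Proof. exact: (tlift_pure coring_tens_counit_bal). Qed.

Lemma coring_tens_counitD : addmap (counit (c := coring_tens C D)).
Proof. exact: (tliftD coring_tens_counit_bal). Qed.

Lemma coring_tens_is_coring : is_coring (coring_tens C D).
Proof.
apply: is_coringI => //.
- apply: cp_linear; first exact: coring_tens_counitD.
  + move=> s t c d; rewrite cp_l !counit_cp (counit_ls hC) (counit_ls hD).
    rewrite -[RHS]/(mul2 ST (left2 ST (st s t)) * st (counit c) (counit d)).
    by rewrite [mul2 _ _]rlift_inl rpureM.
  + move=> s t c d; rewrite cp_r !counit_cp (counit_rs hC) (counit_rs hD).
    rewrite -[RHS]/(mul2 ST (right2 ST (st s t)) * st (counit c) (counit d)).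
    by rewrite [mul2 _ _]rlift_inr rpureM.
- have tT := @trilin_tpure _ _ (coring_tens C D).
  apply: (@cp_ext R S T C D _ (sw (C := coring_tens C D) _) (sw (C :=
      coring_tens C D) _)).
  + exact: (swD hL (trilin_sw1 hL tT)).
  + exact: (swD hL (trilin_sw2 hL tT)).
  by move=> c d; apply: sw2_assoc.
- have bl : bal2 ST (fun c1 c2 : coring_tens C D => left2 ST (counit c1) *: c2).
    apply: cp_bal.
    + by move=> y x x'; rewrite coring_tens_counitD rmorphD scalerDl.
    + by move=> x y y'; rewrite scalerDr.
    + move=> s t c d c' d'; rewrite !counit_cp !cp_l (counit_rs hC) (counit_rs hD).
      by rewrite !lscaleA [s * _]mulrC [t * _]mulrC.
  apply: (@cp_ext R S T C D _ (sw (C := coring_tens C D) _) id); first exact: (swD hL bl).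
    by [].
  move=> c d; rewrite sw_cp // /sw2.
  transitivity (sw (fun c1 c2 => cp (left2 S (counit c1) *: c2) d) c); last first.
    by rewrite (sw_counitl hC _ (cpDl d)).
  apply: sw_ext => c1 c2.
  rewrite -(sw_counitl hD _ (cpDr (left2 S (counit c1) *: c2))).
  by apply: sw_ext => d1 d2; rewrite counit_cp cp_l.
- have br : bal2 ST (fun c1 c2 : coring_tens C D => right2 ST (counit c2) *: c1).
    apply: cp_bal.
    + by move=> y x x'; rewrite scalerDr.
    + by move=> x y y'; rewrite coring_tens_counitD rmorphD scalerDl.
    + move=> s t c d c' d'; rewrite !counit_cp !cp_r (counit_ls hC) (counit_ls hD).
      by rewrite !rscaleA [s * _]mulrC [t * _]mulrC.
  apply: (@cp_ext R S T C D _ (sw (C := coring_tens C D) _) id); first exact: (swD hL br).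
    by [].
  move=> c d; rewrite sw_cp // /sw2.
  transitivity (sw (fun c1 c2 => cp (right2 S (counit c2) *: c1) d) c); last first.
    by rewrite (sw_counitr hC _ (fun c c' => cpDl d c c')).
  apply: sw_ext => c1 c2.
  rewrite -(sw_counitr hD _ (cpDr (right2 S (counit c2) *: c1))).
  by apply: sw_ext => d1 d2; rewrite counit_cp cp_r.
Qed.

End TensorIsCoring.

(** * The inverse of c (x) s |-> c_(1) s (x) c_(2) in Sweedler notation *)

Notation balS S := (balanced (str2 S) (ralg_str S)).

Section CoF.
Variables (R : comPzRingType) (S : ralg R) (C : coring_data S).
Notation i := (ralg_str S).
Notation l2 := (left2 S).
Notation r2 := (right2 S).
Hypothesis hC : is_coring C.
Let hL := comul_linear hC.
Implicit Types (P : zmodType).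

Lemma coFD : addmap (coF (C := C)).
Proof. exact: (tliftD (coF_bal hC)). Qed.

(** [coF_l], [coF_r] and [coF_m] express linearity in three positions: the outer left, the outer
    right, and the middle, which is the factor S on one side and the inner tensor sign on the other.
    The inverse [G] inherits all three. *)
Lemma coF_l s x : coF (C := C) (tinl (str2 S) i (l2 s) *: x) = tinl r2 l2 (l2 s) *: coF x.
Proof.
apply: (@tens_ext _ _ _ _ _ _ _ _ (fun x : cS C => coF (C :=
    C) (tinl (str2 S) i (l2 s) *: x))
  (fun x : cS C => tinl r2 l2 (l2 s) *: coF x)) => {x} [x y|x y|c t].
- by rewrite scalerDr coFD.
- by rewrite coFD scalerDr.
rewrite scale_tinl -!/(cpure _ _) !(coF_pure hC) (sw_l hL _ _ (coF_bal0 _ _)).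
rewrite (addmap_sw (h := *:%R (tinl r2 l2 (l2 s)))); last exact: scaler_addmap.
by apply: sw_ext => a b; rewrite scale_tinl lrC.
Qed.

Lemma coF_r s x : coF (C := C) (tinl (str2 S) i (r2 s) *: x) = tinr r2 l2 (r2 s) *: coF x.
Proof.
apply: (@tens_ext _ _ _ _ _ _ _ _ (fun x : cS C => coF (C :=
    C) (tinl (str2 S) i (r2 s) *: x))
  (fun x : cS C => tinr r2 l2 (r2 s) *: coF x)) => {x} [x y|x y|c t].
- by rewrite scalerDr coFD.
- by rewrite coFD scalerDr.
rewrite scale_tinl -!/(cpure _ _) !(coF_pure hC) (sw_r hL _ _ (coF_bal0 _ _)).
rewrite (addmap_sw (h := *:%R (tinr r2 l2 (r2 s)))); last exact: scaler_addmap.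
by apply: sw_ext => a b; rewrite scale_tinr.
Qed.

Lemma coF_m s x : coF (C := C) (tinr (str2 S) i s *: x) = tinl r2 l2 (r2 s) *: coF x.
Proof.
apply: (@tens_ext _ _ _ _ _ _ _ _ (fun x : cS C => coF (C := C) (tinr (str2 S) i s *: x))
  (fun x : cS C => tinl r2 l2 (r2 s) *: coF x)) => {x} [x y|x y|c t].
- by rewrite scalerDr coFD.
- by rewrite coFD scalerDr.
rewrite scale_tinr -[tpure _ _ c t]/(cpure c t) -[tpure _ _ c _]/(cpure c (s * t))
    !(coF_pure hC).
rewrite (addmap_sw (h := *:%R (tinl r2 l2 (r2 s)))); last exact: scaler_addmap.
by apply: sw_ext => a b; rewrite scale_tinl rscaleA.
Qed.

Variable G : tensS C C -> cS C.
Hypotheses (FK : cancel (coF (C := C)) G) (GK : cancel G (coF (C := C))).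

Lemma coG_D : addmap G.
Proof. by move=> x y; rewrite -[x in LHS]GK -[y in LHS]GK -coFD FK. Qed.

Lemma coG_l s x : G (tinl r2 l2 (l2 s) *: x) = tinl (str2 S) i (l2 s) *: G x.
Proof. by apply: (can_inj FK); rewrite coF_l !GK. Qed.
Lemma coG_r s x : G (tinr r2 l2 (r2 s) *: x) = tinl (str2 S) i (r2 s) *: G x.
Proof. by apply: (can_inj FK); rewrite coF_r !GK. Qed.
Lemma coG_m s x : G (tinl r2 l2 (r2 s) *: x) = tinr (str2 S) i s *: G x.
Proof. by apply: (can_inj FK); rewrite coF_m !GK. Qed.

(* With G the inverse of coF and G (c (x) d) = sum of z (x) s, that is, with
   c (x) d = sum of z_(1) s (x) z_(2), gg K c d is the sum of the K z s. *)
Definition gg P (K : C -> S -> P) c d : P :=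
  tlift (fun c (s : S^o) => K c s) (G (tpure r2 l2 c d)).

Lemma gg_ext P (K K' : C -> S -> P) c d :
  (forall z s, K z s = K' z s) -> gg K c d = gg K' c d.
Proof. by move=> e; apply: tlift_ext => z s; apply: e. Qed.

Lemma addmap_gg P (Q : zmodType) (h : P -> Q) (K : C -> S -> P) c d :
  addmap h -> h (gg K c d) = gg (fun x y => h (K x y)) c d.
Proof. exact: addmap_tlift. Qed.

Section Bal.
Variables (P : zmodType) (K : C -> S -> P).
Hypothesis bK : balS S (fun c (s : S^o) => K c s).

Lemma gg_Dl d : addmap (fun c => gg K c d).
Proof. by move=> c c'; rewrite /gg tpureDl coG_D (tliftD bK). Qed.

Lemma gg_Dr c : addmap (gg K c).
Proof. by move=> d d'; rewrite /gg tpureDr coG_D (tliftD bK). Qed.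

Lemma gg_l s c d : gg K (l2 s *: c) d = gg (fun z t => K (l2 s *: z) t) c d.
Proof. by rewrite /gg -scale_tinl coG_l tlift_tinl. Qed.

Lemma gg_r s c d : gg K c (r2 s *: d) = gg (fun z t => K (r2 s *: z) t) c d.
Proof. by rewrite /gg -scale_tinr coG_r tlift_tinl. Qed.

Lemma gg_m s c d : gg K (r2 s *: c) d = gg (fun z t => K z (s * t)) c d.
Proof. by rewrite /gg -scale_tinl coG_m tlift_tinr. Qed.

Lemma gg_m' s c d : gg K c (l2 s *: d) = gg (fun z t => K z (s * t)) c d.
Proof. by rewrite -gg_m /gg tpureZ. Qed.

Lemma gg_bal : bal2 S (gg K).
Proof.
split=> [c c' d|c d d'|s c d]; [exact: gg_Dl|exact: gg_Dr|].
by rewrite gg_m gg_m'.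
Qed.

(** This is [FK] at z (x) s, since [coF] sends it to the sum of the z_(1) s (x) z_(2). *)
Lemma gg_sw s z : sw (fun z1 z2 => gg K (r2 s *: z1) z2) z = K z s.
Proof.
have := FK (cpure z s); rewrite (coF_pure hC) (addmap_sw _ _ coG_D).
move=> /(congr1 (tlift (fun c (s : S^o) => K c s))).
by rewrite (addmap_sw _ _ (tliftD bK)) (tlift_pure bK).
Qed.

Lemma gg_sw1 z : sw (gg K) z = K z 1.
Proof.
rewrite -gg_sw; apply: sw_ext => z1 z2; by rewrite rmorph1 scale1r.
Qed.

End Bal.

(** This is [GK] seen through [b]. Read from right to left, it turns a value at an arbitrary pair
    into a sum of values at coproducts. *)
Lemma sw_gg P (b : C -> C -> P) c d : bal2 S b ->
  gg (fun z s => sw (fun z1 z2 => b (r2 s *: z1) z2) z) c d = b c d.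
Proof.
move=> bb.
have bK : balS S (fun z (s : S^o) => sw (fun z1 z2 => b (r2 s *: z1) z2) z).
  split=> [m m' n|m n n'|a m n].
  - by rewrite (swD hL) //; apply: bal_scalel.
  - by apply: tlift_split => x y; rewrite rmorphD scalerDl (balDl bb).
  - rewrite -[str2 S a]/(l2 (i a)) (sw_l hL); last exact: bal_scalel.
    by apply: sw_ext => x y; rewrite lr_str rscaleA mulrC.
have := congr1 (tlift b) (GK (tpure r2 l2 c d)); rewrite (tlift_pure bb) => <-.
rewrite /gg; apply: (@tens_ext _ _ _ _ _ _ _ _ _ (fun x =>
    tlift b (coF x)) _ _ _ (G (tpure r2 l2 c d))).
- exact: (tliftD bK).
- by move=> x y; rewrite coFD (tliftD bb).
move=> z s; rewrite (tlift_pure bK) -[tpure _ _ _ _]/(cpure z s) (coF_pure hC).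
rewrite (addmap_sw _ _ (tliftD bb)); apply: sw_ext => z1 z2.
by rewrite (tlift_pure bb).
Qed.

End CoF.

Arguments addmap_gg {R S C G P Q h} K c d _.

Section TensorBij.
Variables (R : comPzRingType) (S T : ralg R).
Variables (C : coring_data S) (D : coring_data T).
Notation i := (ralg_str S).
Notation j := (ralg_str T).
Notation ST := (ralg_tens S T).
Notation CD := (coring_tens_mod C D).
Notation cp := (@coring_tens_pure R S T C D).
Notation st := (rpure i j).
Hypotheses (hC : is_coring C) (hD : is_coring D).
Let hLC := comul_linear hC.
Let hLD := comul_linear hD.
Let hCD := coring_tens_is_coring hC hD.

Variables (G : tensS C C -> cS C) (H : tensS D D -> cS D).
Hypotheses (FK : cancel (coF (C := C)) G) (GK : cancel G (coF (C := C))).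
Hypotheses (FK' : cancel (coF (C := D)) H) (HK : cancel H (coF (C := D))).

Definition mid4 (z : C) (s : S) (w : D) (t : T) : cS CD := cpure (cp z w) (st s t).

Lemma cp_str2 r z w : str2 ST r *: cp z w = cp (str2 S r *: z) w.
Proof.
by rewrite -[str2 ST r]/(left2 ST (st (i r) 1)) cp_l rmorph1 scale1r.
Qed.

Lemma cp_str2' r z w : cp (str2 S r *: z) w = cp z (str2 T r *: w).
Proof. exact: tpureZ. Qed.

Lemma st_strl r s t : st (i r * s) t = ralg_str ST r * st s t.
Proof. by rewrite [RHS]rpureM mul1r. Qed.

Lemma st_strr r s t : st s (j r * t) = ralg_str ST r * st s t.
Proof. by rewrite -st_strl; symmetry; apply: (tpureZ i j r (s : S^o) (t : T^o)). Qed.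

Lemma cpure_Z (V : lmodType (tens2 ST)) r (x : V) (s : ST) :
  cpure (str2 ST r *: x) s = cpure x (ralg_str ST r * s) :> cS V.
Proof. exact: (tpureZ _ _ r x (s : ST^o)). Qed.

Lemma mid4_bal1 w t : balS S (fun z (s : S^o) => mid4 z s w t).
Proof.
split=> [m m' n|m n n'|a m n].
- by rewrite /mid4 cpDl; apply: tpureDl.
- rewrite /mid4 -[RHS]tpureDr; congr (cpure _ _); exact: tpureDl.
- by rewrite /mid4 -cp_str2 cpure_Z -st_strl.
Qed.

Lemma mid4_bal2 z s : balS T (fun w (t : T^o) => mid4 z s w t).
Proof.
split=> [m m' n|m n n'|a m n].
- by rewrite /mid4 cpDr; apply: tpureDl.
- rewrite /mid4 -[RHS]tpureDr; congr (cpure _ _); exact: tpureDr.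
- by rewrite /mid4 -cp_str2' -cp_str2 cpure_Z -st_strr.
Qed.

(** The inverse for C (x) D is computed factor by factor, with [G] on c (x) c' and [H] on d (x)
    d'. *)
Definition mixG c d c' d' : cS CD :=
  gg G (fun z s => gg H (fun w t => mid4 z s w t) d d') c c'.

Lemma mixG_bal1 d d' : balS S (fun z (s : S^o) => gg H (fun w t => mid4 z s w t) d d').
Proof. by apply: bal_param => w t; apply: mid4_bal1. Qed.

Lemma mixG_exchange c d c' d' :
  mixG c d c' d' = gg H (fun w t => gg G (fun z s => mid4 z s w t) c c') d d'.
Proof. exact: tlift_exchange. Qed.

Lemma mixG_balC c' d' : balanced (str2 S) (str2 T) (fun c d => mixG c d c' d').
Proof.
split=> [m m' n|m n n'|a m n].
- exact: (gg_Dl hC FK GK (mixG_bal1 _ _)).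
(* Additivity in [d] is a property of the sum given by [H], which is therefore brought outside. *)
- rewrite !mixG_exchange; apply: (gg_Dl hD FK' HK).
  by apply: bal_param => z s; apply: mid4_bal2.
- rewrite /mixG -[str2 S a]/(left2 S (i a)) (gg_l hC FK GK (mixG_bal1 _ _)).
  apply: gg_ext => z s.
  rewrite -[str2 T a]/(left2 T (j a)) (gg_l hD FK' HK (mid4_bal2 _ _)).
  apply: gg_ext => w t; rewrite /mid4; congr (cpure _ _); exact: cp_str2'.
Qed.

Lemma mixG_balD c d : balanced (str2 S) (str2 T) (fun c' d' => mixG c d c' d').
Proof.
split=> [m m' n|m n n'|a m n].
- exact: (gg_Dr hC FK GK (mixG_bal1 _ _)).
- rewrite !mixG_exchange; apply: (gg_Dr hD FK' HK).
  by apply: bal_param => z s; apply: mid4_bal2.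
- rewrite /mixG -[str2 S a]/(left2 S (i a)) lr_str (gg_r hC FK GK (mixG_bal1 _ _)).
  apply: gg_ext => z s.
  rewrite -[str2 T a]/(left2 T (j a)) lr_str (gg_r hD FK' HK (mid4_bal2 _ _)).
  apply: gg_ext => w t; rewrite /mid4; congr (cpure _ _); rewrite -!lr_str;
      exact: cp_str2'.
Qed.

Definition tensG2 (x y : CD) : cS CD :=
  tlift (fun c d => tlift (fun c' d' => mixG c d c' d') (y : tens (str2 S) (str2 T) C D))
    (x : tens (str2 S) (str2 T) C D).

Lemma tensG2_Dl y : addmap (tensG2^~ y).
Proof. by apply: tliftD; apply: bal_param => c' d'; apply: mixG_balC. Qed.

Lemma tensG2_Dr x : addmap (tensG2 x).
Proof. by move=> y y'; apply: tlift_split => c d; apply: (tliftD (mixG_balD c d)). Qed.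

Lemma tensG2_cp c d c' d' : tensG2 (cp c d) (cp c' d') = mixG c d c' d'.
Proof.
rewrite /tensG2 tlift_pure; first exact: (tlift_pure (mixG_balD c d)).
by apply: bal_param => ? ?; apply: mixG_balC.
Qed.

Lemma tensG2_bal : bal2 ST tensG2.
Proof.
apply: cp_bal; [exact: tensG2_Dl|exact: tensG2_Dr|].
move=> s t c d c' d'; rewrite !tensG2_cp /mixG.
rewrite (gg_m hC FK GK (mixG_bal1 _ _)) (gg_m' hC FK GK (mixG_bal1 _ _)).
apply: gg_ext => z s'.
by rewrite (gg_m hD FK' HK (mid4_bal2 _ _)) (gg_m' hD FK' HK (mid4_bal2 _ _)).
Qed.

Definition tensG : tensS CD CD -> cS CD := tlift tensG2.

Notation coFCD := (coF (C := coring_tens C D)).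

Lemma tensG_D : addmap tensG.
Proof. exact: (tliftD tensG2_bal). Qed.

Lemma tensG_coF_pure z w s t : tensG (coFCD (cpure (cp z w) (st s t))) = mid4 z s w t.
Proof.
rewrite (coF_pure hCD) sw_cp //; last exact: (@coF_bal0 _ _ (coring_tens C D)).
rewrite /sw2 (addmap_sw _ _ tensG_D).
(* Regroup so that the sums over [C] enclose those over [D]; [gg_sw] then collapses [C], and after
   it [D]. *)
transitivity (sw (fun z1 z2 => gg G (fun z' s' => sw (fun w1 w2 =>
    gg H (fun w' t' => mid4 z' s' w' t') (right2 T t *: w1) w2) w) (right2 S s *: z1) z2)
        z).
  apply: sw_ext => z1 z2; rewrite (addmap_sw _ _ tensG_D).
  rewrite [RHS]tlift_exchange; apply: sw_ext => w1 w2.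
  by rewrite /tensG (tlift_pure tensG2_bal) cp_r tensG2_cp.
rewrite (gg_sw hC FK GK (K := fun z' s' => sw (fun w1 w2 => gg H (fun w' t' =>
    mid4 z' s' w' t') (right2 T t *: w1) w2) w)).
  by rewrite (gg_sw hD FK' HK (mid4_bal2 _ _)).
apply: bal_param => w1 w2; exact: mixG_bal1.
Qed.

Lemma coF_tensG_pure c d c' d' : coFCD (tensG2 (cp c d) (cp c' d')) =
  tpure (right2 ST) (left2 ST) (cp c d) (cp c' d').
Proof.
rewrite tensG2_cp /mixG (addmap_gg _ _ _ (coFD hCD)).
pose tb := tpure_balanced (right2 ST) (left2 ST) CD CD.
rewrite -(sw_gg hC GK (b := fun c c' => tpure (right2 ST) (left2 ST) (cp c d) (cp c'
    d')));
  last exact: (bal_cpl _ _ tb).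
apply: gg_ext => z s; rewrite (addmap_gg _ _ _ (coFD hCD)).
transitivity (gg H (fun w t => sw (fun w1 w2 => sw (fun z1 z2 =>
    tpure (right2 ST) (left2 ST) (cp (right2 S s *: z1) (right2 T t *: w1)) (cp z2 w2))
        z) w) d d').
  apply: gg_ext => w t; rewrite [LHS](coF_pure hCD) sw_cp //;
      last exact: (@coF_bal0 _ _ (coring_tens C D)).
  rewrite /sw2 sw_exchange; apply: sw_ext => w1 w2; apply: sw_ext => z1 z2.
  by rewrite cp_r.
rewrite (sw_gg hD HK (b := fun d d' => sw (fun z1 z2 =>
    tpure (right2 ST) (left2 ST) (cp (right2 S s *: z1) d) (cp z2 d')) z)) //.
by apply: bal_param => z1 z2; apply: (bal_cpr _ _ tb).
Qed.

Lemma tensG_coF x : tensG (coFCD x) = x.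
Proof.
elim/tens_ind: x => [|x y IHx IHy|x y].
- by rewrite (addmap0 (coFD hCD)) (addmap0 tensG_D).
- by rewrite (coFD hCD) tensG_D IHx IHy.
change (tensG (coFCD (cpure x y)) = cpure x y).
move: x; apply: cp_ext => [x x'|x x'|z w].
- rewrite -tensG_D -(coFD hCD); congr (tensG (coFCD _)); exact: tpureDl.
- exact: tpureDl.
elim/st_ind: y => [|y y' IHy IHy'|s t].
- have -> : cpure (cp z w) 0 = 0 by exact: tpure0r.
  by rewrite (addmap0 (coFD hCD)) (addmap0 tensG_D).
- have -> : cpure (cp z w) (y + y') = cpure (cp z w) y + cpure (cp z w) y'.
    exact: tpureDr.
  by rewrite (coFD hCD) tensG_D IHy IHy'.
exact: tensG_coF_pure.
Qed.

Lemma coF_tensG x : coFCD (tensG x) = x.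
Proof.
elim/tens_ind: x => [|x y IHx IHy|x y].
- by rewrite (addmap0 tensG_D) (addmap0 (coFD hCD)).
- by rewrite tensG_D (coFD hCD) IHx IHy.
rewrite /tensG (tlift_pure tensG2_bal).
move: x; apply: cp_ext => [x x'|x x'|c d].
- by rewrite tensG2_Dl (coFD hCD).
- exact: tpureDl.
move: y; apply: cp_ext => [y y'|y y'|c' d'].
- by rewrite tensG2_Dr (coFD hCD).
- exact: tpureDr.
exact: coF_tensG_pure.
Qed.

Lemma coring_tens_coF_bij : bijective coFCD.
Proof. by exists tensG; [exact: tensG_coF|exact: coF_tensG]. Qed.

End TensorBij.

(** * Faithful flatness and finite presentation *)

Section ExactTransfer.
Variables (U V W U' V' W' : zmodType).
Variables (u : U -> V) (v : V -> W) (u' : U' -> V') (v' : V' -> W').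
Variables (a : U -> U') (b : V -> V') (c : W -> W').

Lemma exact_transfer : bijective a -> bijective b -> bijective c -> c 0 = 0 ->
  (forall x, b (u x) = u' (a x)) -> (forall y, c (v y) = v' (b y)) ->
  exact_seq u v <-> exact_seq u' v'.
Proof.
move=> [a' aK a'K] [b' bK b'K] [c' cK c'K] c0 bu cv; split=> ex y.
- have e : v' y = 0 <-> v (b' y) = 0.
    rewrite -{1}(b'K y) -cv -c0; split=> [/(can_inj cK) //|->] //.
  apply: (iff_trans e); apply: (iff_trans (ex _)); split=> [[x xP]|[x xP]].
  + by exists (a x); rewrite -bu xP b'K.
  + by exists (a' x); rewrite -xP -[LHS]bK bu a'K.
- have e : v y = 0 <-> v' (b y) = 0.
    by rewrite -cv -c0; split=> [->|/(can_inj cK)].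
  apply: (iff_trans e); apply: (iff_trans (ex _)); split=> [[x xP]|[x xP]].
  + by exists (a' x); apply: (can_inj bK); rewrite bu a'K.
  + by exists (a x); rewrite -bu xP.
Qed.

End ExactTransfer.

Section BaseChange.
Variables (R : comPzRingType) (T : ralg R).
Notation j := (ralg_str T).

Definition bchange (X : lmodType R) := tens j idfun T^o X.

(** T (x) X is viewed as an R-module again, so that the faithful flatness of [S], which quantifies
    over R-modules, applies to it. *)
Definition bchangeR (X : lmodType R) : lmodType R :=
  restr (tinl j idfun \o j) (bchange X).

Definition bpure (X : lmodType R) (t : T) (x : X) : bchange X :=
  tpure j idfun (t : T^o) x.

Lemma bpureZ (X : lmodType R) r t (x : X) : bpure (j r * t) x = bpure t (r *: x).
Proof. exact: (tpureZ j idfun r (t : T^o) x). Qed.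

Lemma bchangeR_scale (X : lmodType R) r t (x : X) :
  r *: (bpure t x : bchangeR X) = bpure (j r * t) x.
Proof. exact: (scale_tinl j idfun (j r) (t : T^o) x). Qed.

Definition bmap (X Y : lmodType R) (h : X -> Y) : bchange X -> bchange Y :=
  tlift (fun (t : T^o) x => tpure j idfun t (h x)).

Lemma bmap_bal (X Y : lmodType R) (h : {linear X -> Y}) :
  balanced j idfun (fun (t : T^o) x => tpure j idfun t (h x)).
Proof.
split=> [t t' x|t x x'|r t x].
- exact: tpureDl.
- by rewrite linearD tpureDr.
- by rewrite tpureZ linearZ.
Qed.

Lemma bmap_linear (X Y : lmodType R) (h : {linear X -> Y}) :
  linear (bmap h : bchangeR X -> bchangeR Y).
Proof.
have hD := tliftD (bmap_bal h).
move=> r x y; rewrite /bmap hD; congr (_ + _).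
elim/tens_ind: x => [|x x' IHx IHx'|t x].
- by rewrite scaler0 (addmap0 hD) scaler0.
- by rewrite scalerDr !hD IHx IHx' scalerDr.
- rewrite [_ *: _](bchangeR_scale r t x) (tlift_pure (bmap_bal h)).
  by rewrite (tlift_pure (bmap_bal h)) [RHS](bchangeR_scale r t (h x)).
Qed.

Definition bmapL (X Y : lmodType R) (h : {linear X -> Y}) :
    {linear bchangeR X -> bchangeR Y} :=
  HB.pack_for {linear bchangeR X -> bchangeR Y} (bmap h : bchangeR X -> bchangeR Y)
    (GRing.isLinear.Build R (bchangeR X) (bchangeR Y) *:%R (bmap h) (bmap_linear h)).

End BaseChange.

Arguments bmap {R} T {X Y} h _.
Arguments bmapL {R} T {X Y} h.
Arguments bmap_bal {R} T {X Y} h.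

Section FlatTens.
Variables (R : comPzRingType) (S T : ralg R).
Notation i := (ralg_str S).
Notation j := (ralg_str T).
Notation ST := (ralg_tens S T).

Section Iso.
Variable X : lmodType R.

Definition assoc1 (y : ST) (x : X) : bchange S (bchangeR T X) :=
  tlift (fun (s : S^o) (t : T^o) => tpure i idfun s (bpure t x : bchangeR T X))
    (y : tens i j S^o T^o).

Lemma assoc1_bal0 x : balanced i j (fun (s : S^o) (t : T^o) =>
  tpure i idfun s (bpure t x : bchangeR T X)).
Proof.
split=> [s s' t|s t t'|r s t].
- exact: tpureDl.
- by rewrite -tpureDr; congr (tpure _ _ _ _); apply: tpureDl.
- by rewrite tpureZ bchangeR_scale.
Qed.

Lemma assoc1_pure s t x : assoc1 (rpure i j s t) x =
  tpure i idfun (s : S^o) (bpure t x : bchangeR T X).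
Proof. exact: (tlift_pure (assoc1_bal0 x)). Qed.

Lemma assoc1_bal : balanced (ralg_str ST) idfun (fun (y : ST^o) x => assoc1 y x).
Proof.
split=> [y y' x|y x x'|r y x].
- exact: (tliftD (assoc1_bal0 x)).
- apply: tlift_split => s t; rewrite -tpureDr; congr (tpure _ _ _ _).
  exact: tpureDr.
- change (assoc1 (ralg_str ST r * y) x = assoc1 y (r *: x)).
  elim/tens_ind: y => [|y y' IHy IHy'|s t].
  + by rewrite mulr0 /assoc1 (addmap0 (tliftD (assoc1_bal0 x))) (addmap0 (tliftD
      (assoc1_bal0 _))).
  + by rewrite mulrDr /assoc1 !(tliftD (assoc1_bal0 _)) -!/(assoc1 _ _) IHy IHy'.
  + change (assoc1 (rpure i j (i r) 1 * rpure i j s t) x =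
      assoc1 (rpure i j s t) (r *: x)).
    rewrite rpureM mul1r !assoc1_pure -bpureZ -bchangeR_scale.
    exact: (tpureZ i idfun r (s : S^o)).
Qed.

Definition assocF : bchange ST X -> bchange S (bchangeR T X) :=
  tlift (fun (y : ST^o) x => assoc1 y x).

Definition assoc2 (s : S) (z : bchangeR T X) : bchange ST X :=
  tlift (fun (t : T^o) x => bpure (rpure i j s t : ST) x) (z : tens j idfun T^o X).

Lemma assoc2_bal0 s : balanced j idfun (fun (t : T^o) (x : X) => bpure (rpure i j s t :
    ST) x).
Proof.
split=> [t t' x|t x x'|r t x].
- rewrite /bpure -tpureDl; congr (tpure _ _ _ _); exact: tpureDr.
- exact: tpureDr.
- change (bpure (rpure i j s (j r * t) : ST) x = bpure (rpure i j s t : ST) (r *: x));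
    rewrite -bpureZ; congr (bpure _ _).
  rewrite [RHS]rpureM mul1r; symmetry; exact: (tpureZ i j r (s : S^o) t).
Qed.

Lemma assoc2_pure s t x : assoc2 s (bpure t x) = bpure (rpure i j s t : ST) x.
Proof. exact: (tlift_pure (assoc2_bal0 s)). Qed.

Lemma assoc2_bal : balanced i idfun (fun (s : S^o) z => assoc2 s z).
Proof.
split=> [s s' z|s z z'|r s z].
- apply: tlift_split => t x; rewrite /bpure -tpureDl; congr (tpure _ _ _ _).
  exact: tpureDl.
- exact: (tliftD (assoc2_bal0 s)).
- change (assoc2 (i r * s) z = assoc2 s (r *: z)).
  elim/tens_ind: z => [|z z' IHz IHz'|t x].
  + by rewrite scaler0 /assoc2 (addmap0 (tliftD (assoc2_bal0 _))) (addmap0 (tliftD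
      (assoc2_bal0 _))).
  + by rewrite scalerDr /assoc2 !(tliftD (assoc2_bal0 _)) -!/(assoc2 _ _) IHz IHz'.
  + rewrite -[tpure _ _ _ _]/(bpure t x) bchangeR_scale !assoc2_pure.
    by congr (bpure _ _); apply: (tpureZ i j r (s : S^o) (t : T^o)).
Qed.

Definition assocB : bchange S (bchangeR T X) -> bchange ST X :=
  tlift (fun (s : S^o) z => assoc2 s z).

Lemma assocF_D : addmap assocF. Proof. exact: (tliftD assoc1_bal). Qed.
Lemma assocB_D : addmap assocB. Proof. exact: (tliftD assoc2_bal). Qed.

Lemma assocF_pure s t x : assocF (bpure (rpure i j s t : ST) x) =
  bpure s (bpure t x : bchangeR T X).
Proof. by rewrite /assocF (tlift_pure assoc1_bal) assoc1_pure. Qed.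

Lemma assocB_pure s t x : assocB (bpure s (bpure t x : bchangeR T X)) =
  bpure (rpure i j s t : ST) x.
Proof. by rewrite /assocB (tlift_pure assoc2_bal) assoc2_pure. Qed.

Lemma bchangeST_ind (Q : bchange ST X -> Prop) : Q 0 ->
  (forall x y, Q x -> Q y -> Q (x + y)) ->
  (forall s t x, Q (bpure (rpure i j s t : ST) x)) -> forall x, Q x.
Proof.
move=> Q0 QD Qp; elim/tens_ind=> // y x; elim/tens_ind: y => [|y y' IHy IHy'|s t].
- by rewrite tpure0l.
- by rewrite tpureDl; apply: QD.
- exact: Qp.
Qed.

Lemma bchangeS_ind (Q : bchange S (bchangeR T X) -> Prop) : Q 0 ->
  (forall x y, Q x -> Q y -> Q (x + y)) ->
  (forall s t x, Q (bpure s (bpure t x : bchangeR T X))) -> forall x, Q x.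
Proof.
move=> Q0 QD Qp; elim/tens_ind=> // s z; elim/tens_ind: z => [|y y' IHy IHy'|t x].
- by rewrite [X in Q X]tpure0r.
- by rewrite [X in Q X]tpureDr; apply: QD.
- exact: Qp.
Qed.

Lemma assocF_bij : bijective assocF.
Proof.
exists assocB.
- elim/bchangeST_ind=> [|x y IHx IHy|s t x].
  + by rewrite (addmap0 assocF_D) (addmap0 assocB_D).
  + by rewrite assocF_D assocB_D IHx IHy.
  + by rewrite assocF_pure assocB_pure.
- elim/bchangeS_ind=> [|x y IHx IHy|s t x].
  + by rewrite (addmap0 assocB_D) (addmap0 assocF_D).
  + by rewrite assocB_D assocF_D IHx IHy.
  + by rewrite assocB_pure assocF_pure.
Qed.

End Iso.

Lemma assocF_nat (X Y : lmodType R) (h : {linear X -> Y}) x :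
  assocF (bmap ST h x) = bmap S (bmapL T h) (assocF x).
Proof.
have bD := tliftD (bmap_bal ST h); have bD' := tliftD (bmap_bal S (bmapL T h)).
elim/bchangeST_ind: x => [|x y IHx IHy|s t x].
- by rewrite /bmap (addmap0 bD) !(addmap0 (@assocF_D _)) (addmap0 bD').
- by rewrite /bmap bD !assocF_D bD' -!/(bmap _ _ _) IHx IHy.
- rewrite assocF_pure /bmap (tlift_pure (bmap_bal ST h)).
  rewrite (tlift_pure (bmap_bal S (bmapL T h))).
  rewrite -[LHS]/(assocF (bpure (rpure i j s t : ST) (h x))) assocF_pure.
  congr (tpure _ _ _ _); symmetry; exact: (tlift_pure (bmap_bal T h)).
Qed.

(** Tensoring with S (x) T is tensoring with [T] and then with [S], and each of the two preserves
    and reflects exactness. *)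
Lemma faithfully_flat_tens : faithfully_flat S -> faithfully_flat T ->
  faithfully_flat ST.
Proof.
move=> fS fT U V W u v /=.
apply: (iff_trans (fT _ _ _ u v)); apply: (iff_trans (fS _ _ _ (bmapL T u) (bmapL T v))).
apply: iff_sym; apply: (exact_transfer (@assocF_bij U) (@assocF_bij V) (@assocF_bij W)).
- exact: (addmap0 (@assocF_D W)).
- exact: assocF_nat.
- exact: assocF_nat.
Qed.

End FlatTens.

(** * Finite presentation of a tensor product *)

Section Mpol.
Variables (R : comPzRingType) (n : nat).
Notation expo := {ffun 'I_n -> nat}.
Implicit Types (p q : mpol R n) (e : expo).

Definition expo_add (e e' : expo) : expo := [ffun k => (e k + e' k)%N].
Definition mpol_one : mpol R n := [:: (1, [ffun=> 0%N])].
Definition mpol_scale (r : R) p : mpol R n := [seq (r * t.1, t.2) | t <- p].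

(** A formal sum may repeat an exponent, so the terms are grouped by exponent. It follows that a sum
    over terms, if additive in the coefficients, depends on the polynomial only. *)
Lemma mpol_sum_coef (V : zmodType) (phi : R -> expo -> V) p (L : seq expo) :
  (forall e, addmap (phi^~ e)) -> uniq L -> {subset map snd p <= L} ->
  \sum_(t <- p) phi t.1 t.2 = \sum_(e <- L) phi (mpol_coef p e) e.
Proof.
move=> phiD uL sL.
transitivity (\sum_(e <- L) \sum_(t <- p) if t.2 == e then phi t.1 e else 0); last first.
  apply: eq_bigr => e _; rewrite /mpol_coef (big_morph (phi^~ e) (phiD e) (addmap0 (phiD
      e))).
  by rewrite -big_mkcond.
rewrite exchange_big /= big_seq [RHS]big_seq; apply: eq_bigr => t tp.
have tL : t.2 \in L by apply: sL; apply: map_f.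
rewrite (bigD1_seq t.2) //= eqxx big1 ?addr0 // => e.
by rewrite eq_sym => /negbTE ->.
Qed.

Lemma mpol_sum_ext (V : zmodType) (phi : R -> expo -> V) p q :
  (forall e, addmap (phi^~ e)) -> mpol_coef p =1 mpol_coef q ->
  \sum_(t <- p) phi t.1 t.2 = \sum_(t <- q) phi t.1 t.2.
Proof.
move=> phiD e.
pose L := undup (map snd p ++ map snd q).
rewrite !(mpol_sum_coef (L := L)) ?undup_uniq //.
- by apply: eq_bigr => a _; rewrite e.
- by move=> a aq; rewrite mem_undup mem_cat aq orbT.
- by move=> a ap; rewrite mem_undup mem_cat ap.
Qed.

Lemma mpol_coefE p e : mpol_coef p e = \sum_(t <- p) if t.2 == e then t.1 else 0.
Proof. by rewrite /mpol_coef big_mkcond. Qed.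

Lemma mpol_coef_cat p q e : mpol_coef (p ++ q) e = mpol_coef p e + mpol_coef q e.
Proof. exact: big_cat. Qed.

Lemma mpol_sum_mul (V : zmodType) (phi : R -> expo -> V) p q :
  \sum_(t <- mpol_mul p q) phi t.1 t.2 =
  \sum_(t <- p) \sum_(t' <- q) phi (t.1 * t'.1) (expo_add t.2 t'.2).
Proof. exact: big_allpairs_dep. Qed.

Lemma expo_add0 e : expo_add [ffun=> 0%N] e = e.
Proof. by apply/ffunP => k; rewrite !ffunE add0n. Qed.

Lemma mpol_coef_one_mul q e : mpol_coef (mpol_mul mpol_one q) e = mpol_coef q e.
Proof.
rewrite !mpol_coefE (mpol_sum_mul (fun r a => if a == e then r else 0)).
by rewrite big_seq1; apply: eq_bigr => t _; rewrite /= mul1r expo_add0.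
Qed.

Section Eval.
Variables (S : ralg R) (x : 'I_n -> S).
Notation i := (ralg_str S).

Definition mpol_mon e : S := \prod_(k < n) x k ^+ e k.

Lemma mpol_monD e e' : mpol_mon (expo_add e e') = mpol_mon e * mpol_mon e'.
Proof. by rewrite /mpol_mon -big_split; apply: eq_bigr => k _; rewrite ffunE exprD. Qed.

Lemma mpol_evalE p : mpol_eval x p = \sum_(t <- p) i t.1 * mpol_mon t.2.
Proof. by []. Qed.

Lemma mpol_eval_ext p q : mpol_coef p =1 mpol_coef q -> mpol_eval x p = mpol_eval x q.
Proof.
apply: (mpol_sum_ext (phi := fun r e => i r * mpol_mon e)) => e r r'.
by rewrite rmorphD mulrDl.
Qed.

Lemma mpol_eval_cat p q : mpol_eval x (p ++ q) = mpol_eval x p + mpol_eval x q.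
Proof. exact: big_cat. Qed.

Lemma mpol_eval_scale r p : mpol_eval x (mpol_scale r p) = i r * mpol_eval x p.
Proof.
rewrite /mpol_eval big_map mulr_sumr; apply: eq_bigr => t _.
by rewrite rmorphM mulrA.
Qed.

Lemma mpol_eval_mul p q : mpol_eval x (mpol_mul p q) = mpol_eval x p * mpol_eval x q.
Proof.
rewrite !mpol_evalE (mpol_sum_mul (fun r e => i r * mpol_mon e)) mulr_suml.
apply: eq_bigr => t _; rewrite mulr_sumr; apply: eq_bigr => t' _.
by rewrite rmorphM mpol_monD mulrACA.
Qed.

Lemma mpol_eval_mono r e : mpol_eval x [:: (r, e)] = i r * mpol_mon e.
Proof. exact: big_seq1. Qed.

Lemma mpol_mon0 : mpol_mon [ffun=> 0%N] = 1.
Proof. by apply: big1 => k _; rewrite ffunE. Qed.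

Lemma mpol_eval_one : mpol_eval x mpol_one = 1.
Proof. by rewrite mpol_eval_mono mpol_mon0 rmorph1 mulr1. Qed.

End Eval.

Section Ideal.
Variables (m : nat) (F : 'I_m -> mpol R n).

(** [mpol_in_ideal] for a coefficient function instead of a polynomial, so that sums and differences
    need no list of terms. *)
Definition in_ideal_coef (a : expo -> R) : Prop :=
  exists Q : 'I_m -> mpol R n,
    forall e, a e = \sum_(j < m) mpol_coef (mpol_mul (Q j) (F j)) e.

Lemma in_ideal_coef_ext a b : a =1 b -> in_ideal_coef a -> in_ideal_coef b.
Proof. by move=> ab [Q QP]; exists Q => e; rewrite -ab. Qed.

Lemma in_ideal_coef0 : in_ideal_coef (fun=> 0).
Proof. by exists (fun=> [::]) => e; rewrite big1 // => k _;
    rewrite /mpol_coef big_nil. Qed.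

Lemma in_ideal_coefD a b : in_ideal_coef a -> in_ideal_coef b ->
  in_ideal_coef (fun e => a e + b e).
Proof.
move=> [Q QP] [Q' Q'P]; exists (fun j => Q j ++ Q' j) => e.
rewrite QP Q'P -big_split; apply: eq_bigr => k _ /=.
by rewrite !mpol_coefE !(mpol_sum_mul (fun r a => if a == e then r else 0)) big_cat.
Qed.

Lemma in_ideal_coefN a : in_ideal_coef a -> in_ideal_coef (fun e => - a e).
Proof.
move=> [Q QP]; exists (fun j => mpol_scale (-1) (Q j)) => e.
rewrite QP -sumrN; apply: eq_bigr => k _.
rewrite !mpol_coefE !(mpol_sum_mul (fun r a => if a == e then r else 0)) big_map.
rewrite -sumrN; apply: eq_bigr => t _; rewrite -sumrN; apply: eq_bigr => t' _ /=.
by case: ifP; rewrite ?oppr0 // mulN1r mulNr.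
Qed.

Lemma in_ideal_gen k : mpol_in_ideal F (F k).
Proof.
exists (fun j => if j == k then mpol_one else [::]) => e.
rewrite (bigD1 k) //= eqxx mpol_coef_one_mul big1 ?addr0 // => j /negbTE ->.
by rewrite /mpol_coef big_nil.
Qed.

End Ideal.
End Mpol.

Section Join.
Variables (R : comPzRingType) (n n' : nat).
Notation N := (n + n')%N.

Definition expo_join (e : {ffun 'I_n -> nat}) (e' : {ffun 'I_n' -> nat}) :
    {ffun 'I_N -> nat} :=
  [ffun k => match split k with inl a => e a | inr b => e' b end].

Lemma expo_joinD a b a' b' :
  expo_join (expo_add a b) (expo_add a' b') = expo_add (expo_join a a') (expo_join b b').
Proof. by apply/ffunP => k; rewrite !ffunE; case: split => ?; rewrite !ffunE. Qed.

(** The product p(X) q(Y) in disjoint sets of variables. *)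
Definition mpol_join (p : mpol R n) (q : mpol R n') : mpol R N :=
  [seq (t.1 * t'.1, expo_join t.2 t'.2)
  | t : R * {ffun 'I_n -> nat} <- p, t' : R * {ffun 'I_n' -> nat} <- q].

Lemma mpol_sum_join (V : zmodType) (phi : R -> {ffun 'I_N -> nat} -> V) p q :
  \sum_(t <- mpol_join p q) phi t.1 t.2 =
  \sum_(t <- p) \sum_(t' <- q) phi (t.1 * t'.1) (expo_join t.2 t'.2).
Proof. exact: big_allpairs_dep. Qed.

Lemma mpol_coef_join p q e : mpol_coef (mpol_join p q) e =
  \sum_(t <- p) \sum_(t' <- q) if expo_join t.2 t'.2 == e then t.1 * t'.1 else 0.
Proof.
by rewrite mpol_coefE (mpol_sum_join (fun r a => if a == e then r else 0)).
Qed.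

Lemma if0D (b : bool) (x y : R) :
  (if b then x + y else 0) = (if b then x else 0) + (if b then y else 0).
Proof. by case: b; rewrite ?addr0. Qed.

Lemma mpol_join_extl p p' q : mpol_coef p =1 mpol_coef p' ->
  mpol_coef (mpol_join p q) =1 mpol_coef (mpol_join p' q).
Proof.
move=> pp' e; rewrite !mpol_coef_join.
apply: (mpol_sum_ext (phi := fun r a => \sum_(t' <- q)
  if expo_join a t'.2 == e then r * t'.1 else 0)) => // a x y.
by rewrite -big_split; apply: eq_bigr => t _ /=; rewrite mulrDl if0D.
Qed.

Lemma mpol_join_extr p q q' : mpol_coef q =1 mpol_coef q' ->
  mpol_coef (mpol_join p q) =1 mpol_coef (mpol_join p q').
Proof.
move=> qq' e; rewrite !mpol_coef_join; apply: eq_bigr => t _.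
apply: (mpol_sum_ext (phi := fun r a =>
  if expo_join t.2 a == e then t.1 * r else 0)) => // a x y.
by rewrite mulrDr if0D.
Qed.

Lemma mpol_coef_flatten k (I : Type) (s : seq I) (P : I -> mpol R k) e :
  mpol_coef (flatten [seq P i | i <- s]) e = \sum_(i <- s) mpol_coef (P i) e.
Proof.
elim: s => [|i s IHs] /=; first by rewrite big_nil /mpol_coef big_nil.
by rewrite mpol_coef_cat IHs big_cons.
Qed.

Variables (m m' : nat) (F : 'I_m -> mpol R n) (F' : 'I_m' -> mpol R n').

Definition gens_join (k : 'I_(m + m')) : mpol R N :=
  match split k with
  | inl a => mpol_join (F a) (mpol_one R n')
  | inr b => mpol_join (mpol_one R n) (F' b)
  end.

Lemma gens_joinl a : gens_join (lshift m' a) = mpol_join (F a) (mpol_one R n').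
Proof. by rewrite /gens_join (unsplitK (inl a)). Qed.

Lemma gens_joinr b : gens_join (rshift m b) = mpol_join (mpol_one R n) (F' b).
Proof. by rewrite /gens_join (unsplitK (inr b)). Qed.

Lemma expo_addC k (e e' : {ffun 'I_k -> nat}) : expo_add e e' = expo_add e' e.
Proof. by apply/ffunP => j; rewrite !ffunE addnC. Qed.

Lemma expo_addr0 k (e : {ffun 'I_k -> nat}) : expo_add e [ffun=> 0%N] = e.
Proof. by rewrite expo_addC expo_add0. Qed.

Lemma mpol_coef_joinMl p f q e :
  mpol_coef (mpol_join (mpol_mul p f) q) e =
  mpol_coef (mpol_mul (mpol_join p q) (mpol_join f (mpol_one R n'))) e.
Proof.
rewrite mpol_coef_join (mpol_sum_mul (fun r a => \sum_(t' <- q)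
   if expo_join a t'.2 == e then r * t'.1 else 0)).
rewrite mpol_coefE (mpol_sum_mul (fun r a => if a == e then r else 0)).
rewrite (mpol_sum_join (fun r a => \sum_(t <- mpol_join f (mpol_one R n'))
   if expo_add a t.2 == e then r * t.1 else 0)).
apply: eq_bigr => t _; rewrite exchange_big; apply: eq_bigr => u _.
rewrite (mpol_sum_join (fun r a => if expo_add (expo_join t.2 u.2) a == e then t.1 * u.1
    * r else 0)).
apply: eq_bigr => v _; rewrite big_seq1 /= mulr1 mulrAC.
by rewrite -expo_joinD expo_addr0.
Qed.

Lemma mpol_coef_joinMr p f q e :
  mpol_coef (mpol_join p (mpol_mul q f)) e =
  mpol_coef (mpol_mul (mpol_join p q) (mpol_join (mpol_one R n) f)) e.
Proof.
rewrite mpol_coef_join mpol_coefE (mpol_sum_mul (fun r a => if a == e then r else 0)).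
rewrite (mpol_sum_join (fun r a => \sum_(t <- mpol_join (mpol_one R n) f)
   if expo_add a t.2 == e then r * t.1 else 0)).
apply: eq_bigr => t _.
rewrite (mpol_sum_mul (fun r a => if expo_join t.2 a == e then t.1 * r else 0)).
apply: eq_bigr => u _.
rewrite (mpol_sum_join (fun r a => if expo_add (expo_join t.2 u.2) a == e then t.1 * u.1
    * r else 0)).
rewrite big_seq1; apply: eq_bigr => v _ /=; rewrite mul1r mulrA.
by rewrite -expo_joinD expo_addr0.
Qed.

(** Multiply an expression of [p] by the relations with q(Y): the cofactor of each F_a becomes
    Q_a(X) q(Y), and the relations in Y get the cofactor 0. *)
Lemma join_ideall p q : mpol_in_ideal F p ->
  in_ideal_coef gens_join (mpol_coef (mpol_join p q)).
Proof.
move=> [Q QP].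
exists (fun k => match split k with inl a => mpol_join (Q a) q | inr _ => [::] end) => e.
rewrite big_split_ord /= [X in _ + X]big1 ?addr0; last first.
  by move=> b _; rewrite (unsplitK (inr b)) /mpol_coef big_nil.
rewrite (@mpol_join_extl _ (flatten [seq mpol_mul (Q a) (F a) | a <- enum 'I_m]));
    last first.
  by move=> a; rewrite QP mpol_coef_flatten big_enum.
transitivity (mpol_coef (flatten [seq mpol_join (mpol_mul (Q a) (F a)) q | a <- enum
    'I_m]) e).
  rewrite mpol_coef_flatten mpol_coef_join big_flatten big_map; apply: eq_bigr => a _.
  by rewrite mpol_coef_join.
rewrite mpol_coef_flatten big_enum; apply: eq_bigr => a _.
by rewrite (unsplitK (inl a)) gens_joinl mpol_coef_joinMl.
Qed.

Lemma join_idealr p q : mpol_in_ideal F' q ->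
  in_ideal_coef gens_join (mpol_coef (mpol_join p q)).
Proof.
move=> [Q QP].
exists (fun k => match split k with inr b => mpol_join p (Q b) | inl _ => [::] end) => e.
rewrite big_split_ord /= big1 ?add0r; last first.
  by move=> b _; rewrite (unsplitK (inl b)) /mpol_coef big_nil.
rewrite (@mpol_join_extr _ _ (flatten [seq mpol_mul (Q a) (F' a) | a <- enum 'I_m']));
    last first.
  by move=> a; rewrite QP mpol_coef_flatten big_enum.
transitivity (\sum_(t <- p) \sum_(a <- enum 'I_m') \sum_(t' <- mpol_mul (Q a) (F' a))
    if expo_join t.2 t'.2 == e then t.1 * t'.1 else 0).
  by rewrite mpol_coef_join; apply: eq_bigr => t _; rewrite big_flatten big_map.
rewrite exchange_big big_enum; apply: eq_bigr => a _.
by rewrite (unsplitK (inr a)) gens_joinr -mpol_coef_joinMr mpol_coef_join.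
Qed.

End Join.

Section FinPres.
Variables (R : comPzRingType) (S T : ralg R).
Notation i := (ralg_str S).
Notation j := (ralg_str T).
Notation ST := (ralg_tens S T).
Variables (n : nat) (x : 'I_n -> S) (m : nat) (F : 'I_m -> mpol R n).
Variables (n' : nat) (y : 'I_n' -> T) (m' : nat) (F' : 'I_m' -> mpol R n').
Hypotheses (xsurj : forall s, exists p, mpol_eval x p = s)
  (xker : forall p, mpol_eval x p = 0 <-> mpol_in_ideal F p)
  (ysurj : forall s, exists p, mpol_eval y p = s)
  (yker : forall p, mpol_eval y p = 0 <-> mpol_in_ideal F' p).

Notation N := (n + n')%N.
Notation FF := (gens_join F F').

Definition gen_join (k : 'I_N) : ST :=
  match split k with inl a => rpure i j (x a) 1 | inr b => rpure i j 1 (y b) end.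

Lemma rpure_prod (I : Type) (s : seq I) (a : I -> S) :
  \prod_(k <- s) rpure i j (a k) 1 = rpure i j (\prod_(k <- s) a k) 1.
Proof. exact: (esym (rmorph_prod (tinl i j) _ _ _)). Qed.

Lemma rpure_prodr (I : Type) (s : seq I) (b : I -> T) :
  \prod_(k <- s) rpure i j 1 (b k) = rpure i j 1 (\prod_(k <- s) b k).
Proof. exact: (esym (rmorph_prod (tinr i j) _ _ _)). Qed.

Lemma mpol_mon_join e e' :
  mpol_mon (S := ST) gen_join (expo_join e e') = rpure i j (mpol_mon x e) (mpol_mon y e').
Proof.
rewrite /mpol_mon big_split_ord /=.
transitivity (rpure i j (mpol_mon x e) 1 * rpure i j 1 (mpol_mon y e')); last first.
  by rewrite rpureM mulr1 mul1r.
congr (_ * _); rewrite -?rpure_prod -?rpure_prodr; apply: eq_bigr => a _; rewrite ffunE.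
- by rewrite /gen_join (unsplitK (inl a)); apply: (esym (rmorphXn (tinl i j) _ _)).
- by rewrite /gen_join (unsplitK (inr a)); apply: (esym (rmorphXn (tinr i j) _ _)).
Qed.

Lemma mpol_eval_join p q :
  mpol_eval (S := ST) gen_join (mpol_join p q) =
      rpure i j (mpol_eval x p) (mpol_eval y q).
Proof.
rewrite mpol_evalE (mpol_sum_join (fun r e => ralg_str ST r * mpol_mon (S :=
    ST) gen_join e)).
rewrite /rpure !mpol_evalE tpure_suml; apply: eq_bigr => t _.
rewrite tpure_sumr; apply: eq_bigr => u _.
rewrite mpol_mon_join rmorphM -[tpure _ _ _ _]/(rpure i j (i t.1 * mpol_mon x t.2) (j u.1
    * mpol_mon y u.2)).
have -> : ralg_str ST u.1 = rpure i j 1 (j u.1) by apply: tinlr.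
by rewrite !rpureM mulr1 mul1r.
Qed.

Let ps (s : S) : mpol R n := projT1 (cid (xsurj s)).
Let qt (t : T) : mpol R n' := projT1 (cid (ysurj t)).

Let psE s : mpol_eval x (ps s) = s. Proof. by rewrite /ps; case: cid. Qed.
Let qtE s : mpol_eval y (qt s) = s. Proof. by rewrite /qt; case: cid. Qed.

(** The inverse of evaluation, on formal sums of pure tensors; only its class modulo the ideal is
    meaningful. *)
Let Phi (l : seq (S^o * T^o)) e := \sum_(p <- l) mpol_coef (mpol_join (ps p.1) (qt p.2))
    e.

Let cg (a b : {ffun 'I_N -> nat} -> R) := in_ideal_coef FF (fun e => a e - b e).

Let cg_refl a : cg a a.
Proof.
by apply: in_ideal_coef_ext (in_ideal_coef0 _) => e; rewrite subrr.
Qed.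

Let cg_sym a b : cg a b -> cg b a.
Proof.
move=> /in_ideal_coefN; apply: in_ideal_coef_ext => e; by rewrite opprB.
Qed.

Let cg_trans b a c : cg a b -> cg b c -> cg a c.
Proof.
move=> /in_ideal_coefD H /H; apply: in_ideal_coef_ext => e; by rewrite addrA subrK.
Qed.

Let cg_add a b a' b' : cg a b -> cg a' b' -> cg (fun e => a e + a' e) (fun e =>
    b e + b' e).
Proof.
move=> /in_ideal_coefD H /H; apply: in_ideal_coef_ext => e.
by rewrite opprD addrACA.
Qed.

Let cg_ext a b : a =1 b -> cg a b.
Proof. by move=> ab; apply: in_ideal_coef_ext (in_ideal_coef0 _) => e;
    rewrite ab subrr. Qed.

(** p - p' evaluates to 0, hence lies in the ideal of [F], and this survives multiplication by
    q(Y). *)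
Let joinl p p' q : mpol_eval x p = mpol_eval x p' ->
  cg (mpol_coef (mpol_join p q)) (mpol_coef (mpol_join p' q)).
Proof.
move=> pp'; have /xker pI : mpol_eval x (p ++ mpol_scale (-1) p') = 0.
  by rewrite mpol_eval_cat mpol_eval_scale pp' rmorphN1 mulN1r subrr.
apply: in_ideal_coef_ext (join_ideall F' q pI) => e.
rewrite !mpol_coef_join big_cat; congr (_ + _).
rewrite big_map -sumrN; apply: eq_bigr => t _; rewrite -sumrN; apply: eq_bigr => u _ /=.
by case: ifP; rewrite ?oppr0 // mulN1r mulNr.
Qed.

Let joinr p q q' : mpol_eval y q = mpol_eval y q' ->
  cg (mpol_coef (mpol_join p q)) (mpol_coef (mpol_join p q')).
Proof.
move=> qq'; have /yker qI : mpol_eval y (q ++ mpol_scale (-1) q') = 0.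
  by rewrite mpol_eval_cat mpol_eval_scale qq' rmorphN1 mulN1r subrr.
apply: in_ideal_coef_ext (join_idealr F p qI) => e.
rewrite !mpol_coef_join -sumrB; apply: eq_bigr => t _.
rewrite big_cat; congr (_ + _); rewrite big_map -sumrN; apply: eq_bigr => u _ /=.
by case: ifP; rewrite ?oppr0 // mulN1r mulrN.
Qed.

Let mpol_coef_join_catl (p p' : mpol R n) (q : mpol R n') e :
    mpol_coef (mpol_join (p ++ p') q) e =
  mpol_coef (mpol_join p q) e + mpol_coef (mpol_join p' q) e.
Proof. by rewrite !mpol_coef_join big_cat. Qed.

Let mpol_coef_join_catr (p : mpol R n) (q q' : mpol R n') e :
    mpol_coef (mpol_join p (q ++ q')) e =
  mpol_coef (mpol_join p q) e + mpol_coef (mpol_join p q') e.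
Proof.
by rewrite !mpol_coef_join -big_split; apply: eq_bigr => t _; rewrite big_cat.
Qed.

(* Sending s (x) t to P_s(X) Q_t(Y), for arbitrary polynomials P_s and Q_t that
   evaluate to s and t, is well defined modulo the ideal; this inverts the
   evaluation map. *)
Lemma tens_rel_ideal l l' : tens_rel i j l l' -> cg (Phi l) (Phi l').
Proof.
elim=> {l l'} [s|s t _|s t u _ + _|s s' t t' _ H _ K|s t|b|a a' b|a b b'|r a b].
- exact: cg_refl.
- exact: cg_sym.
- exact: cg_trans.
- apply: (cg_trans (cg_ext _)) (cg_trans (cg_add H K) (cg_ext _)) => e.
    by rewrite /Phi big_cat.
  by rewrite /Phi big_cat.
- by apply: cg_ext => e; rewrite /Phi !big_cat /= addrC.
(* The polynomial chosen for 0 need not be the empty sum; the two are only congruent. *)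
- apply: (cg_trans (b := mpol_coef (mpol_join [::] (qt b)))); last first.
    by apply: cg_ext => e; rewrite /Phi big_nil mpol_coef_join big_nil.
  apply: (cg_trans (cg_ext _)) (joinl (p := ps 0) _ _) => [e|].
    by rewrite /Phi big_seq1.
  by rewrite psE /mpol_eval big_nil.
- apply: (cg_trans (b := mpol_coef (mpol_join (ps a ++ ps a') (qt b)))); last first.
    apply: cg_ext => e; rewrite mpol_coef_join_catl /Phi big_cons big_seq1 //.
  apply: (cg_trans (cg_ext _)) (joinl (p := ps (a + a')) _ _) => [e|].
    by rewrite /Phi big_seq1.
  by rewrite mpol_eval_cat !psE.
- apply: (cg_trans (b := mpol_coef (mpol_join (ps a) (qt b ++ qt b')))); last first.
    apply: cg_ext => e; rewrite mpol_coef_join_catr /Phi big_cons big_seq1 //.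
  apply: (cg_trans (cg_ext _)) (joinr (q := qt (b + b')) _ _) => [e|].
    by rewrite /Phi big_seq1.
  by rewrite mpol_eval_cat !qtE.
- apply: (cg_trans (b := mpol_coef (mpol_join (mpol_scale r (ps a)) (qt b)))).
    apply: (cg_trans (cg_ext _)) (joinl (p := ps (i r * a)) _ _) => [e|].
      by rewrite /Phi big_seq1.
    by rewrite mpol_eval_scale !psE.
  apply: (cg_trans (b := mpol_coef (mpol_join (ps a) (mpol_scale r (qt b))))).
    apply: cg_ext => e; rewrite !mpol_coef_join big_map; apply: eq_bigr => t _.
    by rewrite big_map; apply: eq_bigr => u _ /=; rewrite mulrCA mulrA.
  apply: cg_trans (joinr (q' := qt (j r * b)) _ _) (cg_ext _) => [|e].
    by rewrite mpol_eval_scale !qtE.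
  by rewrite /Phi big_seq1.
Qed.

Let eL (e : {ffun 'I_N -> nat}) : {ffun 'I_n -> nat} := [ffun k => e (lshift n' k)].
Let eR (e : {ffun 'I_N -> nat}) : {ffun 'I_n' -> nat} := [ffun k => e (rshift n k)].

Let eLR e : expo_join (eL e) (eR e) = e.
Proof.
apply/ffunP => k; rewrite !ffunE -[k in RHS]splitK.
by case: split => a; rewrite ffunE.
Qed.

(** Writes the value of a polynomial as a formal sum of pure tensors, one for each term, so that its
    vanishing becomes a statement about [tens_rel]. *)
Let lP (P : mpol R N) : seq (S^o * T^o) :=
  [seq ((i t.1 * mpol_mon x (eL t.2) : S^o), (mpol_mon y (eR t.2) : T^o)) | t <- P].

Lemma tens_cls_lP P : mpol_eval (S := ST) gen_join P = tens_cls i j (lP P).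
Proof.
rewrite tens_clsE big_map; apply: eq_bigr => t _.
rewrite -/(mpol_mon (S := ST) gen_join t.2) -{1}(eLR t.2) mpol_mon_join.
by rewrite rpureM mul1r.
Qed.

(** Modulo the ideal, a polynomial is recovered from the formal sum that represents its value; this
    is what bounds the kernel of evaluation. *)
Lemma Phi_lP P : cg (Phi (lP P)) (mpol_coef P).
Proof.
elim: P => [|[r e] P IHP]; first by apply: cg_ext => e; rewrite /Phi /mpol_coef !big_nil.
apply: (cg_trans (b := fun e' => mpol_coef (mpol_join (ps (i r * mpol_mon x (eL e))) (qt
    (mpol_mon y (eR e)))) e'
   + Phi (lP P) e')).
  by apply: cg_ext => e'; rewrite /Phi big_cons.
apply: (cg_trans (b := fun e' => mpol_coef [:: (r, e)] e' + mpol_coef P e')); last first.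
  by apply: cg_ext => e'; rewrite -mpol_coef_cat.
apply: cg_add => //.
apply: cg_trans (joinl (p' := [:: (r, eL e)]) _ _) _.
  by rewrite psE mpol_eval_mono.
apply: cg_trans (joinr (q' := [:: (1, eR e)]) _ _) (cg_ext _).
  by rewrite qtE mpol_eval_mono rmorph1 mul1r.
by move=> e'; rewrite mpol_coef_join !big_seq1 /= mulr1 eLR mpol_coefE big_seq1.
Qed.

Lemma mpol_ker_join P : mpol_eval (S := ST) gen_join P = 0 <-> mpol_in_ideal FF P.
Proof.
split=> [|[Q QP]].
  (* If [P] evaluates to 0, its formal sum is related to the empty one, so [P] is congruent to [Phi
     [::]], which is 0. *)
  rewrite tens_cls_lP -[0]/(tens_cls i j [::]) => /tens_clsP /tens_rel_ideal H.
  apply: in_ideal_coef_ext (cg_trans (cg_sym (Phi_lP P)) H) => e.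
  by rewrite /Phi big_nil subr0.
rewrite (@mpol_eval_ext _ _ _ _ _ (flatten [seq mpol_mul (Q a) (FF a) | a <- enum 'I_(m +
    m')])); last first.
  by move=> e; rewrite QP mpol_coef_flatten big_enum.
rewrite /mpol_eval big_flatten big_map big1 // => k _.
rewrite -/(mpol_eval (S := ST) gen_join _) mpol_eval_mul /gens_join.
case: split => a; rewrite mpol_eval_join mpol_eval_one.
- have /xker -> := in_ideal_gen F a.
  by rewrite -[rpure i j 0 1]/(tinl i j 0) rmorph0 mulr0.
- have /yker -> := in_ideal_gen F' a.
  by rewrite -[rpure i j 1 0]/(tinr i j 0) rmorph0 mulr0.
Qed.

Lemma mpol_surj_join z : exists P, mpol_eval (S := ST) gen_join P = z.
Proof.
elim/tens_ind: z => [|z z' [P <-] [P' <-]|s t].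
- by exists [::]; rewrite /mpol_eval big_nil.
- by exists (P ++ P'); rewrite mpol_eval_cat.
- have [[p <-] [q <-]] := (xsurj s, ysurj t).
  by exists (mpol_join p q); rewrite mpol_eval_join.
Qed.

End FinPres.

Lemma finitely_presented_tens (R : comPzRingType) (S T : ralg R) :
  finitely_presented S -> finitely_presented T ->
  finitely_presented (ralg_tens S T).
Proof.
move=> [n [x [m [F [xs xk]]]]] [n' [y [m' [F' [ys yk]]]]].
exists (n + n')%N, (gen_join x y), (m + m')%N, (gens_join F F'); split.
- exact: mpol_surj_join.
- exact: mpol_ker_join.
Qed.

(** * The Azumaya property of a tensor product *)

Lemma azumaya_overP (R : comPzRingType) (S : ralg R) (C : coring_data S) :
  azumaya_over C <->
  [/\ is_coring C, faithfully_projective C & bijective (coF (C := C))].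
Proof. by split=> -[hC pC bC]; split=> //; apply/(tilde_coF hC). Qed.

Section SwapBij.
Variables (R : comPzRingType) (S T : ralg R).
Notation i := (ralg_str S).
Notation j := (ralg_str T).
Notation ST := (ralg_tens S T).
Notation st := (rpure i j).

Lemma unswapS_agree r : (left2 ST \o tinl i j) (i r) = (right2 ST \o tinl i j) (i r).
Proof. exact: (lr_str ST r). Qed.
Lemma unswapT_agree r : (left2 ST \o tinr i j) (j r) = (right2 ST \o tinr i j) (j r).
Proof. by rewrite /= -tinlr; exact: (lr_str ST r). Qed.

Definition unswapS : {rmorphism tens2 S -> tens2 ST} := rlift unswapS_agree.
Definition unswapT : {rmorphism tens2 T -> tens2 ST} := rlift unswapT_agree.

Lemma unswap_agree r : unswapS (str2 S r) = unswapT (str2 T r).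
Proof.
by rewrite [LHS]rlift_inl [RHS]rlift_inl /= tinlr.
Qed.

Definition unswap : {rmorphism tensR (str2 S) (str2 T) -> tens2 ST} := rlift unswap_agree.

Lemma unswapE s s' t t' : unswap (rpure (str2 S) (str2 T)
  (left2 S s * right2 S s') (left2 T t * right2 T t')) =
  left2 ST (st s t) * right2 ST (st s' t').
Proof.
rewrite [LHS]rlift_pure !rmorphM [unswapS (left2 S s)]rlift_inl [unswapS (right2 S
    s')]rlift_inr.
rewrite [unswapT (left2 T t)]rlift_inl [unswapT (right2 T t')]rlift_inr mulrACA.
have e a b : st a b = tinl i j a * tinr i j b by rewrite rpureM mulr1 mul1r.
by rewrite !e !rmorphM.
Qed.

Lemma swap_midE s s' t t' : swap_mid S T (left2 ST (st s t) * right2 ST (st s' t')) =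
  rpure (str2 S) (str2 T) (left2 S s * right2 S s') (left2 T t * right2 T t').
Proof. by rewrite rmorphM swap_mid_l swap_mid_r rpureM. Qed.

Lemma swap_midK : cancel (swap_mid S T) unswap.
Proof.
elim/tens2_ind=> [|x y IHx IHy|x y]; first by rewrite !rmorph0.
  by rewrite !rmorphD IHx IHy.
elim/tens_ind: x => [|x x' IHx IHx'|s t].
- by rewrite [left2 ST 0]rmorph0 mul0r !rmorph0.
- by rewrite [left2 ST _]rmorphD mulrDl !rmorphD IHx IHx'.
elim/tens_ind: y => [|y y' IHy IHy'|s' t'].
- by rewrite [right2 ST 0]rmorph0 mulr0 !rmorph0.
- by rewrite [right2 ST _]rmorphD mulrDr !rmorphD IHy IHy'.
by rewrite swap_midE unswapE.
Qed.

Lemma unswapK : cancel unswap (swap_mid S T).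
Proof.
elim/tens_ind=> [|x y IHx IHy|x y]; first by rewrite !rmorph0.
  by rewrite !rmorphD IHx IHy.
elim/tens2_ind: x => [|x x' IHx IHx'|s s'].
- by rewrite tpure0l !rmorph0.
- by rewrite tpureDl !rmorphD IHx IHx'.
elim/tens2_ind: y => [|y y' IHy IHy'|t t'].
- by rewrite tpure0r !rmorph0.
- by rewrite tpureDr !rmorphD IHy IHy'.
by rewrite -[tpure _ _ _ _]/(rpure (str2 S) (str2 T) _ _) unswapE swap_midE.
Qed.

Lemma azumaya_over_tens (C : coring_data S) (D : coring_data T) :
  azumaya_over C -> azumaya_over D -> azumaya_over (coring_tens C D).
Proof.
move=> /azumaya_overP [hC pC [G FK GK]] /azumaya_overP [hD pD [H FK' HK]].
apply/azumaya_overP; split.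
- exact: coring_tens_is_coring.
- have := faithfully_projective_tens (str2 S) (str2 T) pC pD.
  exact: (@faithfully_projective_transfer _ _ (swap_mid S T) unswap _
    (coring_tens_mod C D) id id swap_midK unswapK).
- exact: (coring_tens_coF_bij hC hD FK GK FK' HK).
Qed.

End SwapBij.

Lemma is_azumaya_tens (R : comPzRingType) (X Y : cpair R) :
  is_azumaya X -> is_azumaya Y -> is_azumaya (cpair_tens X Y).
Proof.
move=> [fX pX aX] [fY pY aY]; split.
- exact: faithfully_flat_tens.
- exact: finitely_presented_tens.
- exact: azumaya_over_tens.
Qed.

(** * Isomorphisms of corings *)

Section CoringIso.
Variables (R : comPzRingType).

(** [cpair_iso] with bare maps and the two actions separated. Additivity is enough, since
    R-linearity follows from [ci_l] and [ci_str]. *)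
Record coring_iso (S T : ralg R) (C : coring_data S) (D : coring_data T)
    (f : {rmorphism S -> T}) (phi : C -> D) : Prop := CoringIso {
  ci_bij : bijective f;
  ci_str : forall r, f (ralg_str S r) = ralg_str T r;
  ci_D : addmap phi;
  ci_pbij : bijective phi;
  ci_l : forall s c, phi (left2 S s *: c) = left2 T (f s) *: phi c;
  ci_r : forall s c, phi (right2 S s *: c) = right2 T (f s) *: phi c;
  ci_comul : forall c, comul (phi c) =
    sw (fun a b => tpure (right2 T) (left2 T) (phi a) (phi b)) c }.

Lemma cpair_isoP (S T : ralg R) (C : coring_data S) (D : coring_data T) :
  cpair_iso (Cpair C) (Cpair D) <-> exists f phi, @coring_iso S T C D f phi.
Proof.
split=> [[f [phi [fb fs pb pl pc]]]|[f [phi [fb fs pD pb pl pr pc]]]].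
  exists f, phi; split=> //.
  - exact: (linearD phi).
  - by move=> s c; have := pl s 1 c; rewrite rmorph1.
  - by move=> s c; have := pl 1 s c; rewrite rmorph1.
have pL : linear (phi : restr (str2 S) C -> restr (str2 T) D).
  move=> r x y; rewrite pD; congr (_ + _).
  rewrite -[LHS]/(phi (left2 S (ralg_str S r) *: (x : C))) pl fs.
  by [].
exists f, (HB.pack_for {linear restr (str2 S) C -> restr (str2 T) D}
   (phi : restr (str2 S) C -> restr (str2 T) D)
   (GRing.isLinear.Build R (restr (str2 S) C) (restr (str2 T) D) *:%R _ pL)).
split=> // s s' c; rewrite rpure_lr -scalerA /=.
by rewrite rpure_lr -scalerA pl pr.
Qed.

Lemma iso_bal (S T : ralg R) (C : coring_data S) (D : coring_data T)
    (f : {rmorphism S -> T}) (phi : C -> D) (P : zmodType) (b : D -> D -> P) :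
  addmap phi ->
  (forall s c, phi (left2 S s *: c) = left2 T (f s) *: phi c) ->
  (forall s c, phi (right2 S s *: c) = right2 T (f s) *: phi c) ->
  bal2 T b -> bal2 S (fun x y => b (phi x) (phi y)).
Proof.
move=> pD pl pr bb; split=> [m m' n|m n n'|a m n].
- by rewrite pD (balDl bb).
- by rewrite pD (balDr bb).
- by rewrite pr pl (balZ bb).
Qed.

Lemma iso_sw (S T : ralg R) (C : coring_data S) (D : coring_data T)
    (f : {rmorphism S -> T}) (phi : C -> D) (P : zmodType) (b : D -> D -> P) c :
  coring_iso f phi -> bal2 T b -> sw b (phi c) = sw (fun x y => b (phi x) (phi y)) c.
Proof.
move=> iso bb; rewrite {1}/sw (ci_comul iso) (addmap_sw _ _ (tliftD bb)).
by apply: sw_ext => x y; rewrite (tlift_pure bb).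
Qed.

Lemma coring_iso_refl (S : ralg R) (C : coring_data S) :
  coring_iso (C := C) (D := C) idfun id.
Proof. by split=> //; [exists id | exists id | move=> c; rewrite comulE]. Qed.

Lemma coring_iso_trans (S T U : ralg R) (C : coring_data S) (D : coring_data T)
    (E : coring_data U) (f : {rmorphism S -> T}) (phi : C -> D)
    (g : {rmorphism T -> U}) (psi : D -> E) :
  coring_iso f phi -> coring_iso g psi ->
  coring_iso (C := C) (D := E) (g \o f) (psi \o phi).
Proof.
move=> i1 i2; split=> /=.
- exact: bij_comp (ci_bij i2) (ci_bij i1).
- by move=> r; rewrite (ci_str i1) (ci_str i2).
- by move=> x y /=; rewrite (ci_D i1) (ci_D i2).
- exact: bij_comp (ci_pbij i2) (ci_pbij i1).
- by move=> s c /=; rewrite (ci_l i1) (ci_l i2).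
- by move=> s c /=; rewrite (ci_r i1) (ci_r i2).
- move=> c; rewrite (ci_comul i2) (iso_sw c i1) //.
  apply: (iso_bal (ci_D i2) (ci_l i2) (ci_r i2)); exact: tpure_balanced.
Qed.

Lemma rmorph_inverse (A B : comPzRingType) (f : {rmorphism A -> B}) :
  bijective f -> exists g : {rmorphism B -> A}, cancel f g /\ cancel g f.
Proof.
move=> [g fK gK].
have gB : zmod_morphism g by move=> x y; rewrite -[x in LHS]gK -[y in LHS]gK -rmorphB fK.
have gM : monoid_morphism g.
  by split=> [|x y]; [rewrite -[1 in LHS](rmorph1 f) fK|rewrite -[x in LHS]gK -[y in
      LHS]gK -rmorphM fK].
by exists (HB.pack_for {rmorphism B -> A} g (GRing.isZmodMorphism.Build B A g gB)
  (GRing.isMonoidMorphism.Build B A g gM)).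
Qed.

Lemma coring_iso_inv (S T : ralg R) (C : coring_data S) (D : coring_data T)
    (f : {rmorphism S -> T}) (g : {rmorphism T -> S}) (phi : C -> D) (psi : D -> C) :
  cancel f g -> cancel g f -> cancel phi psi -> cancel psi phi ->
  coring_iso f phi -> coring_iso g psi.
Proof.
move=> fK gK pK psK iso.
have psD : addmap psi by move=> x y; rewrite -[x in LHS]psK -[y in LHS]psK -(ci_D iso) pK.
have psl s c : psi (left2 T s *: c) = left2 S (g s) *: psi c.
  by apply: (can_inj pK); rewrite (ci_l iso) !psK gK.
have psr s c : psi (right2 T s *: c) = right2 S (g s) *: psi c.
  by apply: (can_inj pK); rewrite (ci_r iso) !psK gK.
split=> //; [by exists f| |by exists phi|].
- by move=> r; rewrite -(ci_str iso) fK.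
- move=> d; rewrite -[d in RHS]psK (iso_sw _ iso); last first.
    exact: (iso_bal psD psl psr (tpure_balanced _ _ _ _)).
  by rewrite comulE; apply: sw_ext => x y; rewrite !pK.
Qed.

Lemma coring_iso_sym (S T : ralg R) (C : coring_data S) (D : coring_data T)
    (f : {rmorphism S -> T}) (phi : C -> D) :
  coring_iso f phi -> exists g psi, coring_iso (C := D) (D := C) g psi /\
    [/\ cancel f g, cancel g f, cancel phi psi & cancel psi phi].
Proof.
move=> iso; have [g [fK gK]] := rmorph_inverse (ci_bij iso).
have [psi pK psK] := ci_pbij iso.
by exists g, psi; split=> //; apply: coring_iso_inv iso.
Qed.

Lemma cp_isoI (S T U : ralg R) (C : coring_data S) (D : coring_data T)
    (E : coring_data U) (f : {rmorphism ralg_tens S T -> U})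
    (phi : coring_tens C D -> E) :
  is_coring C -> is_coring D -> is_coring E ->
  bijective f -> (forall r, f (ralg_str (ralg_tens S T) r) = ralg_str U r) ->
  addmap phi -> bijective phi ->
  (forall s t c d, phi (coring_tens_pure (left2 S s *: c) (left2 T t *: d)) =
     left2 U (f (rpure _ _ s t)) *: phi (coring_tens_pure c d)) ->
  (forall s t c d, phi (coring_tens_pure (right2 S s *: c) (right2 T t *: d)) =
     right2 U (f (rpure _ _ s t)) *: phi (coring_tens_pure c d)) ->
  (forall c d, comul (phi (coring_tens_pure c d)) =
    sw (fun c1 c2 => sw (fun d1 d2 => tpure (right2 U) (left2 U)
      (phi (coring_tens_pure c1 d1)) (phi (coring_tens_pure c2 d2))) d) c) ->
  coring_iso (C := coring_tens C D) f phi.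
Proof.
move=> hC hD hE fb fs pD pb pl pr pc.
have pl' s c : phi (left2 (ralg_tens S T) s *: c) = left2 U (f s) *: phi c.
  by apply: (cp_semilinear (m' := left2 U \o f) pD) => {s c} s t c d; rewrite cp_l pl.
have pr' s c : phi (right2 (ralg_tens S T) s *: c) = right2 U (f s) *: phi c.
  by apply: (cp_semilinear (m' := right2 U \o f) pD) => {s c} s t c d; rewrite cp_r pr.
split=> //.
have bb : bal2 (ralg_tens S T) (fun a b : coring_tens C D =>
    tpure (right2 U) (left2 U) (phi a) (phi b)).
  exact: (iso_bal pD pl' pr' (tpure_balanced _ _ _ _)).
have hL := coring_tens_linear (comul_linear hC) (comul_linear hD).
apply: cp_ext => [x y|x y|c d].
- by rewrite pD (comulD (comul_linear hE)).
- by rewrite (swD hL bb).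
- by rewrite pc (sw_cp (comul_linear hC) (comul_linear hD) _ _ bb).
Qed.

End CoringIso.

(** * Functoriality, commutativity and associativity of the tensor product up to isomorphism *)

Lemma st_ext (R : comPzRingType) (S T : ralg R) (U : zmodType) (f g : ralg_tens S T ->
    U) :
  addmap f -> addmap g -> (forall s t, f (rpure _ _ s t) = g (rpure _ _ s t)) -> f =1 g.
Proof.
move=> fD gD e; elim/st_ind=> [|x y IHx IHy|s t] //; first by rewrite !addmap0.
by rewrite fD gD IHx IHy.
Qed.

Section CpLift.
Variables (R : comPzRingType) (S T : ralg R).
Variables (C : coring_data S) (D : coring_data T).
Variables (P : zmodType) (K : C -> D -> P).
Notation i := (ralg_str S).
Notation j := (ralg_str T).

Lemma bal_str : (forall d, addmap (K^~ d)) -> (forall c, addmap (K c)) ->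
  (forall r c d, K (left2 S (i r) *: c) d = K c (left2 T (j r) *: d)) ->
  balanced (str2 S) (str2 T) K.
Proof.
move=> Kl Kr KZ; split=> [m m' n|m n n'|r m n]; [exact: Kl|exact: Kr|exact: KZ].
Qed.

Definition cp_lift (x : coring_tens C D) : P :=
  tlift K (x : tens (str2 S) (str2 T) C D).

Hypothesis bK : balanced (str2 S) (str2 T) K.

Lemma cp_liftE c d : cp_lift (coring_tens_pure c d) = K c d.
Proof. exact: (tlift_pure bK). Qed.

Lemma cp_liftD : addmap cp_lift.
Proof. exact: (tliftD bK). Qed.

End CpLift.

Lemma cp_bal_pure (R : comPzRingType) (S T : ralg R)
  (C : coring_data S) (D : coring_data T) :
  balanced (str2 S) (str2 T) (@coring_tens_pure R S T C D).
Proof. exact: tpure_balanced. Qed.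

Lemma rpureDl (A B C : comPzRingType) (f : {rmorphism A -> B})
  (g : {rmorphism A -> C}) c : addmap (fun b => rpure f g b c).
Proof. exact: (@tpureDl _ _ _ f g B^o C^o c). Qed.

Lemma rpureDr (A B C : comPzRingType) (f : {rmorphism A -> B})
  (g : {rmorphism A -> C}) b : addmap (rpure f g b).
Proof. exact: (@tpureDr _ _ _ f g B^o C^o b). Qed.

Section Functoriality.
Variables (R : comPzRingType) (S T S' T' : ralg R).
Variables (f : {rmorphism S -> S'}) (g : {rmorphism T -> T'}).
Hypotheses (fs : forall r, f (ralg_str S r) = ralg_str S' r)
  (gs : forall r, g (ralg_str T r) = ralg_str T' r).

Lemma rmap_agree r :
  (tinl (ralg_str S') (ralg_str T') \o f) (ralg_str S r) =
  (tinr (ralg_str S') (ralg_str T') \o g) (ralg_str T r).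
Proof. by rewrite /= fs gs tinlr. Qed.

Definition rmap : {rmorphism ralg_tens S T -> ralg_tens S' T'} := rlift rmap_agree.

Lemma rmapE s t : rmap (rpure _ _ s t) = rpure _ _ (f s) (g t).
Proof. by rewrite [LHS]rlift_pure [LHS]rpureM mulr1 mul1r. Qed.

Lemma rmap_str r : rmap (ralg_str (ralg_tens S T) r) = ralg_str (ralg_tens S' T') r.
Proof. by rewrite [LHS]rmapE fs rmorph1. Qed.

End Functoriality.

Lemma rmapK (R : comPzRingType) (S T S' T' : ralg R)
  (f : {rmorphism S -> S'}) (g : {rmorphism T -> T'})
  (f' : {rmorphism S' -> S}) (g' : {rmorphism T' -> T})
  (fs : forall r, f (ralg_str S r) = ralg_str S' r)
  (gs : forall r, g (ralg_str T r) = ralg_str T' r)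
  (fs' : forall r, f' (ralg_str S' r) = ralg_str S r)
  (gs' : forall r, g' (ralg_str T' r) = ralg_str T r) :
  cancel f f' -> cancel g g' -> cancel (rmap fs gs) (rmap fs' gs').
Proof.
move=> fK gK; apply: st_ext => [x y|//|s t]; first by rewrite !rmorphD.
by rewrite !rmapE fK gK.
Qed.

Section PhiMap.
Variables (R : comPzRingType) (S T S' T' : ralg R).
Variables (C : coring_data S) (D : coring_data T).
Variables (C' : coring_data S') (D' : coring_data T').
Variables (f : {rmorphism S -> S'}) (g : {rmorphism T -> T'}).
Variables (phi : C -> C') (psi : D -> D').
Hypotheses (if_ : coring_iso f phi) (ig : coring_iso g psi).

Lemma coring_tens_map_bal : balanced (str2 S) (str2 T)
  (fun c d => coring_tens_pure (phi c) (psi d) : coring_tens C' D').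
Proof.
apply: bal_str => [d c c'|c d d'|r c d].
- by rewrite (ci_D if_) cpDl.
- by rewrite (ci_D ig) cpDr.
- rewrite (ci_l if_) (ci_l ig) (ci_str if_) (ci_str ig).
  exact: (balZ (cp_bal_pure C' D') r).
Qed.

Definition coring_tens_map : coring_tens C D -> coring_tens C' D' :=
  cp_lift (fun c d => coring_tens_pure (phi c) (psi d) : coring_tens C' D').

Lemma coring_tens_mapE c d :
  coring_tens_map (coring_tens_pure c d) = coring_tens_pure (phi c) (psi d).
Proof. exact: (cp_liftE coring_tens_map_bal). Qed.

Lemma coring_tens_mapD : addmap coring_tens_map.
Proof. exact: (cp_liftD coring_tens_map_bal). Qed.

End PhiMap.

Section IsoTens.
Variables (R : comPzRingType).

Lemma cpair_iso_tens (S T S' T' : ralg R)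
  (C : coring_data S) (D : coring_data T)
  (C' : coring_data S') (D' : coring_data T') :
  is_coring C -> is_coring D -> is_coring C' -> is_coring D' ->
  cpair_iso (Cpair C) (Cpair C') -> cpair_iso (Cpair D) (Cpair D') ->
  cpair_iso (Cpair (coring_tens C D)) (Cpair (coring_tens C' D')).
Proof.
move=> hC hD hC' hD' /cpair_isoP [f [phi i1]] /cpair_isoP [g [psi i2]].
have [f' [phi' [j1 [fK fK' pK pK']]]] := coring_iso_sym i1.
have [g' [psi' [j2 [gK gK' qK qK']]]] := coring_iso_sym i2.
apply/cpair_isoP; exists (rmap (ci_str i1) (ci_str i2)), (coring_tens_map phi psi).
have pe := coring_tens_mapE i1 i2; have pe' := coring_tens_mapE j1 j2.
have pd := coring_tens_mapD i1 i2; have pd' := coring_tens_mapD j1 j2.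
apply: cp_isoI => //.
- exact: coring_tens_is_coring.
- by exists (rmap (ci_str j1) (ci_str j2)); apply: rmapK.
- exact: rmap_str.
- exists (coring_tens_map phi' psi'); apply: cp_ext => [x y|//|c d].
  + by rewrite pd pd'.
  + by rewrite pe pe' pK qK.
  + by rewrite pd' pd.
  + by rewrite pe' pe pK' qK'.
- move=> s t c d; rewrite !pe rmapE (ci_l i1) (ci_l i2).
  by symmetry; apply: cp_l.
- move=> s t c d; rewrite !pe rmapE (ci_r i1) (ci_r i2).
  by symmetry; apply: cp_r.
- move=> c d; rewrite pe (comul_cp (comul_linear hC') (comul_linear hD')) /sw2.
  have tb := tpure_balanced (right2 (ralg_tens S' T')) (left2 (ralg_tens S' T'))
    (coring_tens_mod C' D') (coring_tens_mod C' D').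
  rewrite (iso_sw _ i1); last by apply: bal_param => d1 d2; apply: (bal_cpl _ _ tb).
  apply: sw_ext => c1 c2; rewrite (iso_sw _ i2); last exact: (bal_cpr _ _ tb).
  by apply: sw_ext => d1 d2; rewrite !pe.
Qed.

Section Comm.
Variables (S T : ralg R) (C : coring_data S) (D : coring_data T).
Hypotheses (hC : is_coring C) (hD : is_coring D).

Lemma rswap_agree r : tinr (ralg_str T) (ralg_str S) (ralg_str S r) =
  tinl (ralg_str T) (ralg_str S) (ralg_str T r).
Proof. by rewrite tinlr. Qed.

Definition rswap : {rmorphism ralg_tens S T -> ralg_tens T S} := rlift rswap_agree.

Lemma rswapE s t : rswap (rpure _ _ s t) = rpure _ _ t s.
Proof. by rewrite [LHS]rlift_pure [LHS]rpureM mulr1 mul1r. Qed.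

Lemma cswap_bal : balanced (str2 S) (str2 T)
  (fun (c : C) (d : D) => coring_tens_pure d c : coring_tens D C).
Proof.
apply: bal_str => [d c c'|c d d'|r c d].
- exact: cpDr.
- exact: cpDl.
- exact: (esym (balZ (cp_bal_pure D C) r d c)).
Qed.

Definition cswap : coring_tens C D -> coring_tens D C :=
  cp_lift (fun (c : C) (d : D) => coring_tens_pure d c : coring_tens D C).

Lemma cswapE c d : cswap (coring_tens_pure c d) = coring_tens_pure d c.
Proof. exact: (cp_liftE cswap_bal). Qed.

Lemma cswapD : addmap cswap.
Proof. exact: (cp_liftD cswap_bal). Qed.

End Comm.

Lemma rswapK (S T : ralg R) : cancel (@rswap S T) (@rswap T S).
Proof.
apply: st_ext => [x y|//|s t]; first by rewrite !rmorphD.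
by rewrite !rswapE.
Qed.

Lemma cswapK (S T : ralg R) (C : coring_data S) (D : coring_data T) :
  cancel (@cswap S T C D) (@cswap T S D C).
Proof. by apply: cp_ext => [x y|//|c d]; rewrite ?cswapD ?cswapE. Qed.

Lemma cpair_iso_comm (S T : ralg R) (C : coring_data S) (D : coring_data T) :
  is_coring C -> is_coring D ->
  cpair_iso (Cpair (coring_tens C D)) (Cpair (coring_tens D C)).
Proof.
move=> hC hD; apply/cpair_isoP; exists (@rswap S T), (@cswap S T C D).
apply: cp_isoI => //.
- exact: coring_tens_is_coring.
- by exists (@rswap T S); apply: rswapK.
- by move=> r; rewrite [LHS]rswapE; symmetry; apply: tinlr.
- exact: cswapD.
- by exists (@cswap T S D C); apply: cswapK.
- by move=> s t c d; rewrite !cswapE rswapE [RHS]cp_l.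
- by move=> s t c d; rewrite !cswapE rswapE [RHS]cp_r.
- move=> c d; rewrite cswapE (comul_cp (comul_linear hD) (comul_linear hC)) /sw2.
  rewrite sw_exchange; apply: sw_ext => c1 c2; apply: sw_ext => d1 d2.
  by rewrite !cswapE.
Qed.

Section Assoc.
Variables (S T U : ralg R).
Variables (C : coring_data S) (D : coring_data T) (E : coring_data U).
Notation S_TU := (ralg_tens S (ralg_tens T U)).
Notation ST_U := (ralg_tens (ralg_tens S T) U).
Notation i := (ralg_str S).
Notation j := (ralg_str T).
Notation k := (ralg_str U).
Notation TU := (ralg_tens T U).
Notation ST := (ralg_tens S T).

Lemma ralg_assoc0_agree r : tinl i (ralg_str TU) (i r) =
  (tinr i (ralg_str TU) \o tinl j k) (j r).
Proof. exact: tinlr. Qed.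
Definition ralg_assoc0 : {rmorphism ST -> S_TU} := rlift ralg_assoc0_agree.
Lemma ralg_assoc_agree r : ralg_assoc0 (ralg_str ST r) =
    (tinr i (ralg_str TU) \o tinr j k) (k r).
Proof.
transitivity (tinl i (ralg_str TU) (i r)); first exact: rlift_inl.
by rewrite tinlr; congr (tinr _ _ _); apply: tinlr.
Qed.
Definition ralg_assoc : {rmorphism ST_U -> S_TU} := rlift ralg_assoc_agree.

Lemma ralg_assocE s t u : ralg_assoc (rpure _ _ (rpure _ _ s t) u) =
    rpure i (ralg_str TU) s (rpure j k t u).
Proof.
rewrite [LHS]rlift_pure [ralg_assoc0 _]rlift_pure [X in X * _]rpureM [LHS]rpureM !mulr1
    mul1r.
by rewrite rpureM mulr1 mul1r.
Qed.

Lemma ralg_assocV0_agree r : (tinl (ralg_str ST) k \o tinr i j) (j r) =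
    tinr (ralg_str ST) k (k r).
Proof.
rewrite -tinlr; transitivity (tinl (ralg_str ST) k (tinr i j (j r))) => //.
by congr (tinl _ _ _); symmetry; apply: tinlr.
Qed.
Definition ralg_assocV0 : {rmorphism TU -> ST_U} := rlift ralg_assocV0_agree.
Lemma ralg_assocV_agree r : (tinl (ralg_str ST) k \o tinl i j) (i r) =
    ralg_assocV0 (ralg_str TU r).
Proof.
transitivity (tinl (ralg_str ST) k (tinr i j (j r))); last by symmetry; apply: rlift_inl.
by congr (tinl _ _ _); apply: tinlr.
Qed.
Definition ralg_assocV : {rmorphism S_TU -> ST_U} := rlift ralg_assocV_agree.

Lemma ralg_assocVE s t u : ralg_assocV (rpure i (ralg_str TU) s (rpure j k t u)) =
    rpure _ _ (rpure _ _ s t) u.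
Proof.
rewrite [LHS]rlift_pure [ralg_assocV0 _]rlift_pure [X in _ * X]rpureM [LHS]rpureM !mulr1
    mul1r.
by rewrite rpureM mulr1 mul1r mul1r.
Qed.

Lemma ralg_assocK : cancel ralg_assoc ralg_assocV.
Proof.
apply: st_ext => [x y|//|x u]; first by rewrite !rmorphD.
move: x; apply: st_ext => [x y|x y|s t]; rewrite ?rpureDl ?rmorphD //.
by rewrite ralg_assocE ralg_assocVE.
Qed.

Lemma ralg_assocVK : cancel ralg_assocV ralg_assoc.
Proof.
apply: st_ext => [x y|//|s x]; first by rewrite !rmorphD.
move: x; apply: st_ext => [x y|x y|t u]; rewrite ?rpureDr ?rmorphD //.
by rewrite ralg_assocVE ralg_assocE.
Qed.

Notation cpCD := (@coring_tens_pure R S T C D).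
Notation cpDE := (@coring_tens_pure R T U D E).
Notation cpC_DE := (@coring_tens_pure R S TU C (coring_tens D E)).
Notation cpCD_E := (@coring_tens_pure R ST U (coring_tens C D) E).

Definition cassoc0 (e : E) : coring_tens C D -> coring_tens C (coring_tens D E) :=
  cp_lift (fun c d => cpC_DE c (cpDE d e)).

Lemma cassoc0_bal e : balanced (str2 S) (str2 T) (fun c d => cpC_DE c (cpDE d e)).
Proof.
apply: bal_str => [d c c'|c d d'|r c d].
- exact: cpDl.
- by rewrite cpDl cpDr.
- rewrite [LHS](balZ (cp_bal_pure C (coring_tens D E)) r); congr (cpC_DE _ _).
  by rewrite -[str2 TU r]/(left2 TU (rpure j k (j r) 1)) [LHS]cp_l rmorph1 scale1r.
Qed.

Lemma cassoc0E e c d : cassoc0 e (cpCD c d) = cpC_DE c (cpDE d e).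
Proof. exact: (cp_liftE (cassoc0_bal e)). Qed.
Lemma cassoc0D e : addmap (cassoc0 e).
Proof. exact: (cp_liftD (cassoc0_bal e)). Qed.
Lemma cassoc0Dr x : addmap (cassoc0^~ x).
Proof. by move=> e e'; apply: tlift_split => c d; rewrite -cpDr; congr (cpC_DE _ _);
    apply: cpDr. Qed.

Lemma cassoc_bal : balanced (str2 ST) (str2 U) (fun x e => cassoc0 e x).
Proof.
apply: bal_str => [e|x|r x e]; [exact: cassoc0D|exact: cassoc0Dr|].
move: x; apply: cp_ext => [x y|x y|c d]; rewrite ?scalerDr ?cassoc0D //.
rewrite -[ralg_str ST r]/(rpure i j (i r) 1) cp_l rmorph1 scale1r !cassoc0E.
rewrite [LHS](balZ (cp_bal_pure C (coring_tens D E)) r); congr (cpC_DE _ _).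
(* Inside d (x) e a scalar from R may sit in either factor; [tinlr] carries it from [d] to [e]. *)
rewrite -[str2 TU r]/(left2 TU (tinl j k (j r))) tinlr [LHS]cp_l rmorph1 scale1r.
by [].
Qed.

Definition cassoc : coring_tens (coring_tens C D) E -> coring_tens C (coring_tens D E) :=
  cp_lift (fun x e => cassoc0 e x).

Lemma cassocE c d e : cassoc (cpCD_E (cpCD c d) e) = cpC_DE c (cpDE d e).
Proof. by rewrite [LHS](cp_liftE cassoc_bal) cassoc0E. Qed.
Lemma cassocD : addmap cassoc. Proof. exact: (cp_liftD cassoc_bal). Qed.

Definition cassocV0 (c : C) : coring_tens D E -> coring_tens (coring_tens C D) E :=
  cp_lift (fun d e => cpCD_E (cpCD c d) e).

Lemma cassocV0_bal c : balanced (str2 T) (str2 U) (fun d e => cpCD_E (cpCD c d) e).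
Proof.
apply: bal_str => [e d d'|d e e'|r d e].
- by rewrite cpDr cpDl.
- exact: cpDr.
- rewrite -[RHS](balZ (cp_bal_pure (coring_tens C D) E) r); congr (cpCD_E _ _).
  rewrite -[str2 ST r]/(left2 ST (tinl i j (i r))) tinlr [RHS]cp_l rmorph1 scale1r.
  by [].
Qed.

Lemma cassocV0E c d e : cassocV0 c (cpDE d e) = cpCD_E (cpCD c d) e.
Proof. exact: (cp_liftE (cassocV0_bal c)). Qed.
Lemma cassocV0D c : addmap (cassocV0 c).
Proof. exact: (cp_liftD (cassocV0_bal c)). Qed.
Lemma cassocV0Dl x : addmap (cassocV0^~ x).
Proof. by move=> e e'; apply: tlift_split => c d; rewrite -cpDl; congr (cpCD_E _ _);
    apply: cpDl. Qed.

Lemma cassocV_bal : balanced (str2 S) (str2 TU) cassocV0.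
Proof.
apply: bal_str => [x|c|r c x]; [exact: cassocV0Dl|exact: cassocV0D|].
move: x; apply: cp_ext => [x y|x y|d e]; rewrite ?scalerDr ?cassocV0D //.
rewrite -[ralg_str TU r]/(rpure j k (j r) 1) [X in cassocV0 c X]cp_l rmorph1 scale1r
    !cassocV0E.
congr (cpCD_E _ _); exact: (balZ (cp_bal_pure C D) r).
Qed.

Definition cassocV : coring_tens C (coring_tens D E) -> coring_tens (coring_tens C D) E :=
  cp_lift cassocV0.

Lemma cassocVE c d e : cassocV (cpC_DE c (cpDE d e)) = cpCD_E (cpCD c d) e.
Proof. by rewrite [LHS](cp_liftE cassocV_bal) cassocV0E. Qed.
Lemma cassocVD : addmap cassocV. Proof. exact: (cp_liftD cassocV_bal). Qed.

Lemma cassocK : cancel cassoc cassocV.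
Proof.
apply: cp_ext => [x y|//|x e]; first by rewrite cassocD cassocVD.
move: x; apply: cp_ext => [x y|x y|c d].
- by rewrite cpDl cassocD cassocVD.
- by rewrite cpDl.
- by rewrite cassocE cassocVE.
Qed.

Lemma cassocVK : cancel cassocV cassoc.
Proof.
apply: cp_ext => [x y|//|c x]; first by rewrite cassocVD cassocD.
move: x; apply: cp_ext => [x y|x y|d e].
- by rewrite cpDr cassocVD cassocD.
- by rewrite cpDr.
- by rewrite cassocVE cassocE.
Qed.

Lemma cpair_iso_assoc : is_coring C -> is_coring D -> is_coring E ->
  cpair_iso (Cpair (coring_tens (coring_tens C D) E))
            (Cpair (coring_tens C (coring_tens D E))).
Proof.
move=> hC hD hE; apply/cpair_isoP; exists ralg_assoc, cassoc.
have hCD := coring_tens_is_coring hC hD; have hDE := coring_tens_is_coring hD hE.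
have lC := comul_linear hC; have lD := comul_linear hD; have lE := comul_linear hE.
have lCD := comul_linear hCD; have lDE := comul_linear hDE.
apply: cp_isoI => //.
- exact: coring_tens_is_coring.
- by exists ralg_assocV; [exact: ralg_assocK|exact: ralg_assocVK].
- by move=> r; rewrite [LHS]ralg_assocE.
- exact: cassocD.
- by exists cassocV; [exact: cassocK|exact: cassocVK].
- move=> x u c' e.
  move: c'; apply: cp_ext => [c' c''|c' c''|c d];
      rewrite ?scalerDr ?cpDl ?cassocD ?scalerDr //.
  move: x; apply: st_ext => [x y|x y|s t].
  + by rewrite rmorphD scalerDl cpDl cassocD.
  + by rewrite rpureDl !rmorphD scalerDl.
  + by rewrite cp_l !cassocE ralg_assocE [RHS]cp_l; congr (cpC_DE _ _); symmetry;
      apply: cp_l.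
- move=> x u c' e.
  move: c'; apply: cp_ext => [c' c''|c' c''|c d];
      rewrite ?scalerDr ?cpDl ?cassocD ?scalerDr //.
  move: x; apply: st_ext => [x y|x y|s t].
  + by rewrite rmorphD scalerDl cpDl cassocD.
  + by rewrite rpureDl !rmorphD scalerDl.
  + by rewrite cp_r !cassocE ralg_assocE [RHS]cp_r; congr (cpC_DE _ _); symmetry;
      apply: cp_r.
- have tb := tpure_balanced (right2 S_TU) (left2 S_TU)
    (coring_tens_mod C (coring_tens D E)) (coring_tens_mod C (coring_tens D E)).
  have bb e1 e2 : bal2 ST (fun c1 c2 : coring_tens C D =>
    tpure (right2 S_TU) (left2 S_TU) (cassoc (cpCD_E c1 e1)) (cassoc (cpCD_E c2 e2))).
    apply: cp_bal.
    + by move=> y x x'; rewrite cpDl cassocD tpureDl.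
    + by move=> y x x'; rewrite cpDl cassocD tpureDr.
    + move=> s t c d c' d'; rewrite !cassocE.
      have := balZ tb (rpure i (ralg_str TU) s (rpure j k t 1)) (cpC_DE c (cpDE d e1))
          (cpC_DE c' (cpDE d' e2)).
      by rewrite cp_r cp_l [right2 TU _ *: _]cp_r [left2 TU _ *: _]cp_l !rmorph1 !scale1r.
  move=> x e; move: x; apply: cp_ext => [x y|x y|c d].
  + by rewrite cpDl cassocD (comulD (coring_tens_linear lC lDE)).
  + by apply: (swD lCD); apply: bal_param => e1 e2.
  rewrite cassocE (comul_cp lC lDE) (sw_cp lC lD); last by apply: bal_param => e1 e2.
  apply: sw_ext => c1 c2.
  rewrite (sw_cp lD lE); last exact: (bal_cpr _ _ tb).
  apply: sw_ext => d1 d2; apply: sw_ext => e1 e2.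
  by rewrite !cassocE.
Qed.

End Assoc.
End IsoTens.

Section CpairIso.
Variable R : comPzRingType.

Lemma cpair_iso_refl (X : cpair R) : cpair_iso X X.
Proof.
by case: X => S C; apply/cpair_isoP; exists idfun, id; apply: coring_iso_refl.
Qed.

Lemma cpair_iso_sym (X Y : cpair R) : cpair_iso X Y -> cpair_iso Y X.
Proof.
case: X Y => S C [T D] /cpair_isoP [f [phi iso]]; apply/cpair_isoP.
by have [g [psi [iso' _]]] := coring_iso_sym iso; exists g, psi.
Qed.

Lemma cpair_iso_trans (Y X Z : cpair R) :
  cpair_iso X Y -> cpair_iso Y Z -> cpair_iso X Z.
Proof.
case: X Y Z => S C [T D] [U E] /cpair_isoP [f [phi i1]] /cpair_isoP [g [psi i2]].
by apply/cpair_isoP; exists (g \o f), (psi \o phi); apply: coring_iso_trans.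
Qed.

End CpairIso.

Lemma ci_linear (R : comPzRingType) (S : ralg R) (C D : coring_data S) (phi : C ->
    D) a c :
  coring_iso (C := C) (D := D) idfun phi -> phi (a *: c) = a *: phi c.
Proof.
move=> iso; elim/tens2_ind: a => [|a b IHa IHb|s t].
- by rewrite !scale0r (addmap0 (ci_D iso)).
- by rewrite !scalerDl (ci_D iso) IHa IHb.
- by rewrite -!scalerA (ci_l iso) (ci_r iso).
Qed.

Section Transfer.
Variables (R : comPzRingType) (S : ralg R) (C D : coring_data S) (phi : C -> D).
Hypothesis iso : coring_iso (C := C) (D := D) idfun phi.

(** The inverse of [coF] for [D] is [G] conjugated by the isomorphism. [is_coring D] is asked for
    separately because [coring_iso] does not mention counits. *)
Lemma azumaya_over_iso : is_coring D -> azumaya_over C -> azumaya_over D.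
Proof.
move=> hD /azumaya_overP [hC pC [G FK GK]].
have [psi pK psK] := ci_pbij iso.
have iso' : coring_iso (C := D) (D := C) idfun psi by apply: coring_iso_inv iso.
have psD := ci_D iso'; have psZ a d := ci_linear a d iso'.
have psbal := iso_bal (ci_D iso') (ci_l iso') (ci_r iso').
apply/azumaya_overP; split=> //.
  apply: (@faithfully_projective_transfer _ _ idfun id C D psi phi) => //.
pose K z s := cpure (phi z) s : cS D.
have bK : balS S (fun z (s : S^o) => K z s).
  split=> [z z' s|z s s'|a z s].
  - by rewrite /K (ci_D iso); apply: tpureDl.
  - exact: tpureDr.
  - by rewrite /K (ci_linear _ _ iso); apply: tpureZ.
have bG : bal2 S (fun d d' => gg G K (psi d) (psi d')).
  exact: psbal _ _ (gg_bal hC FK GK bK).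
exists (tlift (fun d d' => gg G K (psi d) (psi d'))).
- move=> x; elim/tens_ind: x => [|x y IHx IHy|d s].
  + by rewrite (addmap0 (coFD hD)) (addmap0 (tliftD bG)).
  + by rewrite (coFD hD) (tliftD bG) IHx IHy.
  rewrite -[tpure _ _ _ _]/(cpure d s) (coF_pure hD) (addmap_sw _ _ (tliftD bG)).
  rewrite -[d]psK (iso_sw _ iso); last first.
    split=> [m m' n|m n n'|a m n]; rewrite !(tlift_pure bG).
    + by rewrite scalerDr (balDl bG).
    + by rewrite (balDr bG).
    + by rewrite -(balZ bG) !scalerA mulrC.
  rewrite -[RHS]/(K (psi d) s) -(gg_sw hC FK GK bK); apply: sw_ext => a b.
  by rewrite (tlift_pure bG) !psZ !pK.
- move=> x; elim/tens_ind: x => [|x y IHx IHy|d d'].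
  + by rewrite (addmap0 (tliftD bG)) (addmap0 (coFD hD)).
  + by rewrite (tliftD bG) (coFD hD) IHx IHy.
  rewrite (tlift_pure bG) (addmap_gg _ _ _ (coFD hD)).
  have tb := tpure_balanced (right2 S) (left2 S) D D.
  have tb' := iso_bal (ci_D iso) (ci_l iso) (ci_r iso) tb.
  rewrite -[d in RHS]psK -[d' in RHS]psK -(sw_gg hC GK _ _ tb').
  apply: gg_ext => z s; rewrite (coF_pure hD) (iso_sw _ iso); last exact: coF_bal0.
  by apply: sw_ext => a b; rewrite ci_linear.
Qed.

End Transfer.

(** * The unit coring *)

Section Unit.
Variable R : comPzRingType.
Notation S := (ralg_id R).
Notation l2 := (left2 S).
Notation r2 := (right2 S).
Notation U := (ccoring (cpair_unit R)).
Definition u_of (r : R) : U := r.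

Lemma unit_l s (x : U) : l2 s *: x = u_of (s * x).
Proof.
rewrite -[LHS]/(mul2 S (l2 s) * x :> R) /u_of; congr (_ * _ : R).
exact: rlift_inl.
Qed.

Lemma unit_r s (x : U) : r2 s *: x = u_of (s * x).
Proof.
rewrite -[LHS]/(mul2 S (r2 s) * x :> R) /u_of; congr (_ * _ : R).
exact: rlift_inr.
Qed.

Lemma unit_sw (P : zmodType) (b : U -> U -> P) x : bal2 S b -> sw b x = b x (u_of 1).
Proof. by move=> bb; rewrite /sw [LHS](tlift_pure bb). Qed.

Lemma unit_comul (x : U) : comul x = tpure r2 l2 x (u_of 1).
Proof. by []. Qed.

Lemma unit_comul_linear : linear (comul (c := U) : U -> tensS_bimod U U).
Proof.
have cD : addmap (comul (c := U) : U -> tensS_bimod U U) by move=> x y; apply: tpureDl.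
move=> a x y; rewrite cD; congr (_ + _).
elim/tens2_ind: a => [|a b IHa IHb|s t].
- by rewrite !scale0r (addmap0 cD).
- by rewrite !scalerDl cD IHa IHb.
rewrite -!scalerA [in RHS]unit_comul tensS_r tensS_l unit_r unit_l.
have -> : r2 t *: u_of 1 = l2 t *: u_of 1 by rewrite unit_l unit_r.
by rewrite -tpureZ unit_r !unit_l unit_comul /u_of mulrCA.
Qed.

Lemma unit_is_coring : is_coring U.
Proof.
have tT := @trilin_tpure _ _ U.
have hL := unit_comul_linear.
apply: is_coringI => //.
- move=> x; rewrite !unit_sw //; [exact: (tri23 tT)|exact: (trilin_sw2 hL tT)|exact:
    (tri12 tT)|exact: (trilin_sw1 hL tT)].
- move=> x; rewrite unit_sw; first by rewrite unit_l /u_of mulr1.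
  split=> [m m' n|m n n'|a m n].
  + by rewrite !unit_l; apply: mulrDl.
  + by rewrite scalerDr.
  + by rewrite unit_r !unit_l /u_of mulrCA mulrA.
- move=> x; rewrite unit_sw; first by rewrite unit_r /u_of mul1r.
  split=> [m m' n|m n n'|a m n].
  + by rewrite scalerDr.
  + by rewrite !unit_r; apply: mulrDl.
  + by rewrite unit_l !unit_r /u_of mulrCA mulrA.
Qed.

Lemma unit_faithfully_projective : faithfully_projective U.
Proof.
have fp0 : faithfully_projective (R^o : lmodType R).
  have idl : linear (fun x : R^o => x : R^o) by [].
  apply/faithfully_projectiveP; split; exists [:: ((1 : R^o), dual_mk idl)].
    by move=> x; rewrite big_seq1 /= /GRing.scale /= mulr1.
  by rewrite big_seq1.
(* R (x)_R R is R, so the question reduces to R as a module over itself. *)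
have mK : cancel (mul2 S) l2.
  elim/tens2_ind=> [|a b IHa IHb|s t]; first by rewrite !rmorph0.
    by rewrite !rmorphD IHa IHb.
  have -> : mul2 S (l2 s * r2 t) = s * t.
    by rewrite rmorphM [mul2 S (l2 s)]rlift_inl [mul2 S (r2 t)]rlift_inr.
  by rewrite rmorphM; congr (_ * _); apply: (lr_str S t).
have Km : cancel l2 (mul2 S) by move=> s; apply: rlift_inl.
exact: (@faithfully_projective_transfer _ _ (mul2 S) l2 (R^o) U id id mK Km).
Qed.

Lemma unit_coF_bij : bijective (coF (C := U)).
Proof.
have hC := unit_is_coring.
have bG : bal2 S (fun a b : U => cpure (u_of ((a : R) * (b : R))) 1 : cS U).
  split=> [m m' n|m n n'|a m n].
  - rewrite -[RHS]tpureDl; congr (cpure _ _); exact: mulrDl.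
  - rewrite -[RHS]tpureDl; congr (cpure _ _); exact: mulrDr.
  - rewrite unit_r unit_l /u_of; congr (cpure _ _); by rewrite mulrAC mulrC mulrA.
exists (tlift (fun a b : U => cpure (u_of ((a : R) * (b : R))) 1 : cS U)).
- elim/tens_ind=> [|x y IHx IHy|x s].
  + by rewrite (addmap0 (coFD hC)) (addmap0 (tliftD bG)).
  + by rewrite (coFD hC) (tliftD bG) IHx IHy.
  rewrite -[tpure _ _ _ _]/(cpure x s) (coF_pure hC) unit_sw; last exact: coF_bal0.
  rewrite (tlift_pure bG) unit_r /u_of mulr1.
  transitivity (cpure (str2 S s *: x) 1).
    by congr (cpure _ _); rewrite -[str2 S s]/(l2 s) unit_l.
  by rewrite [LHS]tpureZ /GRing.scale /= mulr1.
- elim/tens_ind=> [|x y IHx IHy|x y].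
  + by rewrite (addmap0 (tliftD bG)) (addmap0 (coFD hC)).
  + by rewrite (tliftD bG) (coFD hC) IHx IHy.
  rewrite (tlift_pure bG) (coF_pure hC) unit_sw; last exact: coF_bal0.
  rewrite rmorph1 scale1r -[u_of (_ * _)](_ : r2 (y : R) *: x = _); last first.
    by rewrite unit_r /u_of mulrC.
  by rewrite tpureZ unit_l /u_of mulr1.
Qed.

Lemma unit_faithfully_flat : faithfully_flat S.
Proof.
move=> A B C u v /=.
(* x |-> 1 (x) x identifies [X] with its base change, naturally in [X]. *)
pose h (X : lmodType R) (x : X) : bchange S X := bpure (T := S) 1 x.
have hb (X : lmodType R) : bijective (@h X).
  have b : balanced (ralg_str S) idfun (fun (r : S^o) (x : X) => (r : R) *: x).
    split=> [r r' x|r x x'|a r x]; rewrite ?scalerDl ?scalerDr //.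
    by rewrite scalerA mulrC.
  exists (tlift (fun (r : S^o) (x : X) => (r : R) *: x)).
    by move=> x; rewrite /h (tlift_pure b) scale1r.
  have hD : addmap (@h X) by move=> x y; apply: tpureDr.
  elim/tens_ind=> [|x y IHx IHy|r x].
  - by rewrite (addmap0 (tliftD b)) (addmap0 hD).
  - by rewrite (tliftD b) hD IHx IHy.
  - by rewrite (tlift_pure b) /h -bpureZ; congr (bpure _ _); apply: mulr1.
apply: (exact_transfer (hb A) (hb B) (hb C)); first exact: tpure0r.
- by move=> x; rewrite [RHS](tlift_pure (bmap_bal S u)).
- by move=> x; rewrite [RHS](tlift_pure (bmap_bal S v)).
Qed.

Lemma unit_finitely_presented : finitely_presented S.
Proof.
have x0 : 'I_0 -> S by case.
exists 0%N, x0, 0%N, (fun k => [::]).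
(* Without variables there is a single exponent, and evaluation is its coefficient. *)
have ev p : mpol_eval x0 p = mpol_coef p [ffun=> 0%N].
  rewrite /mpol_eval /mpol_coef [RHS]big_mkcond; apply: eq_bigr => t _.
  have -> : t.2 = [ffun=> 0%N] by apply/ffunP; case.
  by rewrite eqxx big_ord0 mulr1.
split=> [s|p].
- by exists [:: (s, [ffun=> 0%N])]; rewrite ev /mpol_coef big_mkcond big_seq1 eqxx.
- rewrite ev; split=> [p0|[Q QP]]; last by rewrite QP big_ord0.
  exists (fun=> [::]) => e; rewrite big_ord0 -[RHS]p0; congr (mpol_coef p _).
  by apply/ffunP; case.
Qed.

Lemma unit_is_azumaya : is_azumaya (cpair_unit R).
Proof.
split; [exact: unit_faithfully_flat|exact: unit_finitely_presented|].
apply/azumaya_overP; split; [exact: unit_is_coring|exact: unit_faithfully_projective|].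
exact: unit_coF_bij.
Qed.

Section UnitIso.
Variables (T : ralg R) (C : coring_data T).
Notation j := (ralg_str T).

Lemma runit_agree r : j (idfun r) = (idfun : {rmorphism T -> T}) (j r).
Proof. by []. Qed.

Definition runit : {rmorphism ralg_tens S T -> T} := rlift runit_agree.

Lemma runitE s t : runit (rpure (ralg_str S) j s t) = j s * t.
Proof. exact: rlift_pure. Qed.

Lemma runit_bij : bijective runit.
Proof.
exists (tinr (ralg_str S) j); last by move=> t; exact: rlift_inr.
apply: st_ext => [x y|//|s t]; first by rewrite !rmorphD.
rewrite runitE rmorphM.
transitivity (tinl (ralg_str S) j s * tinr (ralg_str S) j t).
  by congr (_ * _); symmetry; apply: (tinlr (ralg_str S) j s).
by rewrite rpureM mulr1 mul1r.
Qed.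

Lemma cunit_bal : balanced (str2 S) (str2 T) (fun (r : U) (c : C) => left2 T (j r) *: c).
Proof.
apply: bal_str => [d c c'|c d d'|r c d].
- by rewrite -scalerDl -!rmorphD.
- by rewrite scalerDr.
- by rewrite unit_l /u_of [RHS]lscaleA -rmorphM mulrC.
Qed.

Definition cunit : coring_tens U C -> C :=
  cp_lift (fun (r : U) (c : C) => left2 T (j r) *: c).

Lemma cunitE r c : cunit (coring_tens_pure (r : U) c) = left2 T (j r) *: c.
Proof. exact: (cp_liftE cunit_bal). Qed.

Lemma cunitD : addmap cunit. Proof. exact: (cp_liftD cunit_bal). Qed.

Lemma cpair_iso_unit : is_coring C -> cpair_iso (Cpair (coring_tens U C)) (Cpair C).
Proof.
move=> hC; have hU := unit_is_coring; apply/cpair_isoP; exists runit, cunit.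
have hL := comul_linear hC.
apply: cp_isoI => //.
- exact: runit_bij.
- by move=> r; rewrite [LHS]runitE mulr1.
- exact: cunitD.
- exists (fun c => coring_tens_pure (u_of 1) c).
  + apply: cp_ext => [x y|//|r c]; first by rewrite cunitD cpDr.
    rewrite cunitE; have := balZ (cp_bal_pure U C) (r : R) (u_of 1) c.
    rewrite -[str2 T r]/(left2 T (j r)) => <-; congr (coring_tens_pure _ _).
    by rewrite -[str2 S r]/(l2 r) unit_l /u_of mulr1.
  + by move=> c; rewrite cunitE rmorph1 rmorph1 scale1r.
- move=> s t r c; rewrite unit_l /u_of !cunitE runitE !lscaleA; congr (left2 T _ *: _).
  by rewrite rmorphM mulrAC.
- move=> s t r c; rewrite unit_r /u_of !cunitE runitE lrC -rscaleA -lr_str.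
  by rewrite lscaleA -rmorphM mulrC.
- move=> r c; rewrite unit_sw; last first.
    apply: bal_param => d1 d2; split=> [m m' n|m n n'|a m n].
    + by rewrite cpDl cunitD tpureDl.
    + by rewrite cpDl cunitD tpureDr.
    + rewrite unit_l unit_r /u_of !cunitE !rmorphM -!scalerA.
      rewrite [left2 T (j a) *: (left2 T (j m) *: d1)]scalerA [_ * left2 T (j m)]mulrC
          -scalerA.
      rewrite (_ : left2 T (j a) *: d1 = right2 T (j a) *: d1); last by rewrite lr_str.
      by rewrite -lrC tpureZ.
  rewrite cunitE comulE (sw_l hL); last exact: tpure_balanced.
  by apply: sw_ext => a b; rewrite !cunitE rmorph1 rmorph1 scale1r.
Qed.

End UnitIso.
End Unit.

(** * Elementary corings *)

Section Invertible.
Variables (A : comPzRingType).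

(* The second half of invertibility is pp_gen: x (x) n = p(x, n) (sum of w), so
   that 1 |-> sum of w inverts p. *)
Record perfect_pairing (I N : lmodType A) (p : I -> N -> A) (w : seq (I * N)) : Prop :=
  PerfectPairing {
    pp_bal : balanced idfun idfun p;
    pp_l : forall a x n, p (a *: x) n = a * p x n;
    pp_1 : \sum_(q <- w) p q.1 q.2 = 1;
    pp_gen : forall x n, (tpure idfun idfun x n : tens idfun idfun I N) =
      \sum_(q <- w) tpure idfun idfun (p x n *: q.1) q.2 }.

Lemma tensA_scale (I N : lmodType A) a (x : I) (n : N) :
  a *: (tpure idfun idfun x n : tensA I N) = tpure idfun idfun (a *: x) n.
Proof. exact: (scale_tinl idfun idfun a x n). Qed.

Lemma invertibleP (I : lmodType A) :
  invertible I <-> exists (N : lmodType A) p w, @perfect_pairing I N p w.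
Proof.
split=> [[N [h [k hK kK]]]|[N [p [w [bp pl p1 pg]]]]]; exists N.
  (* [w] represents the element of I (x) N that [h] sends to 1; it generates I (x) N because 1
     generates A. *)
  pose w := repr (k 1).
  have wE : k 1 = \sum_(q <- w) tpure idfun idfun q.1 q.2 by rewrite -tens_clsE tens_clsK.
  exists (fun x n => h (tpure idfun idfun x n)), w.
  have hZ x n a : h (tpure idfun idfun (a *: x) n) = a * h (tpure idfun idfun x n).
    by rewrite -tensA_scale linearZ.
  split=> //.
  - split=> [m m' n|m n n'|a m n].
    + by rewrite tpureDl linearD.
    + by rewrite tpureDr linearD.
    + by rewrite tpureZ.
  - by rewrite -[RHS]kK wE linear_sum.
  - move=> x n; apply: (can_inj hK); rewrite linear_sum.
    under eq_bigr do rewrite hZ.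
    by rewrite -mulr_sumr -(linear_sum h) -wE kK mulr1.
have hl : linear (tlift p : tensA I N -> A^o).
  move=> a x y; rewrite (tliftD bp); congr (_ + _).
  elim/tens_ind: x => [|x x' IHx IHx'|x n].
  - by rewrite scaler0 (addmap0 (tliftD bp)) scaler0.
  - by rewrite scalerDr !(tliftD bp) IHx IHx' scalerDr.
  - by rewrite tensA_scale !(tlift_pure bp) pl.
exists (HB.pack_for {linear tensA I N -> A^o} (tlift p : tensA I N -> A^o)
  (GRing.isLinear.Build A (tensA I N) A^o *:%R (tlift p) hl)) => /=.
pose k (a : A) : tensA I N := \sum_(q <- w) tpure idfun idfun (a *: q.1) q.2.
have kD : addmap k.
  move=> a b; rewrite -big_split; apply: eq_bigr => q _.
  by rewrite scalerDl tpureDl.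
exists k.
- elim/tens_ind=> [|x y IHx IHy|x n].
  + by rewrite (addmap0 (tliftD bp)) (addmap0 kD).
  + by rewrite (tliftD bp) kD IHx IHy.
  + by rewrite (tlift_pure bp) /k -pg.
- move=> a; rewrite /k (addmap_sum _ _ (tliftD bp)).
  under eq_bigr do rewrite (tlift_pure bp) pl.
  by rewrite -mulr_sumr p1 mulr1.
Qed.

End Invertible.

(** * Tensor products of invertible modules *)

Section TensInvertible.
Variables (R : comPzRingType) (S T : ralg R).
Notation i := (ralg_str S).
Notation j := (ralg_str T).
Notation ST := (ralg_tens S T).

Definition tensM (I : lmodType S) (J : lmodType T) : lmodType ST := tens i j I J.

Section Pairing.
Variables (I N : lmodType S) (p : I -> N -> S) (w : seq (I * N)).
Variables (J M : lmodType T) (q : J -> M -> T) (v : seq (J * M)).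
Hypotheses (pp : perfect_pairing p w) (qq : perfect_pairing q v).

Notation bp := (pp_bal pp).
Notation bq := (pp_bal qq).

Definition tens_pairing (x : tensM I J) (n : tensM N M) : ST :=
  tlift (fun (a : I) (b : J) => tlift (fun (c : N) (d : M) => rpure i j (p a c) (q b d))
    (n : tens i j N M)) (x : tens i j I J).

Lemma pairing_bal1 a b : balanced i j (fun (c : N) (d : M) => rpure i j (p a c) (q b d)).
Proof.
split=> [m m' n|m n n'|r m n].
- by rewrite (balDr bp) rpureDl.
- by rewrite (balDr bq) rpureDr.
- rewrite -(balZ bp (i r)) -(balZ bq (j r)) (pp_l pp) (pp_l qq).
  exact: (tpureZ i j r (p a m : S^o) (q b n : T^o)).
Qed.

Lemma pairing_bal2 c d : balanced i j (fun (a : I) (b : J) => rpure i j (p a c) (q b d)).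
Proof.
split=> [m m' n|m n n'|r m n].
- by rewrite (balDl bp) rpureDl.
- by rewrite (balDl bq) rpureDr.
- rewrite (pp_l pp) (pp_l qq).
  exact: (tpureZ i j r (p m c : S^o) (q n d : T^o)).
Qed.

Lemma tens_pairing_Dl n : addmap (tens_pairing^~ n).
Proof. by apply: tliftD; apply: bal_param => c d; apply: pairing_bal2. Qed.
Lemma tens_pairing_Dr x : addmap (tens_pairing x).
Proof. by move=> n n'; apply: tlift_split => a b; apply: (tliftD (pairing_bal1 a b)). Qed.

Lemma tens_pairingE a b c d :
  tens_pairing (tpure i j a b) (tpure i j c d) = rpure i j (p a c) (q b d).
Proof.
rewrite /tens_pairing tlift_pure; first exact: (tlift_pure (pairing_bal1 a b)).
by apply: bal_param => ? ?; apply: pairing_bal2.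
Qed.

Lemma tens_pairing_l a x n : tens_pairing (a *: x) n = a * tens_pairing x n.
Proof.
elim/tens_ind: x => [|x y IHx IHy|x y].
- by rewrite scaler0 (addmap0 (tens_pairing_Dl n)) mulr0.
- by rewrite scalerDr !tens_pairing_Dl IHx IHy mulrDr.
elim/tens_ind: n => [|n m IHn IHm|n m].
- by rewrite !(addmap0 (tens_pairing_Dr _)) mulr0.
- by rewrite !tens_pairing_Dr IHn IHm mulrDr.
elim/tens_ind: a => [|a b IHa IHb|a b].
- by rewrite scale0r (addmap0 (tens_pairing_Dl _)) mul0r.
- by rewrite scalerDl tens_pairing_Dl IHa IHb mulrDl.
rewrite -[tpure i j a b]/(rpure i j a b) [X in tens_pairing X]scale_rpure.
by rewrite !tens_pairingE [RHS]rpureM (pp_l pp) (pp_l qq).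
Qed.

Lemma tens_pairing_r a x n : tens_pairing x (a *: n) = a * tens_pairing x n.
Proof.
elim/tens_ind: x => [|x y IHx IHy|x y].
- by rewrite !(addmap0 (tens_pairing_Dl _)) mulr0.
- by rewrite !tens_pairing_Dl IHx IHy mulrDr.
elim/tens_ind: n => [|n m IHn IHm|n m].
- by rewrite scaler0 !(addmap0 (tens_pairing_Dr _)) mulr0.
- by rewrite scalerDr !tens_pairing_Dr IHn IHm mulrDr.
elim/tens_ind: a => [|a b IHa IHb|a b].
- by rewrite scale0r (addmap0 (tens_pairing_Dr _)) mul0r.
- by rewrite scalerDl tens_pairing_Dr IHa IHb mulrDl.
rewrite -[tpure i j a b]/(rpure i j a b) [X in tens_pairing _ X]scale_rpure.
rewrite !tens_pairingE [RHS]rpureM -(balZ bp a) -(balZ bq b).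
by rewrite (pp_l pp) (pp_l qq).
Qed.

Lemma perfect_pairing_tens : perfect_pairing tens_pairing
  [seq (tpure i j a.1 b.1, tpure i j a.2 b.2) | a <- w, b <- v].
Proof.
split.
- split=> [m m' n|m n n'|a m n].
  + exact: tens_pairing_Dl.
  + exact: tens_pairing_Dr.
  + exact: (etrans (tens_pairing_l a m n) (esym (tens_pairing_r a m n))).
- exact: tens_pairing_l.
- rewrite big_allpairs_dep; under eq_bigr do under eq_bigr do rewrite tens_pairingE.
  under eq_bigr do rewrite -(addmap_sum _ _ (rpureDr i j _)) (pp_1 qq).
  by rewrite -(addmap_sum (h := fun b => rpure i j b 1)) ?(pp_1 pp) //; exact: rpureDl.
have gD (x : tensM I J) (n : tensM N M) : addmap (fun a : ST =>
    \sum_(q0 <- [seq (tpure i j a.1 b.1, tpure i j a.2 b.2) | a <- w, b <- v])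
     (tpure idfun idfun (a *: (q0.1 : tensM I J)) (q0.2 : tensM N M)
      : tens idfun idfun (tensM I J) (tensM N M))).
  by move=> a b; rewrite -big_split; apply: eq_bigr => u _; rewrite scalerDl tpureDl.
move=> x n.
elim/tens_ind: x => [|x y IHx IHy|x y].
- by rewrite (addmap0 (tens_pairing_Dl _)) (addmap0 (gD 0 n)) tpure0l.
- by rewrite tens_pairing_Dl (gD x n) tpureDl IHx IHy.
elim/tens_ind: n => [|n m IHn IHm|n m].
- by rewrite (addmap0 (tens_pairing_Dr _)) (addmap0 (gD 0 0)) tpure0r.
- by rewrite tens_pairing_Dr (gD 0 n) tpureDr IHn IHm.
rewrite tens_pairingE big_allpairs_dep.
pose tp (x : I) (n : N) (y : J) (m : M) : tens idfun idfun (tensM I J) (tensM N M) :=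
  tpure idfun idfun (tpure i j x y : tensM I J) (tpure i j n m : tensM N M).
have bI y' m' : balanced idfun idfun (fun x n => tp x n y' m').
  split=> [a a' b|a b b'|a b c]; rewrite /tp.
  - by rewrite tpureDl; apply: tpureDl.
  - by rewrite tpureDl; apply: tpureDr.
  - have := tpureZ (idfun : {rmorphism ST -> ST}) (idfun : {rmorphism ST ->
      ST}) (rpure i j a 1) (tpure i j b y' : tensM I J) (tpure i j c m' : tensM N M).
    by rewrite [_ *: _]scale_rpure [X in _ = tpure _ _ _ X]scale_rpure !scale1r.
have bJ x' n' : balanced idfun idfun (fun y m => tp x' n' y m).
  split=> [a a' b|a b b'|a b c]; rewrite /tp.
  - by rewrite tpureDr; apply: tpureDl.
  - by rewrite tpureDr; apply: tpureDr.
  - have := tpureZ (idfun : {rmorphism ST -> ST}) (idfun : {rmorphism ST ->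
      ST}) (rpure i j 1 a) (tpure i j x' b : tensM I J) (tpure i j n' c : tensM N M).
    by rewrite [_ *: _]scale_rpure [X in _ = tpure _ _ _ X]scale_rpure !scale1r.
(* Apply [pp_gen] of the first pairing with [y] and [m] fixed, and then [pp_gen] of the second
   inside each summand. *)
have := congr1 (tlift (fun x n => tp x n y m)) (pp_gen pp x n).
rewrite (tlift_pure (bI y m)) (addmap_sum _ _ (tliftD (bI y m))) => eI.
rewrite -[LHS]/(tp x n y m) eI.
apply: eq_bigr => a _; rewrite (tlift_pure (bI y m)).
have := congr1 (tlift (fun y m => tp (p x n *: a.1) a.2 y m)) (pp_gen qq y m).
rewrite (tlift_pure (bJ _ _)) (addmap_sum _ _ (tliftD (bJ _ _))) => ->.
apply: eq_bigr => b _; rewrite (tlift_pure (bJ _ _)) /tp.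
by rewrite [X in _ = tpure _ _ X _]scale_rpure.
Qed.

End Pairing.

Lemma invertible_tens (I : lmodType S) (J : lmodType T) :
  invertible I -> invertible J -> invertible (tensM I J).
Proof.
move=> /invertibleP [N [p [w pp]]] /invertibleP [M [q [v qq]]]; apply/invertibleP.
exists (tensM N M), (tens_pairing p q), [seq (tpure i j a.1 b.1,
    tpure i j a.2 b.2) | a <- w, b <- v].
exact: perfect_pairing_tens.
Qed.

End TensInvertible.

Section ListBasis.
Variables (R : comPzRingType) (S : ralg R) (I : lmodType S).
Variable L : seq (I * dual I).

(** [can] takes families indexed by ['I_n], whereas dual bases are built below as lists of pairs. *)
Definition lbasis (k : 'I_(size L)) : I := (tnth (in_tuple L) k).1.
Definition lcobasis (k : 'I_(size L)) : dual I := (tnth (in_tuple L) k).2.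

Lemma lbasis_sum (P : zmodType) (F : I -> dual I -> P) :
  \sum_k F (lbasis k) (lcobasis k) = \sum_(q <- L) F q.1 q.2.
Proof. by rewrite [RHS]big_tnth. Qed.

End ListBasis.

(** * The coring Can(I) of a module with a dual basis *)

Section Can.
Variables (R : comPzRingType) (S : ralg R) (I : lmodType S).
Variables (n : nat) (e : 'I_n -> I) (f : 'I_n -> dual I).
Hypothesis ef : dual_basis e f.
Notation i := (ralg_str S).
Notation l2 := (left2 S).
Notation r2 := (right2 S).
Notation K := (can e f).

Definition cn (g : dual I) (x : I) : K := tpure i i g x.

Lemma cnDl x : addmap (cn^~ x). Proof. exact: tpureDl. Qed.
Lemma cnDr g : addmap (cn g). Proof. exact: tpureDr. Qed.
Lemma cnZ r g x : cn (i r *: g) x = cn g (i r *: x). Proof. exact: tpureZ. Qed.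

Lemma cn_l s g x : l2 s *: cn g x = cn (s *: g) x.
Proof. exact: scale_tinl. Qed.
Lemma cn_r s g x : r2 s *: cn g x = cn g (s *: x).
Proof. exact: scale_tinr. Qed.

Lemma cn_ext (P : zmodType) (h k : K -> P) : addmap h -> addmap k ->
  (forall g x, h (cn g x) = k (cn g x)) -> h =1 k.
Proof. exact: tens_ext. Qed.

(** The dual form of [ef]: expand [x] in the basis and apply [g]. *)
Lemma cobasis_sum (g : dual I) : g = \sum_j (g (e j) : S) *: f j.
Proof.
apply: dual_ext => x; transitivity (\sum_j (g (e j) : S) * (f j x : S)).
  rewrite {1}(ef x) linear_sum; apply: eq_bigr => k _.
  by rewrite linearZ mulrC.
by elim/big_rec2: _ => // k a b _ ->.
Qed.

Lemma comul_can_bal : balanced i i (fun g x => \sum_j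
  (tpure r2 l2 (cn g (e j)) (cn (f j) x) : tensS K K)).
Proof.
split=> [m m' x|m x x'|r m x].
- by rewrite -big_split; apply: eq_bigr => k _; rewrite cnDl tpureDl.
- by rewrite -big_split; apply: eq_bigr => k _; rewrite cnDr tpureDr.
- apply: eq_bigr => k _; rewrite cnZ -cn_r tpureZ cn_l.
  by rewrite cnZ.
Qed.

Lemma comul_cn g x : comul (cn g x) =
  \sum_j (tpure r2 l2 (cn g (e j)) (cn (f j) x) : tensS K K).
Proof. exact: (tlift_pure comul_can_bal). Qed.

Lemma sw_cn (P : zmodType) (b : K -> K -> P) g x : bal2 S b ->
  sw b (cn g x) = \sum_j b (cn g (e j)) (cn (f j) x).
Proof.
move=> bb; rewrite /sw comul_cn (addmap_sum _ _ (tliftD bb)).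
by apply: eq_bigr => k _; rewrite (tlift_pure bb).
Qed.

Lemma counit_can_bal : balanced i i (fun (g : dual I) x => g x : S).
Proof.
split=> [//|m x x'|r m x]; first by rewrite linearD.
by rewrite linearZ.
Qed.

Lemma counit_cn g x : counit (cn g x) = g x.
Proof. exact: (tlift_pure counit_can_bal). Qed.

Lemma cn_linear (V : lmodType (tens2 S)) (h : K -> V) : addmap h ->
  (forall s g x, h (cn (s *: g) x) = l2 s *: h (cn g x)) ->
  (forall s g x, h (cn g (s *: x)) = r2 s *: h (cn g x)) -> linear h.
Proof.
move=> hD hl hr a x y; rewrite hD; congr (_ + _).
move: x; apply: (@cn_ext _ (fun x => h (a *: x)) (fun x => a *: h x)) => [x x'|x x'|g x].
- by rewrite scalerDr hD.
- by rewrite hD scalerDr.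
elim/tens2_ind: a => [|a b IHa IHb|s t].
- by rewrite !scale0r (addmap0 hD).
- by rewrite !scalerDl hD IHa IHb.
- by rewrite -!scalerA cn_r cn_l hl hr.
Qed.

Lemma can_is_coring : is_coring K.
Proof.
have hL : linear (comul (c := K) : K -> tensS_bimod K K).
  apply: cn_linear; first exact: (tliftD comul_can_bal).
  - move=> s g x; rewrite !comul_cn scaler_sumr; apply: eq_bigr => k _.
    by rewrite tensS_l cn_l.
  - move=> s g x; rewrite !comul_cn scaler_sumr; apply: eq_bigr => k _.
    by rewrite tensS_r cn_r.
have cD : addmap (counit (c := K)) by exact: (tliftD counit_can_bal).
have tT := @trilin_tpure _ _ K.
apply: is_coringI => //.
- apply: cn_linear => // s g x; rewrite !counit_cn.
  + rewrite -[RHS]/(mul2 S (l2 s) * g x).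
    by congr (_ * _); symmetry; apply: rlift_inl.
  + rewrite -[RHS]/(mul2 S (r2 s) * g x) linearZ.
    by congr (_ * _); symmetry; apply: rlift_inr.
- apply: cn_ext => [x y|x y|g x].
  + exact: (swD hL (trilin_sw1 hL tT)).
  + exact: (swD hL (trilin_sw2 hL tT)).
  (* Both sides are the double sum of the (g (x) e_j) (x) (f_j (x) e_k) (x) (f_k (x) x). *)
  rewrite (sw_cn _ _ (trilin_sw1 hL tT)) (sw_cn _ _ (trilin_sw2 hL tT)).
  under eq_bigr do rewrite (sw_cn _ _ (tri12 tT _)).
  under [RHS]eq_bigr do rewrite (sw_cn _ _ (tri23 tT _)).
  by rewrite exchange_big.
- have b : bal2 S (fun c1 c2 : K => l2 (counit c1) *: c2).
    split=> [m m' z|m z z'|a m z].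
    + by rewrite cD rmorphD scalerDl.
    + by rewrite scalerDr.
    + move: m; apply: cn_ext => [x y|x y|g x].
      * by rewrite scalerDr cD rmorphD scalerDl.
      * by rewrite cD rmorphD scalerDl.
      * by rewrite cn_r !counit_cn linearZ lscaleA mulrC.
  apply: cn_ext => [x y|//|g x]; first exact: (swD hL b).
  rewrite (sw_cn _ _ b); under eq_bigr do rewrite counit_cn cn_l.
  by rewrite -(addmap_sum _ _ (cnDl x)) -cobasis_sum.
- have b : bal2 S (fun c1 c2 : K => r2 (counit c2) *: c1).
    split=> [m m' z|m z z'|a m z].
    + by rewrite scalerDr.
    + by rewrite cD rmorphD scalerDl.
    + move: z; apply: cn_ext => [x y|x y|g x].
      * by rewrite cD rmorphD scalerDl.
      * by rewrite scalerDr cD rmorphD scalerDl.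
      * by rewrite cn_l !counit_cn rscaleA mulrC.
  apply: cn_ext => [x y|//|g x]; first exact: (swD hL b).
  rewrite (sw_cn _ _ b); under eq_bigr do rewrite counit_cn cn_r.
  by rewrite -(addmap_sum _ _ (cnDr g)) -ef.
Qed.

Section CanLift.
Variables (P : zmodType) (b : dual I -> I -> P).

Definition can_lift (x : K) : P := tlift b (x : tens i i (dual I) I).
Hypothesis bb : balanced i i b.

Lemma can_liftE g x : can_lift (cn g x) = b g x.
Proof. exact: (tlift_pure bb). Qed.
Lemma can_liftD : addmap can_lift.
Proof. exact: (tliftD bb). Qed.

End CanLift.
End Can.

Section DualTens.
Variables (A B C : comPzRingType).
Variables (f : {rmorphism A -> B}) (g : {rmorphism A -> C}).
Variables (M : lmodType B) (N : lmodType C).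

Lemma dual_tens_ext (u v : dual (tens f g M N)) :
  (forall m n, u (tpure f g m n) = v (tpure f g m n)) -> u = v.
Proof.
move=> e; apply: dual_ext; apply: tens_ext => // x y; exact: linearD.
Qed.

Lemma dual_tensDl (v : dual N) : addmap (fun u : dual M => dual_tens f g u v).
Proof.
move=> u u'; apply: dual_tens_ext => m n.
transitivity (dual_tens f g u v (tpure f g m n) + dual_tens f g u' v (tpure f g m n) :
    tensR f g) => //.
by rewrite !dual_tensE -rpureDl.
Qed.

Lemma dual_tensDr (u : dual M) : addmap (fun v : dual N => dual_tens f g u v).
Proof.
move=> v v'; apply: dual_tens_ext => m n.
transitivity (dual_tens f g u v (tpure f g m n) + dual_tens f g u v' (tpure f g m n) :
    tensR f g) => //.
by rewrite !dual_tensE -rpureDr.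
Qed.

Lemma dual_tensZ b c (u : dual M) (v : dual N) :
  dual_tens f g (b *: u) (c *: v) = rpure f g b c *: dual_tens f g u v.
Proof.
apply: dual_tens_ext => m n.
transitivity (rpure f g b c * dual_tens f g u v (tpure f g m n) : tensR f g) => //.
by rewrite !dual_tensE rpureM.
Qed.

End DualTens.

(** * Can(I) (x) Can(J) is isomorphic to Can(I (x) J) *)

Section CanTens.
Variables (R : comPzRingType) (S T : ralg R).
Notation i := (ralg_str S).
Notation j := (ralg_str T).
Notation ST := (ralg_tens S T).
Notation st := (rpure i j).
Variables (I : lmodType S) (n : nat) (e : 'I_n -> I) (f : 'I_n -> dual I).
Variables (J : lmodType T) (n' : nat) (e' : 'I_n' -> J) (f' : 'I_n' -> dual J).
Hypotheses (ef : dual_basis e f) (ef' : dual_basis e' f').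
Notation IJ := (tensM I J : lmodType ST).
Notation dt := (dual_tens i j (M := I) (N := J)).
Notation xy := (tpure i j (M := I) (N := J)).
Notation cnI := (cn e f).
Notation cnJ := (cn e' f').

(** With the products of the two given dual bases, the coproduct of Can(I (x) J) is term by term
    that of Can(I) (x) Can(J). *)
Definition tens_basis_seq : seq (IJ * dual IJ) :=
  [seq (xy (e a) (e' b), dt (f a) (f' b)) | a <- enum 'I_n, b <- enum 'I_n'].

Notation eL := (lbasis (L := tens_basis_seq)).
Notation fL := (lcobasis (L := tens_basis_seq)).

Lemma tens_basis_sum (P : zmodType) (F : IJ -> dual IJ -> P) :
  \sum_k F (eL k) (fL k) = \sum_a \sum_b F (xy (e a) (e' b)) (dt (f a) (f' b)).
Proof.
rewrite lbasis_sum big_allpairs_dep big_enum; apply: eq_bigr => a _.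
by rewrite big_enum.
Qed.

Lemma tens_dual_basis : dual_basis eL fL.
Proof.
move=> z; rewrite (tens_basis_sum (fun y g => (g z : ST) *: y)).
move: z; apply: tens_ext => [//|z z'|x y].
- rewrite -big_split; apply: eq_bigr => a _; rewrite -big_split; apply: eq_bigr => b _.
  by rewrite linearD scalerDl.
- rewrite {1}(ef x) {1}(ef' y) tpure_suml; apply: eq_bigr => a _.
  rewrite tpure_sumr; apply: eq_bigr => b _; rewrite -scale_rpure.
  by congr (_ *: _); rewrite dual_tensE.
Qed.

Notation K := (can eL fL).
Notation cnK := (cn eL fL).
Notation CC := (coring_tens (can e f) (can e' f')).
Notation cp := (@coring_tens_pure R S T (can e f) (can e' f')).

Definition cn_tens (g : dual I) (x : I) (h : dual J) (y : J) : K := cnK (dt g h) (xy x y).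

Lemma st_str_l r : st (i r) 1 = ralg_str ST r. Proof. by []. Qed.
Lemma st_str_r r : st 1 (j r) = ralg_str ST r. Proof. by symmetry; apply: tinlr. Qed.

Lemma cn_tens_bal1 h y : balanced i i (fun g x => cn_tens g x h y).
Proof.
split=> [m m' x|m x x'|r m x]; rewrite /cn_tens.
- by rewrite dual_tensDl cnDl.
- by rewrite tpureDl cnDr.
- rewrite -[h in LHS]scale1r dual_tensZ -[y in RHS]scale1r -scale_rpure st_str_l.
  by rewrite cnZ.
Qed.

Lemma cn_tens_bal2 g x : balanced j j (fun h y => cn_tens g x h y).
Proof.
split=> [m m' z|m z z'|r m z]; rewrite /cn_tens.
- by rewrite dual_tensDr cnDl.
- by rewrite tpureDr cnDr.
- rewrite -[g in LHS]scale1r dual_tensZ -[x in RHS]scale1r -scale_rpure st_str_r.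
  by rewrite cnZ.
Qed.

Definition canmap0 (u : can e f) (v : can e' f') : K :=
  can_lift (fun g x => can_lift (fun h y => cn_tens g x h y) v) u.

Lemma canmap0E g x h y : canmap0 (cnI g x) (cnJ h y) = cn_tens g x h y.
Proof.
have b : balanced i i (fun g x => can_lift (fun h y => cn_tens g x h y) (cnJ h y)).
  by apply: bal_param => h' y'; apply: cn_tens_bal1.
by rewrite [LHS](can_liftE e f b) (can_liftE e' f' (cn_tens_bal2 g x)).
Qed.

Lemma canmap0Dl v : addmap (canmap0^~ v).
Proof. by apply: (@can_liftD _ _ _ _ e f); apply: bal_param => h' y';
    apply: cn_tens_bal1. Qed.
Lemma canmap0Dr u : addmap (canmap0 u).
Proof. by move=> v v'; apply: tlift_split => g x;
    apply: (can_liftD (cn_tens_bal2 g x)). Qed.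

Lemma canmap0_bal : balanced (str2 S) (str2 T) canmap0.
Proof.
apply: bal_str => [v|u|r u v]; [exact: canmap0Dl|exact: canmap0Dr|].
move: u; apply: cn_ext => [u u'|u u'|g x].
- by rewrite scalerDr canmap0Dl.
- by rewrite canmap0Dl.
move: v; apply: cn_ext => [v v'|v v'|h y].
- by rewrite canmap0Dr.
- by rewrite scalerDr canmap0Dr.
rewrite !cn_l !canmap0E /cn_tens -[h in LHS]scale1r -[g in RHS]scale1r !dual_tensZ.
by rewrite st_str_l st_str_r.
Qed.

Definition canmap : CC -> K := cp_lift canmap0.

Lemma canmapE g x h y : canmap (cp (cnI g x) (cnJ h y)) = cn_tens g x h y.
Proof. by rewrite [LHS](cp_liftE canmap0_bal) canmap0E. Qed.
Lemma canmapD : addmap canmap.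
Proof. exact: (cp_liftD canmap0_bal). Qed.

(** A functional [k] on I (x) J need not be a pure tensor. It is first expanded as the sum of k(e_a
    (x) e'_b) times f_a (x) f'_b, and the factors of each term are then separated. *)
Definition caninv1 (k : dual IJ) (x : I) (y : J) : CC :=
  \sum_a \sum_b left2 ST (k (xy (e a) (e' b))) *: cp (cnI (f a) x) (cnJ (f' b) y).

Definition caninv0 (k : dual IJ) (z : IJ) : CC := tlift (caninv1 k) (z : tens i j I J).

Lemma caninv1_bal k : balanced i j (caninv1 k).
Proof.
split=> [m m' x|m x x'|r m x].
- rewrite -big_split; apply: eq_bigr => a _; rewrite -big_split; apply: eq_bigr => b _.
  by rewrite cnDr cpDl scalerDr.
- rewrite -big_split; apply: eq_bigr => a _; rewrite -big_split; apply: eq_bigr => b _.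
  by rewrite cnDr cpDr scalerDr.
- apply: eq_bigr => a _; apply: eq_bigr => b _; congr (_ *: _).
  by rewrite -!cnZ -!cn_l; apply: (balZ (cp_bal_pure (can e f) (can e' f')) r).
Qed.

Lemma caninv0E k x y : caninv0 k (xy x y) = caninv1 k x y.
Proof. exact: (tlift_pure (caninv1_bal k)). Qed.

Lemma caninv0_bal : balanced (ralg_str ST) (ralg_str ST) caninv0.
Proof.
split=> [k k' z|k z z'|r k z].
- apply: tlift_split => x y.
  rewrite -big_split; apply: eq_bigr => a _; rewrite -big_split; apply: eq_bigr => b _.
  by rewrite /= -scalerDl -rmorphD.
- exact: (tliftD (caninv1_bal k)).
move: z; apply: (@tens_ext _ _ _ _ _ _ _ _ (fun z : IJ => caninv0 (ralg_str ST r *: k) z)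
  (fun z : IJ => caninv0 k (ralg_str ST r *: z))) => [z z'|z z'|x y].
- exact: (tliftD (caninv1_bal _)).
- by rewrite scalerDr /caninv0 (tliftD (caninv1_bal k)).
rewrite -[ralg_str ST r]/(st (i r) 1) [X in caninv0 k X]scale_rpure !caninv0E scale1r.
apply: eq_bigr => a _; apply: eq_bigr => b _.
rewrite -[(_ *: k) _]/(st (i r) 1 * k (xy (e a) (e' b))) mulrC -lscaleA; congr (_ *: _).
by rewrite cp_l rmorph1 scale1r cn_l cnZ.
Qed.

Definition caninv : K -> CC := can_lift caninv0.

Lemma caninvE k x y : caninv (cnK k (xy x y)) = caninv1 k x y.
Proof. by rewrite [LHS](can_liftE eL fL caninv0_bal) caninv0E. Qed.
Lemma caninvD : addmap caninv.
Proof. exact: (can_liftD caninv0_bal). Qed.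

Lemma canmap_l s t u v :
  canmap (cp (left2 S s *: u) (left2 T t *: v)) = left2 ST (st s t) *: canmap (cp u v).
Proof.
move: u; apply: cn_ext => [u u'|u u'|g x].
- by rewrite scalerDr cpDl canmapD.
- by rewrite cpDl canmapD scalerDr.
move: v; apply: cn_ext => [v v'|v v'|h y].
- by rewrite scalerDr cpDr canmapD.
- by rewrite cpDr canmapD scalerDr.
by rewrite !cn_l !canmapE /cn_tens dual_tensZ cn_l.
Qed.

Lemma canmap_r s t u v :
  canmap (cp (right2 S s *: u) (right2 T t *: v)) = right2 ST (st s t) *: canmap (cp u v).
Proof.
move: u; apply: cn_ext => [u u'|u u'|g x].
- by rewrite scalerDr cpDl canmapD.
- by rewrite cpDl canmapD scalerDr.
move: v; apply: cn_ext => [v v'|v v'|h y].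
- by rewrite scalerDr cpDr canmapD.
- by rewrite cpDr canmapD scalerDr.
by rewrite !cn_r !canmapE /cn_tens -scale_rpure cn_r.
Qed.

Lemma canmap_lST x u : canmap (left2 ST x *: u) = left2 ST x *: canmap u.
Proof.
by apply: (cp_semilinear canmapD) => {x u} s t u v; rewrite cp_l canmap_l.
Qed.

Lemma canmap_rST x u : canmap (right2 ST x *: u) = right2 ST x *: canmap u.
Proof.
by apply: (cp_semilinear canmapD) => {x u} s t u v; rewrite cp_r canmap_r.
Qed.

Lemma canmapK : cancel canmap caninv.
Proof.
apply: cp_ext => [x y|//|u v]; first by rewrite canmapD caninvD.
move: u; apply: cn_ext => [u u'|u u'|g x].
- by rewrite cpDl canmapD caninvD.
- by rewrite cpDl.
move: v; apply: cn_ext => [v v'|v v'|h y].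
- by rewrite cpDr canmapD caninvD.
- by rewrite cpDr.
rewrite canmapE /cn_tens caninvE /caninv1 [in RHS](cobasis_sum ef g) [in RHS](cobasis_sum
    ef' h).
rewrite (addmap_sum _ _ (cnDl e f x)) (addmap_sum _ _ (cnDl e' f' y)).
rewrite (addmap_sum _ _ (cpDl _)); apply: eq_bigr => a _.
rewrite (addmap_sum _ _ (cpDr _)); apply: eq_bigr => b _.
by rewrite -!cn_l -cp_l; congr (left2 ST _ *: _); rewrite dual_tensE.
Qed.

Lemma caninvK : cancel caninv canmap.
Proof.
apply: cn_ext => [x y|//|k z]; first by rewrite caninvD canmapD.
move: z; apply: (@tens_ext _ _ _ _ _ _ _ _ (fun z : IJ => canmap (caninv (cnK k z)))
  (fun z : IJ => cnK k z)) => [z z'|z z'|x y].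
- by rewrite cnDr caninvD canmapD.
- by rewrite cnDr.
rewrite caninvE /caninv1 (addmap_sum _ _ canmapD).
transitivity (cnK (\sum_a \sum_b k (xy (e a) (e' b)) *: dt (f a) (f' b)) (xy x y)).
  rewrite (addmap_sum _ _ (cnDl _ _ _)); apply: eq_bigr => a _.
  rewrite (addmap_sum _ _ canmapD) (addmap_sum _ _ (cnDl _ _ _)); apply: eq_bigr => b _.
  by rewrite canmap_lST canmapE /cn_tens cn_l.
congr (cnK _ _); rewrite [RHS](cobasis_sum tens_dual_basis k).
by rewrite (tens_basis_sum (fun y g => (k y : ST) *: g)).
Qed.

Lemma canmap_iso : coring_iso (C := CC) (D := K) idfun canmap.
Proof.
have hI := can_is_coring ef; have hJ := can_is_coring ef'.
have hK := can_is_coring tens_dual_basis.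
apply: cp_isoI => //.
- by exists id.
- exact: canmapD.
- by exists caninv; [exact: canmapK|exact: caninvK].
- by move=> s t u v; rewrite canmap_l.
- by move=> s t u v; rewrite canmap_r.
have tb := iso_bal (C := CC) (D := K) (f := idfun) canmapD canmap_lST canmap_rST
    (tpure_balanced (right2 ST) (left2 ST) K K).
have bI d1 d2 := bal_cpl d1 d2 tb; have bJ c1 c2 := bal_cpr c1 c2 tb.
have bP d : bal2 S (fun c1 c2 => sw (fun d1 d2 =>
    tpure (right2 ST) (left2 ST) (canmap (cp c1 d1)) (canmap (cp c2 d2))) d).
  by apply: bal_param => d1 d2; apply: bI.
move=> u v; move: u; apply: cn_ext => [u u'|u u'|g x].
- by rewrite cpDl canmapD (comulD (comul_linear hK)).
- by rewrite (swD (comul_linear hI) (bP v)).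
move: v; apply: cn_ext => [v v'|v v'|h y].
- by rewrite cpDr canmapD (comulD (comul_linear hK)).
- apply: tlift_split => c1 c2; exact: (swD (comul_linear hJ) (bJ c1 c2)).
rewrite (sw_cn _ _ (bP _)) canmapE comul_cn.
rewrite (tens_basis_sum (fun z k => tpure (right2 ST) (left2 ST) (cnK (dt g h) z) (cnK k
    (xy x y)))).
apply: eq_bigr => a _; rewrite (sw_cn _ _ (bJ _ _)); apply: eq_bigr => b _.
by rewrite !canmapE.
Qed.

End CanTens.

(** * The unit coring is elementary up to isomorphism *)

Section CanUnit.
Variable R : comPzRingType.
Notation S := (ralg_id R).
Notation U := (ccoring (cpair_unit R)).

Lemma dual_id_linear : linear (fun x : R^o => x : R^o).
Proof. by []. Qed.
Definition dual_id : dual (R^o : lmodType S) := dual_mk dual_id_linear.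

Definition ebase1 (k : 'I_1) : (R^o : lmodType S) := (1 : R).
Definition cobase1 (k : 'I_1) : dual (R^o : lmodType S) := dual_id.

Lemma dual_basis1 : dual_basis ebase1 cobase1.
Proof. by move=> x; rewrite big_ord1 /GRing.scale /= mulr1. Qed.

Notation K := (can ebase1 cobase1).
Notation cnK := (cn ebase1 cobase1).

Lemma invertible1 : invertible (R^o : lmodType S).
Proof.
apply/invertibleP; exists (R^o : lmodType S), (fun x y => (x : R) * (y : R)), [:: ((1 :
    R), (1 : R))].
split.
- split=> [m m' n|m n n'|a m n]; rewrite ?mulrDl ?mulrDr //.
  by rewrite /GRing.scale /= mulrCA mulrA.
- by move=> a x n; rewrite /GRing.scale /= mulrA.
- by rewrite big_seq1 /= mulr1.
- move=> x y; rewrite big_seq1 /=.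
  have -> : (x : R) * y *: (1 : R^o) = (y : R) *: (x :
      R^o) by rewrite /GRing.scale /= mulr1 mulrC.
  have := tpureZ (idfun : {rmorphism S -> S}) (idfun : {rmorphism S -> S}) (y : S) (x :
      R^o) (1 : R^o).
  move=> ->; congr (tpure _ _ _ _); by rewrite /GRing.scale /= mulr1.
Qed.

Definition ucan (r : U) : K := cnK dual_id (r : R).

Lemma ucanD : addmap ucan. Proof. exact: cnDr. Qed.

Lemma cn_str r g (x : R^o) : cnK ((r : R) *: g) x = cnK g ((r : R) *: x).
Proof. exact: (@cnZ _ S _ _ ebase1 cobase1 r g x). Qed.

Lemma dual_id_gen (g : dual (R^o : lmodType S)) : g = (g 1 : R) *: dual_id.
Proof.
apply: dual_ext => x; rewrite -[RHS]/((g 1 : R) * x) mulrC.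
transitivity (g ((x : R) *: (1 : R^o))); last exact: (linearZ_LR g x (1 : R^o)).
by congr (g _); rewrite /GRing.scale /= mulr1.
Qed.

Lemma ucan_iso : coring_iso (C := U) (D := K) idfun ucan.
Proof.
split.
- by exists id.
- by [].
- exact: ucanD.
- have b := @counit_can_bal _ S (R^o).
  exists (can_lift (fun (g : dual (R^o : lmodType S)) x => g x : R) : K -> U).
    by move=> r; rewrite /ucan [LHS](can_liftE ebase1 cobase1 b).
  apply: cn_ext => [x y|//|g x].
    by rewrite (can_liftD b) ucanD.
  rewrite (can_liftE ebase1 cobase1 b) /ucan [in RHS](dual_id_gen g) cn_str;
      congr (cnK _ _).
  transitivity (g ((x : R) *: (1 : R^o))); first by congr (g _);
      rewrite /GRing.scale /= mulr1.
  rewrite (linearZ_LR g x (1 : R^o)); exact: mulrC.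
- by move=> s r; rewrite unit_l /ucan cn_l cn_str.
- by move=> s r; rewrite unit_r /ucan cn_r.
- move=> r; rewrite unit_sw; last first.
    split=> [m m' n|m n n'|a m n].
    + by rewrite ucanD tpureDl.
    + by rewrite ucanD tpureDr.
    + rewrite unit_r unit_l /ucan -[u_of (a * m)]/((a : R) *: (m :
        R^o)) -[u_of (a * n)]/((a : R) *: (n : R^o)).
      by rewrite -[X in tpure _ _ X _](cn_r ebase1 cobase1 (a : S)) tpureZ cn_l cn_str.
  rewrite /ucan comul_cn big_ord1 /ebase1 /cobase1 /u_of.
  have e : cnK dual_id r = left2 S r *: cnK dual_id (1 : R).
    by rewrite cn_l cn_str; congr (cnK _ _); rewrite /GRing.scale /= mulr1.
  rewrite [X in tpure _ _ _ X = _]e -tpureZ cn_r; congr (tpure _ _ (cnK _ _) _).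
  by rewrite /GRing.scale /= mulr1.
Qed.

End CanUnit.

(** * The inverse of an Azumaya coring *)

Section Cop.
Variables (R : comPzRingType) (S : ralg R) (C : coring_data S).
Notation i := (ralg_str S).
Notation l2 := (left2 S).
Notation r2 := (right2 S).
Implicit Types (P : zmodType).

Lemma flip_agree r : r2 (i r) = l2 (i r).
Proof. by rewrite lr_str. Qed.

Definition flip2 : {rmorphism tens2 S -> tens2 S} := rlift flip_agree.

Lemma flip_l s : flip2 (l2 s) = r2 s. Proof. exact: rlift_inl. Qed.
Lemma flip_r s : flip2 (r2 s) = l2 s. Proof. exact: rlift_inr. Qed.
Lemma flipK : involutive flip2.
Proof.
elim/tens2_ind=> [|x y IHx IHy|s t]; first by rewrite !rmorph0.
  by rewrite !rmorphD IHx IHy.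
by rewrite !rmorphM flip_l flip_r flip_r flip_l.
Qed.

Definition cop_mod : lmodType (tens2 S) := restr flip2 C.

Definition cop : coring_data S :=
  @CoringData R S cop_mod
    (fun c => sw (fun a b : C => tpure r2 l2 (b : cop_mod) (a : cop_mod)) (c : C))
    (fun c => counit (c : C)).

Lemma cop_scale a (c : C) : a *: (c : cop) = flip2 a *: c.
Proof. by []. Qed.
Lemma cop_l s (c : C) : l2 s *: (c : cop) = r2 s *: c.
Proof. by rewrite cop_scale flip_l. Qed.
Lemma cop_r s (c : C) : r2 s *: (c : cop) = l2 s *: c.
Proof. by rewrite cop_scale flip_r. Qed.

Lemma bal_cop P (b : cop -> cop -> P) : bal2 S b -> bal2 S (fun x y : C => b y x).
Proof.
move=> bb; split=> [m m' n|m n n'|a m n]; [exact: (balDr bb)|exact: (balDl bb)|].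
by have := balZ bb a n m; rewrite cop_l cop_r => ->.
Qed.

Lemma cop_bal P (b : C -> C -> P) : bal2 S b -> bal2 S (fun x y : cop => b y x).
Proof.
move=> bb; split=> [m m' n|m n n'|a m n]; [exact: (balDr bb)|exact: (balDl bb)|].
by rewrite cop_l cop_r (balZ bb).
Qed.

Lemma sw_cop P (b : cop -> cop -> P) (c : C) : bal2 S b ->
  sw (C := cop) b c = sw (fun x y : C => b y x) c.
Proof.
move=> bb; rewrite {1}/sw /= (addmap_sw _ _ (tliftD bb)).
by apply: sw_ext => x y; rewrite (tlift_pure bb).
Qed.

Hypothesis hC : is_coring C.
Let hL := comul_linear hC.

Lemma cop_tpure_bal : bal2 S (fun x y : C => tpure r2 l2 (y : cop) (x : cop)).
Proof. exact: (bal_cop (tpure_balanced r2 l2 cop cop)). Qed.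

Lemma cop_linear : linear (comul (c := cop) : cop -> tensS_bimod cop cop).
Proof.
have cD : addmap (comul (c := cop) : cop -> tensS_bimod cop cop).
  exact: (swD hL cop_tpure_bal).
move=> a x y; rewrite cD; congr (_ + _).
elim/tens2_ind: a x => [|a b IHa IHb|s t] x.
- by rewrite !scale0r (addmap0 cD).
- by rewrite !scalerDl cD IHa IHb.
have el z : comul (c := cop) (l2 s *: (z : cop)) = l2 s *: (comul (c := cop) z :
    tensS_bimod cop cop).
  rewrite cop_l [LHS](sw_r hL _ _ cop_tpure_bal).
  rewrite [RHS](addmap_sw (h := fun x : tensS_bimod cop cop => l2 s *: x));
      last exact: scaler_addmap.
  by apply: sw_ext => p q; rewrite tensS_l cop_l.
have er z : comul (c := cop) (r2 t *: (z : cop)) = r2 t *: (comul (c := cop) z :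
    tensS_bimod cop cop).
  rewrite cop_r [LHS](sw_l hL _ _ cop_tpure_bal).
  rewrite [RHS](addmap_sw (h := fun x : tensS_bimod cop cop => r2 t *: x));
      last exact: scaler_addmap.
  by apply: sw_ext => p q; rewrite tensS_r cop_r.
by rewrite -!scalerA el er.
Qed.

Lemma cop_is_coring : is_coring cop.
Proof.
have tT := @trilin_tpure _ _ cop.
have cL := cop_linear.
apply: is_coringI => //.
- move=> a x y; rewrite (counitD hC); congr (_ + _).
  rewrite cop_scale (counitZ hC) -[RHS]/(mul2 S a * counit (x : C)); congr (_ * _).
  elim/tens2_ind: a => [|a b IHa IHb|s t].
  + by rewrite !rmorph0.
  + by rewrite !rmorphD IHa IHb.
  + rewrite !rmorphM flip_l flip_r [mul2 S (r2 s)]rlift_inr [mul2 S (l2 t)]rlift_inl.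
    by rewrite [mul2 S (l2 s)]rlift_inl [mul2 S (r2 t)]rlift_inr.
- move=> c; rewrite (sw_cop _ (trilin_sw1 cL tT)) (sw_cop _ (trilin_sw2 cL tT)).
  (* Reading the triple tensors backwards turns the claim into coassociativity of [C], used from
     right to left. *)
  have tT' : trilin (fun p q r : C => tpure r2 l2 (r : cop) (tpure r2 l2 (q : cop) (p :
      cop) : tensS_bimod cop cop)).
    by split=> x; [exact: (bal_cop (tri23 tT x))|exact: (bal_cop (tri12 tT x))].
  transitivity (sw (fun x y : C => sw (fun p q : C => tpure r2 l2 (q :
      cop) (tpure r2 l2 (p : cop) (x : cop) : tensS_bimod cop cop)) y) c).
    by apply: sw_ext => x y; rewrite sw_cop //; exact: (tri12 tT).
  rewrite -(sw_assoc hC c tT'); apply: sw_ext => x y.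
  by rewrite sw_cop //; exact: (tri23 tT).
- move=> c; rewrite sw_cop.
    rewrite -[RHS](sw_counitr hC (q := id) c) //; apply: sw_ext => x y.
    by rewrite cop_l.
  split=> [m m' n|m n n'|a m n].
  + by rewrite [counit _](counitD hC) rmorphD scalerDl.
  + by rewrite scalerDr.
  + by rewrite cop_r !cop_l [counit _](counit_ls hC) rscaleA mulrC.
- move=> c; rewrite sw_cop.
    rewrite -[RHS](sw_counitl hC (q := id) c) //; apply: sw_ext => x y.
    by rewrite cop_r.
  split=> [m m' n|m n n'|a m n].
  + by rewrite scalerDr.
  + by rewrite [counit _](counitD hC) rmorphD scalerDl.
  + have e : counit (n : C) * a = counit (r2 a *: (n :
      C)) by rewrite (counit_rs hC) mulrC.
    rewrite cop_l !cop_r.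
    exact: (etrans (lscaleA _ _ _) (congr1 (fun t => l2 t *: (m : C)) e)).
Qed.

Variable G : tensS C C -> cS C.
Hypotheses (FK : cancel (coF (C := C)) G) (GK : cancel G (coF (C := C))).

Definition copk (z : C) (s : S) : cS cop := cpure (z : cop) s.

Lemma copk_bal : balS S (fun (z : C) (s : S^o) => copk z s).
Proof.
split=> [z z' s|z s s'|a z s].
- exact: tpureDl.
- exact: tpureDr.
- rewrite -[str2 S a]/(l2 (i a)) lr_str -cop_l /copk.
  exact: (tpureZ (str2 S) i a (z : cop) (s : S^o)).
Qed.

(** The middle scalar may sit on either side of the inner tensor sign, so [G] with its arguments
    exchanged inverts [coF] for [cop]. *)
Lemma cop_coF_bij : bijective (coF (C := cop)).
Proof.
have hcop := cop_is_coring.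
have bG : bal2 S (fun a b : cop => gg G copk (b : C) (a : C)).
  exact: (cop_bal (gg_bal hC FK GK copk_bal)).
exists (tlift (fun a b : cop => gg G copk (b : C) (a : C))).
- elim/tens_ind=> [|x y IHx IHy|c s].
  + by rewrite (addmap0 (coFD hcop)) (addmap0 (tliftD bG)).
  + by rewrite (coFD hcop) (tliftD bG) IHx IHy.
  rewrite -[tpure _ _ _ _]/(cpure (c : cop) s) (coF_pure hcop) sw_cop;
      last exact: (@coF_bal0 _ _ cop).
  rewrite (addmap_sw _ _ (tliftD bG)) -[RHS]/(copk c s) -(gg_sw hC FK GK copk_bal).
  apply: sw_ext => x y; rewrite (tlift_pure bG) cop_r.
  by rewrite (balZ (gg_bal hC FK GK copk_bal)).
- elim/tens_ind=> [|x y IHx IHy|x y].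
  + by rewrite (addmap0 (tliftD bG)) (addmap0 (coFD hcop)).
  + by rewrite (tliftD bG) (coFD hcop) IHx IHy.
  rewrite (tlift_pure bG) (addmap_gg _ _ _ (coFD hcop)).
  rewrite -(sw_gg hC GK _ _ cop_tpure_bal); apply: gg_ext => z s.
  rewrite (coF_pure hcop) sw_cop; last exact: (@coF_bal0 _ _ cop).
  by apply: sw_ext => p q; rewrite cop_r (balZ cop_tpure_bal).
Qed.

End Cop.

Lemma azumaya_over_cop (R : comPzRingType) (S : ralg R) (C : coring_data S) :
  azumaya_over C -> azumaya_over (cop C).
Proof.
move=> /azumaya_overP [hC pC [G FK GK]]; apply/azumaya_overP; split.
- exact: cop_is_coring.
- exact: (@faithfully_projective_transfer _ _ (flip2 S) (flip2 S) C (cop C) id id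
    (@flipK _ S) (@flipK _ S)).
- exact: (cop_coF_bij hC FK GK).
Qed.

(** * The duality between C_12 and C_21 *)

Section Inverse.
Variables (R : comPzRingType) (S : ralg R) (C : coring_data S).
Notation i := (ralg_str S).
Notation l2 := (left2 S).
Notation r2 := (right2 S).
Notation st := (rpure i i).
Notation flip := (flip2 S).
Implicit Types (P : zmodType).

Hypothesis hC : is_coring C.
Let hL := comul_linear hC.
Variable G : tensS C C -> cS C.
Hypotheses (FK : cancel (coF (C := C)) G) (GK : cancel G (coF (C := C))).

Notation gb := (gg_bal hC FK GK).

(* The composition C_12 (x) C_21 -> C_11 (x) S_2 followed by the counit of C_11. *)
Definition hk (z : C) (s : S) : tens2 S := st (counit z) s.
Definition hh (c d : C) : tens2 S := gg G hk c d.

Lemma hk_bal : balS S (fun z (s : S^o) => hk z s).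
Proof.
split=> [z z' s|z s s'|a z s].
- by rewrite /hk (counitD hC) rpureDl.
- exact: rpureDr.
- rewrite /hk -[str2 S a]/(l2 (i a)) (counit_ls hC).
  exact: (tpureZ i i a (counit z : S^o) (s : S^o)).
Qed.

Lemma hh_bal : bal2 S hh. Proof. exact: gb hk_bal. Qed.

Lemma hh_l s c d : hh (l2 s *: c) d = l2 s * hh c d.
Proof.
rewrite /hh (gg_l hC FK GK hk_bal) (addmap_gg (h := *%R (l2 s))).
  apply: gg_ext => z t; rewrite /hk (counit_ls hC).
  by rewrite rpureM mul1r.
by move=> x y; rewrite mulrDr.
Qed.

Lemma hh_m s c d : hh (r2 s *: c) d = r2 s * hh c d.
Proof.
rewrite /hh (gg_m hC FK GK hk_bal) (addmap_gg (h := *%R (r2 s))).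
  by apply: gg_ext => z t; rewrite [RHS]rpureM mul1r.
by move=> x y; rewrite mulrDr.
Qed.

(** The counit identifies the two ends of [z], so the right end of [d] is the same position as the
    left end of [c]. *)
Lemma hh_r s c d : hh c (r2 s *: d) = l2 s * hh c d.
Proof.
rewrite /hh (gg_r hC FK GK hk_bal) (addmap_gg (h := *%R (l2 s))).
  apply: gg_ext => z t; rewrite /hk (counit_rs hC).
  by rewrite rpureM mul1r.
by move=> x y; rewrite mulrDr.
Qed.

Lemma hh_m' s c d : hh c (l2 s *: d) = r2 s * hh c d.
Proof. by rewrite -hh_m (balZ hh_bal). Qed.

Lemma hh_Z a c d : hh (a *: c) d = a * hh c d.
Proof.
elim/tens2_ind: a => [|a b IHa IHb|s t].
- by rewrite scale0r mul0r /hh (addmap0 (gg_Dl hC FK GK hk_bal d)).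
- by rewrite scalerDl (balDl hh_bal) IHa IHb mulrDl.
- by rewrite -scalerA hh_l hh_m mulrA.
Qed.

Lemma hh_Zr a c d : hh c (flip a *: d) = a * hh c d.
Proof.
elim/tens2_ind: a => [|a b IHa IHb|s t].
- by rewrite rmorph0 scale0r mul0r /hh (addmap0 (gg_Dr hC FK GK hk_bal c)).
- by rewrite rmorphD scalerDl (balDr hh_bal) IHa IHb mulrDl.
- by rewrite rmorphM flip_l flip_r -scalerA hh_r hh_m' mulrA.
Qed.

Lemma sw_hh s z : sw (fun a b => hh (r2 s *: a) b) z = st (counit z) s.
Proof. exact: (gg_sw hC FK GK hk_bal). Qed.

Lemma rcounit_bal P (q : C -> P) : addmap q ->
  bal2 S (fun x y : C => q (r2 (counit y) *: x)).
Proof.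
move=> qD; split=> [m m' n|m n n'|a m n].
- by rewrite scalerDr qD.
- by rewrite (counitD hC) rmorphD scalerDl qD.
- by rewrite (counit_ls hC) rscaleA mulrC.
Qed.

Lemma lcounit_bal P (q : C -> P) : addmap q ->
  bal2 S (fun x y : C => q (l2 (counit x) *: y)).
Proof.
move=> qD; split=> [m m' n|m n n'|a m n].
- by rewrite (counitD hC) rmorphD scalerDl qD.
- by rewrite scalerDr qD.
- by rewrite (counit_rs hC) lscaleA mulrC.
Qed.

(** Apply id (x) counit to the expression of c (x) d as a sum of w_(1) s (x) w_(2). For
    [counit_gg_l] it is counit (x) id. *)
Lemma counit_gg_r P (q : C -> P) c d : addmap q ->
  gg G (fun w s => q (r2 s *: w)) c d = q (r2 (counit d) *: c).
Proof.
move=> qD; rewrite -(sw_gg hC GK _ _ (rcounit_bal qD)); apply: gg_ext => w s.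
rewrite -(sw_counitr hC (q := fun w => q (r2 s *: w))); last first.
  by move=> x y; rewrite scalerDr qD.
by apply: sw_ext => a b; rewrite !rscaleA mulrC.
Qed.

Lemma counit_gg_l P (q : C -> P) c d : addmap q ->
  gg G (fun w s => q (l2 s *: w)) c d = q (l2 (counit c) *: d).
Proof.
move=> qD; rewrite -(sw_gg hC GK _ _ (lcounit_bal qD)); apply: gg_ext => w s.
rewrite -(sw_counitl hC (q := fun w => q (l2 s *: w))); last first.
  by move=> x y; rewrite scalerDr qD.
by apply: sw_ext => a b; rewrite (counit_rs hC) lscaleA.
Qed.

(** For a functional [g] and x in C, the image of g(x) in S under multiplication is a value of the
    counit, and 1 is a sum of such g(x). *)
Lemma exists_counit1 : faithfully_projective C -> exists u : C, counit u = 1.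
Proof.
move=> /faithfully_projectiveP [_ [t t1]].
(* The summand is not balanced, so this element depends on the representative of the coproduct; its
   counit does not. *)
exists (\sum_(p <- t) sw (fun a b => l2 (mul2 S (p.2 b)) *: a) p.1).
rewrite (addmap_sum _ _ (counitD hC)) -[RHS](rmorph1 (mul2 S)) t1 rmorph_sum.
apply: eq_bigr => p _; rewrite (addmap_sw _ _ (counitD hC)).
rewrite -(sw_counitl hC (q := fun x => mul2 S (p.2 x))); last first.
  by move=> x y; rewrite linearD rmorphD.
apply: sw_ext => a b; rewrite (counit_ls hC) linearZ.
transitivity (mul2 S (l2 (counit a) * p.2 b)) => //.
by rewrite rmorphM [mul2 S (l2 _)]rlift_inl mulrC.
Qed.

Variable u : C.
Hypothesis u1 : counit u = 1.

(* A map identifying the two S-actions factors through C_11, which the counit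
   maps isomorphically onto S. *)
Lemma trace_counit P (q : C -> P) z : addmap q ->
  (forall s c, q (l2 s *: c) = q (r2 s *: c)) -> q z = q (l2 (counit z) *: u).
Proof.
move=> qD qlr; rewrite -(counit_gg_l _ _ qD).
transitivity (gg G (fun w s => q (r2 s *: w)) z u); last by apply: gg_ext => w s;
    rewrite qlr.
by rewrite (counit_gg_r _ _ qD) u1 rmorph1 scale1r.
Qed.

(** The element that pairs to 1 is the coproduct of [u] with its legs exchanged: [hh] maps it to
    counit(u) (x) 1. *)
Lemma cop_pairing : perfect_pairing (I := cop C) (N := C) (fun d c => hh c d)
  [seq (p.2 : cop C, p.1) | p <- repr (comul u)].
Proof.
have hZr a c (d : cop C) : hh c (a *: d) = a * hh c (d : C) by apply: hh_Zr.
split.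
- split=> [m m' n|m n n'|a m n]; [exact: (balDr hh_bal)|exact: (balDl hh_bal)|].
  by rewrite hZr hh_Z.
- by move=> a d c; apply: hZr.
- rewrite big_map -[LHS]/(sw hh u) (gg_sw1 hC FK GK hk_bal) /hk u1.
  by [].
- move=> d c; rewrite big_map.
  (* [b] takes x (x) y to the product over S (x) S, where a scalar passes from [x] to [y] with its
     two ends flipped. *)
  pose b (x y : C) : tens idfun idfun (cop C) C := tpure idfun idfun (y : cop C) x.
  have tZ a x y : b (a *: x) y = b x (flip a *: y).
    exact: (esym (tpureZ (idfun : {rmorphism tens2 S -> tens2 S}) (idfun :
        {rmorphism tens2 S -> tens2 S}) a (y : cop C) x)).
  have bb : bal2 S b.
    split=> [m m' n|m n n'|a m n]; [exact: tpureDr|exact: tpureDl|].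
    by rewrite tZ flip_r.
  pose X (a : tens2 S) := sw (fun x y => b (a *: x) y) u.
  have XD : addmap X.
    by move=> a a'; apply: tlift_split => x y; rewrite scalerDl (balDl bb).
  transitivity (X (hh c d)); last first.
    by apply: eq_bigr => p _; rewrite tZ.
  rewrite -[LHS]/(b c d) -(sw_gg hC GK _ _ bb) /hh (addmap_gg _ _ _ XD).
  apply: gg_ext => z s.
  have bs := bal_scalel (r2 s) bb.
  (* With both ends tied together, the two actions of S on [z] have the same effect, so [z] may be
     replaced by counit(z) times [u]. *)
  rewrite (trace_counit (q := sw (fun x y => b (r2 s *: x) y)) z).
  + rewrite (sw_l hL _ _ bs) /hk /X; apply: sw_ext => x y.
    by rewrite rpure_lr mulrC scalerA.
  + exact: (swD hL bs).
  + move=> t x; rewrite (sw_l hL _ _ bs) (sw_r hL _ _ bs); apply: sw_ext => p q.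
    by rewrite lrC [LHS]tZ flip_l.
Qed.

Lemma hh_trilin1 : trilin (fun x a b => hh x a *: b).
Proof.
split=> c; split=> [m m' n|m n n'|s m n].
- by rewrite (balDl hh_bal) scalerDl.
- by rewrite (balDr hh_bal) scalerDl.
- by rewrite (balZ hh_bal).
- by rewrite (balDr hh_bal) scalerDl.
- by rewrite scalerDr.
- by rewrite hh_r scalerA mulrC.
Qed.

Lemma hh_trilin2 : trilin (fun a b y => flip (hh b y) *: a).
Proof.
split=> c; split=> [m m' n|m n n'|s m n].
- by rewrite scalerDr.
- by rewrite (balDl hh_bal) rmorphD scalerDl.
- by rewrite hh_l rmorphM flip_l scalerA mulrC.
- by rewrite (balDl hh_bal) rmorphD scalerDl.
- by rewrite (balDr hh_bal) rmorphD scalerDl.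
- by rewrite (balZ hh_bal).
Qed.

Lemma trilin_scale1 P (T : C -> C -> C -> P) a : trilin T ->
  trilin (fun x y z => T (a *: x) y z).
Proof.
by move=> tT; split=> c; [exact: (bal_scalel a (tri12 tT c))|exact: (tri23 tT)].
Qed.

Lemma trilin_scale2 P (T : C -> C -> C -> P) a : trilin T ->
  trilin (fun x y z => T x (a *: y) z).
Proof.
by move=> tT; split=> c; [exact: (bal_scaler a (tri12 tT c))|exact: (bal_scalel a (tri23
    tT c))].
Qed.

(** [hh_recl] and [hh_recr] are the triangle identities for the pairing [hh] and the element
    [comul u]. *)
Lemma hh_recl c : sw (fun a b => hh c a *: b) u = c.
Proof.
have tT := hh_trilin1.
have bb := trilin_sw2 hL tT.
have idD : addmap (fun x : C => x) by [].
transitivity (gg G (fun w s => r2 s *: w) c u); last first.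
  by rewrite (counit_gg_r c u idD) u1 rmorph1 scale1r.
(* Replace c (x) u by a sum of w_(1) s (x) w_(2). After reassociation the pairing meets the two legs
   of one coproduct, where [sw_hh] evaluates it. *)
rewrite -[LHS](sw_gg hC GK c u bb); apply: gg_ext => w s.
rewrite -(sw_assoc hC w (trilin_scale1 (r2 s) tT)).
rewrite -(sw_counitl hC (q := fun w => r2 s *: w)); last exact: scaler_addmap.
apply: sw_ext => w1 w2.
rewrite -(addmap_sw (h := fun t => t *: w2)); last by move=> x y; rewrite scalerDl.
by rewrite sw_hh rpure_lr mulrC scalerA.
Qed.

Lemma hh_recr d : sw (fun a b => flip (hh b d) *: a) u = d.
Proof.
have tT := hh_trilin2.
have bb := trilin_sw1 hL tT.
have idD : addmap (fun x : C => x) by [].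
transitivity (gg G (fun w s => l2 s *: w) u d); last first.
  by rewrite (counit_gg_l u d idD) u1 rmorph1 scale1r.
rewrite -[LHS](sw_gg hC GK u d bb); apply: gg_ext => w s.
transitivity (sw (fun w1 w2 => sw (fun a b => flip (hh (r2 s *: b) w2) *: a) w1) w).
  by apply: sw_ext => w1 w2; rewrite (sw_r hL _ _ (tri12 tT w2)).
rewrite (sw_assoc hC w (trilin_scale2 (r2 s) tT)).
rewrite -(sw_counitr hC (q := fun w => l2 s *: w)); last exact: scaler_addmap.
apply: sw_ext => w1 w2.
rewrite -(addmap_sw (h := fun t => flip t *: w1)); last by move=> x y;
    rewrite rmorphD scalerDl.
by rewrite sw_hh rpure_lr rmorphM flip_l flip_r mulrC scalerA.
Qed.

Notation SS := (ralg_tens S S).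
(** The ring of [ralg_tens S S] is [tens2 S], so C_21 is a module over this algebra as it stands. *)
Notation I := (cop_mod C : lmodType SS).

Lemma psi_linear (c : C) : linear (fun d : cop_mod C => hh c (d : C) : (tens2 S)^o).
Proof.
move=> a x y; rewrite (balDr hh_bal); congr (_ + _); exact: hh_Zr.
Qed.

Definition psi (c : C) : dual I := dual_mk (psi_linear c).

Lemma psiE c d : psi c d = hh c d. Proof. by []. Qed.

Lemma psiD : addmap psi.
Proof. by move=> x y; apply: dual_ext => d; apply: (balDl hh_bal). Qed.

Lemma psiZ (a : tens2 S) c : psi (a *: c) = (a : SS) *: psi c.
Proof. by apply: dual_ext => d; apply: hh_Z. Qed.

(** The expansion of [g] in the basis that [comul u] provides, read in C instead of the dual. *)
Definition psiinv (g : dual I) : C := sw (fun a b => (g (a : cop_mod C) :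
    tens2 S) *: b) u.

Lemma psiK : cancel psi psiinv.
Proof. exact: hh_recl. Qed.

Lemma psiinvK : cancel psiinv psi.
Proof.
move=> g; apply: dual_ext => d; rewrite psiE /psiinv.
rewrite (addmap_sw (h := fun x => hh x d)); last by move=> x y; apply: (balDl hh_bal).
rewrite -[in RHS](hh_recr d) (addmap_sw (h := fun x : C => g (x : cop_mod C) : tens2 S));
    last first.
  by move=> x y; apply: linearD.
apply: sw_ext => a b; rewrite hh_Z.
have -> : flip (hh b d) *: a = (hh b d : SS) *: (a : I) :> C by [].
by rewrite linearZ_LR mulrC.
Qed.

Lemma psiinvD : addmap psiinv.
Proof. by move=> x y; rewrite -[x in LHS]psiinvK -[y in LHS]psiinvK -psiD psiK. Qed.

Lemma psiinvZ (a : tens2 S) g : psiinv ((a : SS) *: g) = a *: psiinv g.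
Proof. by rewrite -[g in LHS]psiinvK -psiZ psiK. Qed.

(** The first triangle factor of [comul u] gives the basis of C_21 and the second, through [psi],
    the functionals; [hh_recr] is the dual basis property. *)
Definition inv_basis_seq : seq (I * dual I) := [seq (p.1 : I,
    psi p.2) | p <- repr (comul u)].
Notation eI := (lbasis (L := inv_basis_seq)).
Notation fI := (lcobasis (L := inv_basis_seq)).

Lemma inv_basis_sum P (F : I -> dual I -> P) :
  \sum_k F (eI k) (fI k) = sw (fun a b => F a (psi b)) u.
Proof. by rewrite lbasis_sum big_map. Qed.

Lemma inv_dual_basis : dual_basis eI fI.
Proof.
move=> d; rewrite (inv_basis_sum (fun x g => (g d : SS) *: x)).
exact: (esym (hh_recr d)).
Qed.

(** * The bijection between Can(C^cop) and C (x) C^cop *)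

Notation K := (can eI fI).
Notation cnK := (cn eI fI).
Notation CC := (coring_tens C (cop C)).

Definition cq (z y : C) : CC := coring_tens_pure z (y : cop C).

Lemma cqDl y : addmap (cq^~ y). Proof. exact: cpDl. Qed.
Lemma cqDr z : addmap (cq z). Proof. by move=> x y; apply: (@cpDr _ _ _ C (cop C) z). Qed.
(** In C_13 (x) C_42 the left copy of S (x) S holds positions 1 and 2, the right copy positions 3
    and 4. *)
Lemma cq_l s t z y : left2 SS (st s t) *: cq z y = cq (l2 s *: z) (r2 t *: y).
Proof. by rewrite [LHS]cp_l cop_l. Qed.
Lemma cq_r s t z y : right2 SS (st s t) *: cq z y = cq (r2 s *: z) (l2 t *: y).
Proof. by rewrite [LHS]cp_r cop_r. Qed.
Lemma cq_str r z y : cq (l2 (i r) *: z) y = cq z (r2 (i r) *: y).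
Proof. by rewrite [LHS](balZ (cp_bal_pure C (cop C)) r) [X in coring_tens_pure _ X]cop_l.
    Qed.

Lemma cq_ext P (h k : CC -> P) : addmap h -> addmap k ->
  (forall z y, h (cq z y) = k (cq z y)) -> h =1 k.
Proof. exact: cp_ext. Qed.

(** [G] releases position 2 as a scalar [s], which is put back on the right end of [x] in C_42. *)
Definition theta_ker (x z : C) (s : S) : CC := cq z (r2 s *: x).

Lemma theta_ker_bal x : balS S (fun z (s : S^o) => theta_ker x z s).
Proof.
split=> [z z' s|z s s'|a z s]; rewrite /theta_ker.
- exact: cqDl.
- by rewrite rmorphD scalerDl cqDr.
- by rewrite cq_str rscaleA.
Qed.

Lemma theta_ker_scale s x z t : theta_ker (r2 s *: x) z t = theta_ker x z (s * t).
Proof. by rewrite /theta_ker rscaleA mulrC. Qed.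

Lemma theta_ker_gg c : bal2 S (fun x y => gg G (theta_ker x) c y).
Proof.
split=> [m m' n|m n n'|a m n].
- by apply: tlift_split => z s; rewrite /theta_ker scalerDr cqDr.
- exact: (gg_Dr hC FK GK (theta_ker_bal m)).
- by rewrite (gg_m' hC FK GK (theta_ker_bal m)); apply: gg_ext => z s;
    rewrite theta_ker_scale.
Qed.

(* C_12 (x) C_43 -> C_12 (x) C_42 (x) C_23 -> C_13 (x) C_42 *)
Definition theta0 (c d : C) : CC := sw (fun d1 d2 => gg G (theta_ker d1) c d2) d.

Lemma theta0Dr c : addmap (theta0 c). Proof. exact: (swD hL (theta_ker_gg c)). Qed.
Lemma theta0Dl d : addmap (theta0^~ d).
Proof. by move=> x y; apply: tlift_split => d1 d2;
    apply: (gg_Dl hC FK GK (theta_ker_bal d1)). Qed.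

Lemma theta0_l s t c d : theta0 (l2 s *: (r2 t *: c)) d = left2 SS (st s t) *: theta0 c d.
Proof.
rewrite /theta0 (addmap_sw (h := fun x : CC => left2 SS (st s t) *: x));
    last exact: scaler_addmap.
apply: sw_ext => d1 d2; rewrite (gg_l hC FK GK (theta_ker_bal d1)).
rewrite (gg_m hC FK GK (bal_scalel (l2 s) (theta_ker_bal d1))).
rewrite (addmap_gg (h := fun x : CC => left2 SS (st s t) *: x));
    last exact: scaler_addmap.
by apply: gg_ext => z s'; rewrite /theta_ker cq_l rscaleA.
Qed.

Lemma theta0_r s t c d : theta0 c (r2 s *: (l2 t *: d)) =
    right2 SS (st s t) *: theta0 c d.
Proof.
rewrite /theta0 (sw_r hL _ _ (theta_ker_gg c)) (sw_l hL _ _ (bal_scaler (r2 s)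
    (theta_ker_gg c))).
rewrite (addmap_sw (h := fun x : CC => right2 SS (st s t) *: x));
    last exact: scaler_addmap.
apply: sw_ext => d1 d2; rewrite (gg_r hC FK GK (theta_ker_bal _)).
rewrite (addmap_gg (h := fun x : CC => right2 SS (st s t) *: x));
    last exact: scaler_addmap.
by apply: gg_ext => z s'; rewrite /theta_ker cq_r lrC.
Qed.

Lemma ralg_tens_strl r : ralg_str SS r = l2 (i r). Proof. by []. Qed.

Definition theta1 (g : dual I) (d : I) : CC := theta0 (psiinv g) (d : C).

Lemma theta1_bal : balanced (ralg_str SS) (ralg_str SS) theta1.
Proof.
split=> [g g' d|g d d'|r g d].
- by rewrite /theta1 psiinvD theta0Dl.
- exact: theta0Dr.
- rewrite /theta1 psiinvZ ralg_tens_strl.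
  have := theta0_l (i r) 1 (psiinv g) d; rewrite rmorph1 scale1r => ->.
  rewrite -[X in _ = theta0 _ X]/(flip (l2 (i r)) *: (d : C)) flip_l.
  have := theta0_r (i r) 1 (psiinv g) d; rewrite rmorph1 scale1r => ->.
  congr (_ *: _); exact: (lr_str SS r).
Qed.

Definition theta : K -> CC := can_lift theta1.

Lemma thetaE g d : theta (cnK g d) = theta0 (psiinv g) d.
Proof. exact: (can_liftE _ _ theta1_bal). Qed.
Lemma thetaD : addmap theta. Proof. exact: (can_liftD theta1_bal). Qed.

Lemma thinv_ker_str r (c z : C) : cnK (psi (l2 (i r) *: c)) (z : I) =
    cnK (psi c) (l2 (i r) *: z : I).
Proof.
rewrite psiZ -ralg_tens_strl cnZ; congr (cnK _ _).
rewrite -[LHS]/(flip (l2 (i r)) *: (z : C)) flip_l.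
by rewrite -lr_str.
Qed.

Definition thinv_ker (x z : C) (s : S) : K := cnK (psi (r2 s *: x)) (z : I).

Lemma thinv_ker_bal x : balS S (fun z (s : S^o) => thinv_ker x z s).
Proof.
split=> [z z' s|z s s'|a z s]; rewrite /thinv_ker.
- exact: cnDr.
- by rewrite rmorphD scalerDl psiD cnDl.
- by rewrite -rscaleA -lr_str thinv_ker_str.
Qed.

Lemma thinv_ker_scale s x z t : thinv_ker (r2 s *: x) z t = thinv_ker x z (s * t).
Proof. by rewrite /thinv_ker rscaleA mulrC. Qed.

Lemma thinv_ker_gg c : bal2 S (fun x y => gg G (thinv_ker x) c y).
Proof.
split=> [m m' n|m n n'|a m n].
- by apply: tlift_split => z s; rewrite /thinv_ker scalerDr psiD cnDl.
- exact: (gg_Dr hC FK GK (thinv_ker_bal m)).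
- by rewrite (gg_m' hC FK GK (thinv_ker_bal m)); apply: gg_ext => z s;
    rewrite thinv_ker_scale.
Qed.

(** The reverse route C_13 (x) C_42 -> C_12 (x) C_23 (x) C_42 -> C_12 (x) C_43. *)
Definition thinv0 (c d : C) : K := sw (fun c1 c2 => gg G (thinv_ker c1) d c2) c.

Lemma thinv0Dl d : addmap (thinv0^~ d). Proof. exact: (swD hL (thinv_ker_gg d)). Qed.
Lemma thinv0Dr c : addmap (thinv0 c).
Proof. by move=> x y; apply: tlift_split => d1 d2;
    apply: (gg_Dl hC FK GK (thinv_ker_bal d1)). Qed.

Lemma thinv0_bal : balanced (str2 S) (str2 S) (fun (c : C) (d : cop C) => thinv0 c (d :
    C)).
Proof.
apply: bal_str => [d|c|r c d]; [exact: thinv0Dl|exact: thinv0Dr|].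
rewrite cop_l /thinv0 (sw_l hL _ _ (thinv_ker_gg d)); apply: sw_ext => c1 c2.
rewrite (gg_m hC FK GK (thinv_ker_bal _)); apply: gg_ext => z s.
by rewrite lr_str thinv_ker_scale.
Qed.

Definition thinv : CC -> K := cp_lift (fun (c : C) (d : cop C) => thinv0 c (d : C)).

Lemma thinvE c d : thinv (cq c d) = thinv0 c d.
Proof. exact: (cp_liftE thinv0_bal). Qed.
Lemma thinvD : addmap thinv. Proof. exact: (cp_liftD thinv0_bal). Qed.

Lemma thetaK : cancel theta thinv.
Proof.
apply: cn_ext => [x y|//|g d]; first by rewrite thetaD thinvD.
rewrite thetaE /theta0 (addmap_sw _ _ thinvD).
(* The target is itself obtained by splitting [d] with the coproduct and rejoining the legs with
   [G]; in this form the two sides agree term by term. *)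
have e1 : sw (gg G (thinv_ker (psiinv g))) d = cnK g d.
  by rewrite (gg_sw1 hC FK GK (thinv_ker_bal _)) /thinv_ker rmorph1 scale1r psiinvK.
rewrite -[RHS]e1; apply: sw_ext => d1 d2; rewrite (addmap_gg _ _ _ thinvD).
rewrite -[RHS](sw_gg hC GK _ _ (thinv_ker_gg d1)); apply: gg_ext => z s.
rewrite thinvE /thinv0; apply: sw_ext => z1 z2.
rewrite (gg_m hC FK GK (thinv_ker_bal _)); apply: gg_ext => w t.
by rewrite thinv_ker_scale.
Qed.

Lemma thinvK : cancel thinv theta.
Proof.
apply: cq_ext => [x y|//|c d]; first by rewrite thinvD thetaD.
rewrite thinvE /thinv0 (addmap_sw _ _ thetaD).
have e1 : sw (gg G (theta_ker d)) c = cq c d.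
  by rewrite (gg_sw1 hC FK GK (theta_ker_bal _)) /theta_ker rmorph1 scale1r.
rewrite -[RHS]e1; apply: sw_ext => c1 c2; rewrite (addmap_gg _ _ _ thetaD).
rewrite -[RHS](sw_gg hC GK _ _ (theta_ker_gg c1)); apply: gg_ext => z s.
rewrite /thinv_ker thetaE psiK /theta0; apply: sw_ext => z1 z2.
rewrite (gg_m hC FK GK (theta_ker_bal _)); apply: gg_ext => w t.
by rewrite theta_ker_scale.
Qed.

(* G is right colinear: if G (c (x) b) = sum of z (x) s, then the sum of the
   z_(1) (x) s (x) z_(2) is G (c (x) b_(1)) (x) b_(2). *)
Lemma gg_colinear P (Y : C -> S -> C -> P) c b :
  (forall y, balS S (fun z (s : S^o) => Y z s y)) -> (forall z s, addmap (Y z s)) ->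
  (forall t z s y, Y (r2 t *: z) s y = Y z s (l2 t *: y)) ->
  gg G (fun z s => sw (fun z1 z2 => Y z1 s z2) z) c b =
  sw (fun b1 b2 => gg G (fun z s => Y z s b2) c b1) b.
Proof.
move=> Yb YD YZ.
have tT : trilin (fun x b1 b2 => gg G (fun z s => Y z s b2) x b1).
  split=> x; first exact: gb (Yb x).
  split=> [m m' n|m n n'|t m n].
  - exact: (gg_Dr hC FK GK (Yb n)).
  - by apply: tlift_split => z s; apply: YD.
  - by rewrite (gg_r hC FK GK (Yb n)); apply: gg_ext => z s; rewrite YZ.
rewrite -[RHS](sw_gg hC GK _ _ (trilin_sw2 hL tT)); apply: gg_ext => z s.
rewrite -(sw_assoc hC z (trilin_scale1 (r2 s) tT)); apply: sw_ext => z1 z2.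
by rewrite (gg_sw hC FK GK (Yb z2)).
Qed.

(** * Compatibility of the bijection with the coproducts *)

Notation CCM := (coring_tens_mod C (cop C)).

Definition cq2 (a b a' b' : C) : tensS CCM CCM :=
  tpure (right2 SS) (left2 SS) (cq a b) (cq a' b').

Lemma cq2_D2 a a' b' : addmap (fun b => cq2 a b a' b').
Proof. by move=> x y; rewrite /cq2 cqDr tpureDl. Qed.
Lemma cq2_D3 a b b' : addmap (fun a' => cq2 a b a' b').
Proof. by move=> x y; rewrite /cq2 cqDl tpureDr. Qed.
Lemma cq2_D4 a b a' : addmap (cq2 a b a').
Proof. by move=> x y; rewrite /cq2 cqDr tpureDr. Qed.

Lemma cq2_Z13 t a b a' b' : cq2 (r2 t *: a) b a' b' = cq2 a b (l2 t *: a') b'.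
Proof.
have := tpureZ (right2 SS) (left2 SS) (st t 1) (cq a b) (cq a' b').
by rewrite cq_l [X in tpure _ _ X]cq_r !rmorph1 !scale1r.
Qed.

Lemma cq2_Z24 t a b a' b' : cq2 a (l2 t *: b) a' b' = cq2 a b a' (r2 t *: b').
Proof.
have := tpureZ (right2 SS) (left2 SS) (st 1 t) (cq a b) (cq a' b').
by rewrite cq_l [X in tpure _ _ X]cq_r !rmorph1 !scale1r.
Qed.

Lemma hCC : is_coring CC.
Proof. exact: (coring_tens_is_coring hC (cop_is_coring hC)). Qed.

Lemma cq2_bal a a' : bal2 S (fun p q => cq2 a q a' p).
Proof.
split=> [m m' n|m n n'|t m n]; [exact: cq2_D4|exact: cq2_D2|].
by rewrite cq2_Z24.
Qed.

Lemma comul_cq z y : comul (cq z y) =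
  sw (fun z1 z2 => sw (fun p q => cq2 z1 q z2 p) y) z.
Proof.
rewrite [LHS](comul_cp hL (cop_linear hC)); apply: sw_ext => z1 z2.
rewrite sw_cop //.
exact: (bal_cpr _ _ (tpure_balanced (right2 SS) (left2 SS) CCM CCM)).
Qed.

Lemma cq2_ker_bal q p b : balS S (fun z (s : S^o) => cq2 z (r2 s *: q) b p).
Proof.
exact: (bal_comp (fun x y => tpureDl (right2 SS) (left2 SS) (cq b p) x y) (theta_ker_bal
    q)).
Qed.

(** [p], [q], [b1], [b2] will be the four legs of an iterated coproduct of [d]: [G] joins [c] to
    [b1], [q] takes the released scalar, and [b2] and [p] form the second factor. *)
Definition gg_cq2 (c p q b1 b2 : C) := gg G (fun z s => cq2 z (r2 s *: q) b2 p) c b1.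

Lemma gg_cq2_trilin c p : trilin (gg_cq2 c p).
Proof.
have kb q b : balS S (fun z (s : S^o) => cq2 z (r2 s *: q) b p) by apply: cq2_ker_bal.
split=> x; split=> [m m' n|m n n'|t m n].
- by apply: tlift_split => z s; rewrite scalerDr cq2_D2.
- exact: (gg_Dr hC FK GK (kb _ _)).
- rewrite /gg_cq2 (gg_m' hC FK GK (kb _ _)); apply: gg_ext => z s.
  by rewrite rscaleA mulrC.
- exact: (gg_Dr hC FK GK (kb _ _)).
- by apply: tlift_split => z s; rewrite cq2_D3.
- rewrite /gg_cq2 (gg_r hC FK GK (kb _ _)); apply: gg_ext => z s.
  by rewrite cq2_Z13.
Qed.

(* The common value, summed over d = d_(1) (x) d_(2) with p = d_(1) and e = d_(2),
   of the two sides of comul_theta0. *)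
Definition sw_gg_cq2 c p e := sw (fun q b => sw (fun b1 b2 => gg_cq2 c p q b1 b2) b) e.

Lemma sw_gg_cq2D c p : addmap (sw_gg_cq2 c p).
Proof. exact: (swD hL (trilin_sw2 hL (gg_cq2_trilin c p))). Qed.

Lemma gg_cq2_l c p t q b1 b2 : gg_cq2 c p (l2 t *: q) b1 b2 =
    gg_cq2 c (r2 t *: p) q b1 b2.
Proof. by apply: gg_ext => z s; rewrite lrC cq2_Z24. Qed.

Lemma gg_cq2_kbal c p a b : balS S (fun w (t : S^o) => gg_cq2 c p (l2 t *: a) b w).
Proof.
have tW := gg_cq2_trilin c p.
split=> [m m' n|m n n'|t m n].
- exact: (balDr (tri23 tW _)).
- by rewrite rmorphD scalerDl (balDl (tri12 tW _)).
- rewrite -[str2 S t]/(l2 (i t)) -(balZ (tri23 tW _)) -lr_str -(balZ (tri12 tW _)).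
  by rewrite -lr_str lscaleA.
Qed.

(** Used from right to left, it inserts the coproduct of [u]. The proof removes it again: u (x) e is
    rewritten as a sum of v_(1) r (x) v_(2), and what remains collapses by counit(u) = 1. *)
Lemma sw_gg_cq2_counit c p e :
  sw (fun u1 u2 => sw (fun a b => gg G (fun w t =>
      gg_cq2 c p (l2 t *: a) b w) u2 e) u1) u =
  sw_gg_cq2 c p e.
Proof.
have tW := gg_cq2_trilin c p.
have tV y : trilin (fun a b x => gg G (fun w t => gg_cq2 c p (l2 t *: a) b w) x y).
  split=> x.
  - by apply: bal_param => w t; exact: (bal_scalel (l2 t) (tri12 tW w)).
  - split=> [m m' n|m n n'|r m n].
    + by apply: tlift_split => w t; apply: (balDl (tri23 tW _)).
    + exact: (gg_Dl hC FK GK (gg_cq2_kbal c p _ _)).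
    + rewrite (gg_l hC FK GK (gg_cq2_kbal c p _ _)); apply: gg_ext => w t.
      by rewrite (balZ (tri23 tW _)).
pose Q x1 x2 y := sw (fun a b => gg G (fun w t => gg_cq2 c p (l2 t *: a) b w) x2 y) x1.
have tQ : trilin Q.
  split=> x; first exact: (trilin_sw1 hL (tV x)).
  by apply: bal_param => a b; apply: gb (gg_cq2_kbal c p a b).
have idD := sw_gg_cq2D c p.
transitivity (gg G (fun v r => sw_gg_cq2 c p (l2 r *: v)) u e); last first.
  by rewrite (counit_gg_l u e idD) u1 rmorph1 scale1r.
rewrite -[LHS]/((fun x y => sw (fun a b => Q a b y) x) u e).
rewrite -[LHS](sw_gg hC GK _ _ (trilin_sw1 hL tQ)); apply: gg_ext => v r.
transitivity (sw (fun v1 v2 => sw (fun a b => Q a (r2 r *: b) v2) v1) v).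
  by apply: sw_ext => v1 v2; rewrite (sw_r hL _ _ (tri12 tQ v2)).
rewrite (sw_assoc hC v (trilin_scale2 (r2 r) tQ)).
rewrite /sw_gg_cq2 -(sw_assoc hC _ tW) (sw_l hL _ _ (trilin_sw1 hL tW)).
apply: sw_ext => v1 v2.
rewrite (sw_l hL _ _ (tri12 tW v2)) /Q [LHS]tlift_exchange; apply: sw_ext => a b.
exact: (gg_sw hC FK GK (gg_cq2_kbal c p a b)).
Qed.

Lemma gg_cq2_pq_bal c b1 b2 : bal2 S (fun p q => gg_cq2 c p q b1 b2).
Proof.
split=> [m m' n|m n n'|t m n].
- by apply: tlift_split => z s; rewrite cq2_D4.
- exact: (balDl (tri12 (gg_cq2_trilin c m) b2)).
- by rewrite gg_cq2_l.
Qed.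

(** Colinearity of [G] turns the coproduct of [z] into one of the second leg of [d]; coassociativity
    then regroups the legs. *)
Lemma comul_theta0_lhs c d :
  comul (theta0 c d) = sw (fun p e => sw_gg_cq2 c p e) d.
Proof.
have cD := comulD (comul_linear hCC).
rewrite /theta0 (addmap_sw _ _ cD).
transitivity (sw (fun d1 d2 => sw (fun p q => sw (fun b1 b2 =>
    gg_cq2 c p q b1 b2) d2) d1) d).
  apply: sw_ext => d1 d2; rewrite (addmap_gg _ _ _ cD).
  transitivity (gg G (fun z s => sw (fun p q => sw (fun z1 z2 =>
      cq2 z1 (r2 s *: q) z2 p) z) d1) c d2).
    apply: gg_ext => z s; rewrite /theta_ker comul_cq [RHS]tlift_exchange;
        apply: sw_ext => z1 z2.
    by rewrite (sw_r hL _ _ (cq2_bal z1 z2)).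
  rewrite [LHS]tlift_exchange; apply: sw_ext => p q.
  rewrite -/(gg _ _ _ _); apply: (gg_colinear (Y := fun z s y => cq2 z (r2 s *: q) y p)).
  - by move=> y; apply: cq2_ker_bal.
  - by move=> z s; apply: cq2_D3.
  - by move=> t z s y; apply: cq2_Z13.
rewrite (sw_assoc hC d (T := fun p q b => sw (fun b1 b2 => gg_cq2 c p q b1 b2) b)) //.
split=> x; last exact: (trilin_sw2 hL (gg_cq2_trilin c x)).
by apply: bal_param => b1 b2; apply: gg_cq2_pq_bal.
Qed.

(** The right side is the coproduct of the elementary coring, for the dual basis taken from
    [comul u]. *)
Lemma comul_theta0 c d :
  comul (theta0 c d) =
  sw (fun u1 u2 => tpure (right2 SS) (left2 SS) (theta0 c u1) (theta0 u2 d)) u.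
Proof.
rewrite comul_theta0_lhs.
transitivity (sw (fun p e => sw (fun u1 u2 => sw (fun a b =>
    gg G (fun w t => gg_cq2 c p (l2 t *: a) b w) u2 e) u1) u) d).
  by apply: sw_ext => p e; rewrite sw_gg_cq2_counit.
rewrite [LHS]tlift_exchange; apply: sw_ext => u1' u2'.
rewrite [LHS]tlift_exchange.
rewrite {2}/theta0 (addmap_sw (h := fun x : CCM =>
    tpure (right2 SS) (left2 SS) x (theta0 u2' d)));
  last by move=> x y; rewrite tpureDl.
apply: sw_ext => a b.
rewrite /theta0 (addmap_sw (h := fun y : CCM =>
    tpure (right2 SS) (left2 SS) (gg G (theta_ker a) c b : CCM) y));
  last by move=> x y; rewrite tpureDr.
apply: sw_ext => p e.
rewrite (addmap_gg (h := fun y : CCM => tpure (right2 SS) (left2 SS) (gg G (theta_ker a)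
    c b : CCM) y));
  last by move=> x y; rewrite tpureDr.
apply: gg_ext => w t; rewrite gg_cq2_l /gg_cq2.
rewrite (addmap_gg (h := fun x : CCM => tpure (right2 SS) (left2 SS) x (theta_ker p w t :
    CCM)));
  last by move=> x y; rewrite tpureDl.
by apply: gg_ext => z s.
Qed.

Lemma theta_l x k : theta (left2 SS x *: k) = left2 SS x *: theta k.
Proof.
move: k; apply: (@cn_ext _ _ _ _ _ _ _ (fun k => theta (left2 SS x *: k)) (fun k =>
    left2 SS x *: theta k))
  => [k k'|k k'|g d]; rewrite ?scalerDr ?thetaD ?scalerDr //.
rewrite cn_l !thetaE psiinvZ.
elim/tens2_ind: x => [|x y IHx IHy|s t].
- by rewrite scale0r rmorph0 scale0r (addmap0 (theta0Dl d)).
- by rewrite scalerDl theta0Dl IHx IHy rmorphD scalerDl.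
- by rewrite -scalerA theta0_l rpure_lr.
Qed.

Lemma theta_r x k : theta (right2 SS x *: k) = right2 SS x *: theta k.
Proof.
move: k; apply: (@cn_ext _ _ _ _ _ _ _ (fun k => theta (right2 SS x *: k)) (fun k =>
    right2 SS x *: theta k))
  => [k k'|k k'|g d]; rewrite ?scalerDr ?thetaD ?scalerDr //.
rewrite cn_r !thetaE -[X in theta0 _ X = _]/(flip x *: (d : C)).
elim/tens2_ind: x => [|x y IHx IHy|s t].
- by rewrite !rmorph0 !scale0r (addmap0 (theta0Dr _)).
- by rewrite !rmorphD !scalerDl theta0Dr IHx IHy.
- by rewrite rmorphM flip_l flip_r -scalerA theta0_r rpure_lr.
Qed.

Lemma theta_iso : coring_iso (C := K) (D := CC) idfun theta.
Proof.
split.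
- by exists id.
- by [].
- exact: thetaD.
- by exists thinv; [exact: thetaK|exact: thinvK].
- exact: theta_l.
- exact: theta_r.
- have tb := iso_bal (C := K) (D := CC) (f := idfun) thetaD theta_l theta_r
    (tpure_balanced (right2 SS) (left2 SS) CCM CCM).
  have kL := comul_linear (can_is_coring inv_dual_basis).
  apply: cn_ext => [x y|x y|g d].
  + by rewrite thetaD (comulD (comul_linear hCC)).
  + by rewrite (swD kL tb).
  rewrite thetaE comul_theta0 (sw_cn _ _ tb).
  rewrite (inv_basis_sum (fun x h => tpure (right2 SS) (left2 SS) (theta (cnK g x))
      (theta (cnK h d)))).
  by apply: sw_ext => a b; rewrite !thetaE psiK.
Qed.

End Inverse.

Lemma elementary_inverse (R : comPzRingType) (S : ralg R) (C : coring_data S) :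
  azumaya_over C ->
  exists (I : lmodType (ralg_tens S S)) (n : nat) (e : 'I_n -> I) (f : 'I_n ->
      dual I) theta,
    [/\ invertible I, dual_basis e f
      & coring_iso (C := can e f) (D := coring_tens C (cop C)) idfun theta].
Proof.
move=> /azumaya_overP [hC pC [G FK GK]].
have [u u1] := exists_counit1 hC pC.
do 5 eexists; split; last exact: (theta_iso hC FK GK u1).
- apply/(@invertibleP (ralg_tens S S)); do 3 eexists.
  exact: (cop_pairing hC FK GK u1).
- exact: inv_dual_basis.
Qed.

(** * The Brauer group *)

Section Brauer.
Variable R : comPzRingType.
Implicit Types X Y Z E : azumaya_coring R.

Notation "X ~= Y" := (cpair_iso (az_pair X) (az_pair Y)) (at level 70).

Lemma az_is_coring X : is_coring (ccoring X).
Proof. by case: (az_axiom X) => _ _ []. Qed.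

Definition az_tens X Y : azumaya_coring R :=
  AzumayaCoring (is_azumaya_tens (az_axiom X) (az_axiom Y)).

Definition az_unit : azumaya_coring R := AzumayaCoring (unit_is_azumaya R).

Lemma az_refl X : X ~= X. Proof. exact: cpair_iso_refl. Qed.
Lemma az_sym X Y : X ~= Y -> Y ~= X. Proof. exact: cpair_iso_sym. Qed.
Lemma az_trans Y X Z : X ~= Y -> Y ~= Z -> X ~= Z. Proof. exact: cpair_iso_trans. Qed.

Lemma az_tens_iso X X' Y Y' : X ~= X' -> Y ~= Y' -> az_tens X Y ~= az_tens X' Y'.
Proof.
have := (az_is_coring X, az_is_coring X', az_is_coring Y, az_is_coring Y').
case: X X' Y Y' => [[S C] ?] [[S' C'] ?] [[T D] ?] [[T' D'] ?] /= [[[? ?] ?] ?].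
exact: cpair_iso_tens.
Qed.

Lemma az_tensC X Y : az_tens X Y ~= az_tens Y X.
Proof. exact: (cpair_iso_comm (az_is_coring X) (az_is_coring Y)). Qed.

Lemma az_tensA X Y Z : az_tens (az_tens X Y) Z ~= az_tens X (az_tens Y Z).
Proof. exact: (cpair_iso_assoc (az_is_coring X) (az_is_coring Y) (az_is_coring Z)). Qed.

Lemma az_tens1 X : az_tens az_unit X ~= X.
Proof.
have := az_is_coring X; case: X => [[S C] ?] /= hC.
exact: cpair_iso_unit.
Qed.

Lemma az_tensAC X Y Z : az_tens (az_tens X Y) Z ~= az_tens (az_tens X Z) Y.
Proof.
apply: az_trans (az_tensA X Y Z) _; apply: az_trans (az_sym (az_tensA X Z Y)).
exact: az_tens_iso (az_refl _) (az_tensC _ _).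
Qed.

(* Isomorphic to an elementary coring: unlike is_elementary, this is stable
   under tensor products and isomorphisms. *)
Definition az_split X : Prop := exists E, is_elementary E /\ X ~= E.

Lemma az_split_iso X Y : X ~= Y -> az_split Y -> az_split X.
Proof. by move=> XY [E [eE YE]]; exists E; split=> //; apply: az_trans XY YE. Qed.

Lemma az_split_unit : az_split az_unit.
Proof.
have ax : is_azumaya (Cpair (can (@ebase1 R) (@cobase1 R))).
  have [ff fp ao] := unit_is_azumaya R; split=> //.
  exact: (azumaya_over_iso (ucan_iso R) (can_is_coring (@dual_basis1 R)) ao).
exists (AzumayaCoring ax); split.
  exists (ralg_id R), (R^o : lmodType R), 1%N, (@ebase1 R), (@cobase1 R).
  by split; [exact: invertible1|exact: dual_basis1|].
by apply/cpair_isoP; exists idfun, (@ucan R); apply: ucan_iso.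
Qed.

Lemma az_split_elementary E1 E2 : is_elementary E1 -> is_elementary E2 ->
  az_split (az_tens E1 E2).
Proof.
case: E1 E2 => [p1 ax1] [p2 ax2] [S [I [n [e [f [vI ef /= E1]]]]]].
move=> [T [J [n' [e' [f' [vJ ef' /= E2]]]]]]; subst p1 p2.
have iso := canmap_iso ef ef'; have db := tens_dual_basis ef ef'.
have ax : is_azumaya (Cpair (can (lbasis (L := tens_basis_seq e f e' f'))
    (lcobasis (L := tens_basis_seq e f e' f')))).
  have [ff fp ao] := is_azumaya_tens ax1 ax2; split=> //.
  exact: (azumaya_over_iso iso (can_is_coring db) ao).
exists (AzumayaCoring ax); split.
  do 5 eexists; split; [|exact: db|by []].
  exact: invertible_tens.
by apply/cpair_isoP; do 2 eexists; exact: iso.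
Qed.

Lemma az_split_tens X Y : az_split X -> az_split Y -> az_split (az_tens X Y).
Proof.
move=> [E [eE XE]] [E' [eE' YE']]; apply: az_split_iso (az_split_elementary eE eE').
exact: az_tens_iso.
Qed.

Lemma az_inverse X : exists Y, az_split (az_tens X Y).
Proof.
case: X => [[S C] ax]; have [ff fp ao] := ax.
have axY : is_azumaya (Cpair (cop C)) by split=> //; apply: azumaya_over_cop.
exists (AzumayaCoring axY).
have [I [n [e [f [th [vI ef iso]]]]]] := elementary_inverse ao.
have [th' thK thK'] := ci_pbij iso.
have iso' : coring_iso (C := coring_tens C (cop C)) (D := can e f) idfun th'.
  exact: coring_iso_inv iso.
(* The elementary coring is Azumaya because C (x) C^cop is. *)
have axE : is_azumaya (Cpair (can e f)).
  have [ff2 fp2 ao2] := is_azumaya_tens ax axY; split=> //.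
  exact: (azumaya_over_iso iso' (can_is_coring ef) ao2).
exists (AzumayaCoring axE); split; first by exists (ralg_tens S S), I, n, e, f.
by apply/cpair_isoP; exists idfun, th'.
Qed.

(** The isomorphisms of [E1] and [E2] with elementary corings are absorbed into the tensor
    products. *)
Lemma brauer_equivP X Y : brauer_equiv X Y <->
  exists E1 E2, [/\ az_split E1, az_split E2 & az_tens X E1 ~= az_tens Y E2].
Proof.
split=> [[E1 [E2 [e1 e2 iso]]]|[E1 [E2 [[E1' [e1 i1]] [E2' [e2 i2]] iso]]]].
  by exists E1, E2; split=> //; [exists E1|exists E2]; split=> //; apply: az_refl.
exists E1', E2'; split=> //; change (az_tens X E1' ~= az_tens Y E2').
apply: az_trans (az_tens_iso (az_refl X) (az_sym i1)) _.
exact: az_trans iso (az_tens_iso (az_refl Y) i2).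
Qed.

Lemma iso_brauer X Y : X ~= Y -> brauer_equiv X Y.
Proof.
move=> XY; apply/brauer_equivP; exists az_unit, az_unit.
by split; [exact: az_split_unit|exact: az_split_unit|exact: az_tens_iso XY (az_refl _)].
Qed.

Lemma brauer_refl X : brauer_equiv X X.
Proof. exact: iso_brauer (az_refl X). Qed.

Lemma brauer_sym X Y : brauer_equiv X Y -> brauer_equiv Y X.
Proof.
by move=> [E1 [E2 [e1 e2 iso]]]; exists E2, E1; split=> //; apply: cpair_iso_sym.
Qed.

Lemma brauer_trans Y X Z : brauer_equiv X Y -> brauer_equiv Y Z -> brauer_equiv X Z.
Proof.
move=> /brauer_equivP [E1 [E2 [s1 s2 XY]]] /brauer_equivP [E3 [E4 [s3 s4 YZ]]].
(* In product notation, X E1 E3 = Y E2 E3 = Y E3 E2 = Z E4 E2 up to isomorphism. *)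
apply/brauer_equivP; exists (az_tens E1 E3), (az_tens E4 E2).
split; try exact: az_split_tens.
apply: az_trans (az_sym (az_tensA _ _ _)) _; apply: az_trans (az_tensA _ _ _).
apply: az_trans (az_tens_iso XY (az_refl _)) _.
apply: az_trans (az_tensAC _ _ _) _; exact: az_tens_iso YZ (az_refl _).
Qed.

Lemma brauer_tens X X' Y Y' : brauer_equiv X X' -> brauer_equiv Y Y' ->
  brauer_equiv (az_tens X Y) (az_tens X' Y').
Proof.
have ACA A B C D : az_tens (az_tens A B) (az_tens C D) ~= az_tens (az_tens A C) (az_tens
    B D).
  apply: az_trans (az_sym (az_tensA _ _ _)) _; apply: az_trans (az_tensA _ _ _).
  exact: az_tens_iso (az_tensAC _ _ _) (az_refl _).
move=> /brauer_equivP [E1 [E2 [s1 s2 XX]]] /brauer_equivP [E3 [E4 [s3 s4 YY]]].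
apply/brauer_equivP; exists (az_tens E1 E3), (az_tens E2 E4).
split; try exact: az_split_tens.
apply: az_trans (ACA _ _ _ _) _; apply: az_trans (ACA _ _ _ _).
exact: az_tens_iso.
Qed.

Lemma brauer_split X : az_split X -> brauer_equiv X az_unit.
Proof.
(* The split coring [X] is its own witness: X (x) 1 is isomorphic to 1 (x) X. *)
move=> sX; apply/brauer_equivP; exists az_unit, X; split=> //; first exact: az_split_unit.
exact: az_tensC.
Qed.

Lemma brauer_cls_eq X Y : brauer_equiv X Y -> brauer_cls X = brauer_cls Y.
Proof.
move=> XY; have e : brauer_equiv X = brauer_equiv Y.
  apply: funext => Z; apply: propext; split; apply: brauer_trans => //.
  exact: brauer_sym.
rewrite /brauer_cls; move: (ex_intro _ X _) (ex_intro _ Y _); rewrite e => p q.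
by rewrite (Prop_irrelevance p q).
Qed.

Lemma brauer_clsE X Y : brauer_cls X = brauer_cls Y -> brauer_equiv X Y.
Proof.
move=> /(congr1 (@brauer_class R)) /= /(congr1 (@^~ Y)) ->; exact: brauer_refl.
Qed.

Lemma brauer_cls_surj (a : brauer_fl R) : exists X, a = brauer_cls X.
Proof.
case: a => c p; have [X cX] := p; exists X; rewrite /brauer_cls; subst c.
by congr BrauerFl; apply: Prop_irrelevance.
Qed.

End Brauer.

Theorem proposition6p3 (R : comPzRingType) :
  exists (zero : brauer_fl R) (opp : brauer_fl R -> brauer_fl R)
         (add : brauer_fl R -> brauer_fl R -> brauer_fl R),
    [/\ associative add,
        commutative add,
        left_id zero add
      & left_inverse zero opp add] /\
    (forall X Y : azumaya_coring R,
       exists Z : azumaya_coring R,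
         az_pair Z = cpair_tens X Y /\
         add (brauer_cls X) (brauer_cls Y) = brauer_cls Z) /\
    (exists U : azumaya_coring R,
       az_pair U = cpair_unit R /\ zero = brauer_cls U).
Proof.
(* The operations act on chosen representatives; [addE] shows that the choice does not affect
   sums. *)
pose rep (a : brauer_fl R) := projT1 (cid (brauer_cls_surj a)).
have repK a : brauer_cls (rep a) = a by rewrite /rep; case: cid.
have repE (X : azumaya_coring R) : brauer_equiv (rep (brauer_cls X)) X by apply:
    brauer_clsE; rewrite repK.
pose inv (X : azumaya_coring R) := projT1 (cid (az_inverse X)).
have invP (X : azumaya_coring R) : az_split (az_tens X (inv X)) by rewrite /inv;
    case: cid.
pose add a b := brauer_cls (az_tens (rep a) (rep b)).
pose opp a := brauer_cls (inv (rep a)).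
have addE (X Y : azumaya_coring R) : add (brauer_cls X) (brauer_cls Y) =
    brauer_cls (az_tens X Y).
  by apply: brauer_cls_eq; apply: brauer_tens; apply: repE.
exists (brauer_cls (az_unit R)), opp, add; split; last split.
- split.
  + move=> a b c; rewrite -(repK a) -(repK b) -(repK c) !addE.
    by apply: brauer_cls_eq; apply: brauer_sym; apply: iso_brauer; apply: az_tensA.
  + move=> a b; apply: brauer_cls_eq; apply: iso_brauer; exact: az_tensC.
  + move=> a; rewrite -(repK a) addE.
    by apply: brauer_cls_eq; apply: iso_brauer; apply: az_tens1.
  + move=> a; rewrite /opp -[a in X in add _ X]repK addE; apply: brauer_cls_eq.
    apply: brauer_trans (iso_brauer (az_tensC _ _)) _.
    exact: brauer_split.
- by move=> X Y; exists (az_tens X Y); split=> //; apply: addE.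
- by exists (az_unit R).
Qed.
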